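(* Let $V$ be a braided vector space over $\mathbb{C}$ and let $N\ge 2$ be an integer such that $H_0(B_N,V^{\otimes N})=0$. Then $H_i(B_n,V^{\otimes n})=0$ for all $(n,i)$ with $i\le \frac{n+1}{N+1}-1$; in particular $H_i(B_n,V^{\otimes n})$ vanishes with slope $\frac{1}{N+1}$.
   Context: A braided vector space $(V,R)$ over $\mathbb{C}$ is a finite-dimensional $\mathbb{C}$-vector space $V$ with a linear isomorphism $R\colon V\otimes V\to V\otimes V$ satisfying $(R\otimes \mathrm{id})(\mathrm{id}\otimes R)(R\otimes \mathrm{id})=(\mathrm{id}\otimes R)(R\otimes \mathrm{id})(\mathrm{id}\otimes R)$. $B_n$ is the Artin braid group on $n$ strands with standard generators $\sigma_1,\dots,\sigma_{n-1}$; it acts on $V^{\otimes n}$ with $\sigma_j$ acting by $R$ on the $j$-th and $(j+1)$-th tensor factors. $H_i(B_n,V^{\otimes n})$ is group homology; $n\ge 1$ and $i\ge 0$ are integers. One says that $H_i(B_n,V^{\otimes n})$ vanishes with slope $s$ if there is a constant $t$ such that $H_i(B_n,V^{\otimes n})=0$ for all $(n,i)$ with $i\le sn+t$. *)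

(* Defs.v *)
From HB Require Import structures.
From mathcomp Require Import all_boot all_order all_algebra.
From mathcomp Require Import finmap.
From mathcomp.multinomials Require Import monalg.
From mathcomp Require Import boolp reals.
From mathcomp Require Import complex zify.

Set Implicit Arguments.
Unset Strict Implicit.
Unset Printing Implicit Defensive.

Import GRing.Theory Num.Theory.
Local Open Scope ring_scope.
Local Open Scope quotient_scope.

Section BraidGroup.
Variable n : nat.

(* Strands are numbered from 0, so j : 'I_n.-1 stands for the generator that is *)
(* sigma_(j+1) in 1-based notation; (j, true) is this generator and (j, false)  *)
(* its inverse.                                                                 *)
Definition braid_word : Type := seq ('I_n.-1 * bool).
HB.instance Definition _ := Choice.copy braid_word (seq ('I_n.-1 * bool)).

Local Notation s j := (j, true).

Inductive braid_eq : braid_word -> braid_word -> Prop :=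
| braid_eq_refl u : braid_eq u u
| braid_eq_sym u v : braid_eq u v -> braid_eq v u
| braid_eq_trans u v w : braid_eq u v -> braid_eq v w -> braid_eq u w
| braid_eq_cat u u' v v' :
    braid_eq u u' -> braid_eq v v' -> braid_eq (u ++ v) (u' ++ v')
| braid_eq_cancel j b : braid_eq [:: (j, b); (j, ~~ b)] [::]
| braid_eq_comm (j k : 'I_n.-1) : (j.+1 < k)%N -> braid_eq [:: s j; s k] [:: s k; s j]
| braid_eq_braid (j k : 'I_n.-1) : k = j.+1 :> nat ->
    braid_eq [:: s j; s k; s j] [:: s k; s j; s k].

Definition braid_eqb (u v : braid_word) : bool := `[< braid_eq u v >].

Lemma braid_eqb_equiv : equiv_class_of braid_eqb.
Proof.
split=> [u|u v|v u w].
- exact/asboolP/braid_eq_refl.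
- by apply/asboolP/asboolP => /braid_eq_sym.
- move=> /asboolP uv /asboolP vw; apply/asboolP; exact: braid_eq_trans vw.
Qed.

Canonical braid_eqb_equivrel := EquivRelPack braid_eqb_equiv.

Definition braid_group : Type := {eq_quot braid_eqb}.
HB.instance Definition _ := Choice.on braid_group.
HB.instance Definition _ : EqQuotient braid_word braid_eqb braid_group :=
  EqQuotient.on braid_group.

Definition braid_of_word (u : braid_word) : braid_group := \pi_braid_group u.

Lemma braid_of_wordP u v : braid_of_word u = braid_of_word v <-> braid_eq u v.
Proof.
split=> [/eqmodP/asboolP //|uv]; exact/eqmodP/asboolP.
Qed.

Lemma braid_repr u : braid_eq (repr (braid_of_word u)) u.
Proof. by apply/braid_of_wordP; rewrite /braid_of_word reprK. Qed.

Definition word_inv (u : braid_word) : braid_word :=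
  [seq (x.1, ~~ x.2) | x <- rev u].

Lemma word_inv_cat u v : word_inv (u ++ v) = word_inv v ++ word_inv u.
Proof. by rewrite /word_inv rev_cat map_cat. Qed.

Lemma word_invK : involutive word_inv.
Proof.
move=> u; rewrite /word_inv -map_rev revK -map_comp map_id_in // => -[j b] _ /=.
by rewrite negbK.
Qed.

Lemma word_mulV u : braid_eq (u ++ word_inv u) [::].
Proof.
elim: u => [|[j b] u IH]; first exact: braid_eq_refl.
rewrite -cat1s word_inv_cat catA -(catA [:: _]).
have h : braid_eq ([:: (j, b)] ++ [::] ++ word_inv [:: (j, b)]) [::].
  exact: braid_eq_cancel.
apply: braid_eq_trans h; rewrite -catA; apply: braid_eq_cat.
  exact: braid_eq_refl.
by apply: braid_eq_cat => //; exact: braid_eq_refl.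
Qed.

Lemma word_mulVl u : braid_eq (word_inv u ++ u) [::].
Proof. by have := word_mulV (word_inv u); rewrite word_invK. Qed.

Lemma word_inv_eq u v : braid_eq u v -> braid_eq (word_inv u) (word_inv v).
Proof.
move=> uv.
have h1 : braid_eq (word_inv u ++ v ++ word_inv v) (word_inv u).
  rewrite -{2}[word_inv u]cats0; apply: braid_eq_cat; first exact: braid_eq_refl.
  exact: word_mulV.
have h2 : braid_eq (word_inv u ++ v ++ word_inv v) (word_inv v).
  rewrite catA -{2}[word_inv v]cat0s; apply: braid_eq_cat; last exact: braid_eq_refl.
  apply: braid_eq_trans (word_mulVl u); apply: braid_eq_cat.
    exact: braid_eq_refl.
  exact: braid_eq_sym.
exact: braid_eq_trans (braid_eq_sym h1) h2.
Qed.

Definition braid_one : braid_group := braid_of_word [::].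
Definition braid_mul (x y : braid_group) : braid_group :=
  braid_of_word (repr x ++ repr y).
Definition braid_inv (x : braid_group) : braid_group :=
  braid_of_word (word_inv (repr x)).

Lemma braid_mulE u v :
  braid_mul (braid_of_word u) (braid_of_word v) = braid_of_word (u ++ v).
Proof. by apply/braid_of_wordP/braid_eq_cat; exact: braid_repr. Qed.

Lemma braid_invE u : braid_inv (braid_of_word u) = braid_of_word (word_inv u).
Proof. by apply/braid_of_wordP/word_inv_eq; exact: braid_repr. Qed.

Lemma braid_wordE x : exists u, x = braid_of_word u.
Proof. by exists (repr x); rewrite /braid_of_word reprK. Qed.

Lemma braid_mulA : associative braid_mul.
Proof.
move=> x y z; have [u ->] := braid_wordE x; have [v ->] := braid_wordE y.
by have [w ->] := braid_wordE z; rewrite !braid_mulE catA.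
Qed.

Lemma braid_mul1 : left_id braid_one braid_mul.
Proof. by move=> x; have [u ->] := braid_wordE x; rewrite braid_mulE. Qed.

Lemma braid_mulx1 : right_id braid_one braid_mul.
Proof. by move=> x; have [u ->] := braid_wordE x; rewrite braid_mulE cats0. Qed.

Lemma braid_mulVx : left_inverse braid_one braid_inv braid_mul.
Proof.
move=> x; have [u ->] := braid_wordE x; rewrite braid_invE braid_mulE.
exact/braid_of_wordP/word_mulVl.
Qed.

Lemma braid_mulxV : right_inverse braid_one braid_inv braid_mul.
Proof.
move=> x; have [u ->] := braid_wordE x; rewrite braid_invE braid_mulE.
exact/braid_of_wordP/word_mulV.
Qed.

HB.instance Definition _ := isGroup.Build braid_group
  braid_mulA braid_mul1 braid_mulx1 braid_mulVx braid_mulxV.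

Definition sigma (j : 'I_n.-1) : braid_group := braid_of_word [:: s j].

End BraidGroup.

Section TensorPower.
Variables (K : fieldType) (V : vectType K).

(* V^{(x) n} in coordinates: an element assigns a coefficient to each           *)
(* multi-index t : 'I_n -> 'I_(\dim V), i.e. to each pure tensor of vectors of  *)
(* the basis vbasis fullv. The lemmas tens_multilinear and tens_universal       *)
(* below show that it satisfies the universal property of V^{(x) n}.            *)
Definition mindex (n : nat) : Type := {ffun 'I_n -> 'I_(\dim {:V})}.
HB.instance Definition _ (n : nat) := Finite.on (mindex n).

Definition tpow (n : nat) : Type := {ffun mindex n -> K^o}.
HB.instance Definition _ (n : nat) := Vector.on (tpow n).

Definition tens n (v : {ffun 'I_n -> V}) : tpow n :=
  [ffun t : mindex n => \prod_(k < n) coord (vbasis {:V}) (t k) (v k)].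

(* Replace the entries of t at the positions f 0, ..., f (m - 1) by those of a  *)
(* (f is meant to be injective).                                                *)
Definition splice (T : Type) m n (f : 'I_m -> 'I_n)
    (t : {ffun 'I_n -> T}) (a : {ffun 'I_m -> T}) : {ffun 'I_n -> T} :=
  [ffun k => if [pick e | f e == k] is Some e then a e else t k].

Definition restr (T : Type) m n (f : 'I_m -> 'I_n) (t : {ffun 'I_n -> T}) :
  {ffun 'I_m -> T} := [ffun e => t (f e)].

(* The operator on V^{(x) n} that applies phi to the tensor factors in          *)
(* positions f 0, ..., f (m - 1) and the identity to the other factors:         *)
(* see the lemma at_slots_tens.                                                 *)
Definition at_slots m n (f : 'I_m -> 'I_n) (phi : tpow m -> tpow m)
    (x : tpow n) : tpow n :=
  [ffun t : mindex n =>
     phi [ffun a : mindex m => x (splice f t a)] (restr f t)].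

Section Splice.
Variables (T : Type) (m n : nat) (f : 'I_m -> 'I_n).
Implicit Types (t : {ffun 'I_n -> T}) (a b : {ffun 'I_m -> T}).

Lemma splice_out t a k : (forall e, f e != k) -> splice f t a k = t k.
Proof.
move=> fk; rewrite ffunE; case: pickP => // e; by rewrite (negbTE (fk e)).
Qed.

Lemma splice_splice t a b : splice f (splice f t a) b = splice f t b.
Proof. by apply/ffunP => k; rewrite !ffunE; case: pickP. Qed.

Lemma splice_restr t : splice f t (restr f t) = t.
Proof.
by apply/ffunP => k; rewrite !ffunE; case: pickP => // e /eqP <-; rewrite ffunE.
Qed.

Hypothesis f_inj : injective f.

Lemma splice_in t a e : splice f t a (f e) = a e.
Proof.
by rewrite ffunE; case: pickP => [e' /eqP/f_inj -> //|/(_ e)]; rewrite eqxx.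
Qed.

Lemma restr_splice t a : restr f (splice f t a) = a.
Proof. by apply/ffunP => e; rewrite ffunE splice_in. Qed.

End Splice.

Lemma splice_comp (T : Type) l m n (f : 'I_l -> 'I_m) (g : 'I_m -> 'I_n)
    (t : {ffun 'I_n -> T}) a : injective g ->
  splice g t (splice f (restr g t) a) = splice (g \o f) t a.
Proof.
move=> g_inj; apply/ffunP => k; rewrite ffunE.
case: pickP => [e /eqP <-|gk]; last first.
  by rewrite splice_out // => e /=; apply/negbT/gk.
rewrite !ffunE -(eq_pick (P := fun d => f d == e)); last first.
  by move=> d /=; rewrite (inj_eq g_inj).
by case: pickP => // _; rewrite ffunE.
Qed.

Lemma at_slots_eq m n (f : 'I_m -> 'I_n) phi psi : phi =1 psi ->
  at_slots f phi =1 at_slots f psi.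
Proof. by move=> e x; apply/ffunP => t; rewrite !ffunE e. Qed.

Lemma at_slots_id n m (f : 'I_m -> 'I_n) x : at_slots f id x = x.
Proof. by apply/ffunP => t; rewrite !ffunE splice_restr. Qed.

Lemma at_slots_comp m n (f : 'I_m -> 'I_n) (phi psi : tpow m -> tpow m) x :
  injective f -> at_slots f phi (at_slots f psi x) = at_slots f (phi \o psi) x.
Proof.
move=> f_inj; apply/ffunP => t; rewrite !ffunE /=; congr (phi _ _).
apply/ffunP => a; rewrite !ffunE restr_splice //; congr (psi _ _).
by apply/ffunP => b; rewrite !ffunE splice_splice.
Qed.

Lemma at_slots_at_slots l m n (f : 'I_l -> 'I_m) (g : 'I_m -> 'I_n) phi x :
  injective g -> at_slots g (at_slots f phi) x = at_slots (g \o f) phi x.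
Proof.
move=> g_inj; apply/ffunP => t; rewrite !ffunE.
have -> : restr f (restr g t) = restr (g \o f) t.
  by apply/ffunP => e; rewrite !ffunE.
congr (phi _ _); apply/ffunP => a; rewrite !ffunE splice_comp //.
Qed.

Definition tpow_delta n (a : mindex n) : tpow n := [ffun b => (b == a)%:R].

Lemma tpow_sum n (x : tpow n) : x = \sum_a x a *: tpow_delta a.
Proof.
apply/ffunP => b; rewrite sum_ffunE (bigD1 b) //= !ffunE eqxx big1 ?addr0.
  by rewrite [_ *: _]mulr1.
by move=> a ab; rewrite !ffunE eq_sym (negbTE ab) scaler0.
Qed.

Lemma at_slots_sum m n (f : 'I_m -> 'I_n) (phi : 'End(tpow m)) x t :
  at_slots f phi x t
  = \sum_a x (splice f t a) * phi (tpow_delta a) (restr f t).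
Proof.
rewrite ffunE (tpow_sum [ffun _ => _]) linear_sum sum_ffunE.
by apply: eq_bigr => a _; rewrite linearZ !ffunE.
Qed.

Lemma at_slots_is_linear m n (f : 'I_m -> 'I_n) (phi : 'End(tpow m)) :
  linear (at_slots f phi).
Proof.
move=> c x y; apply/ffunP => t; rewrite !ffunE.
rewrite (_ : [ffun a => _] = c *: ([ffun a => x (splice f t a)] : tpow m)
    + [ffun a => y (splice f t a)]); last by apply/ffunP => a; rewrite !ffunE.
by rewrite linearP !ffunE.
Qed.

HB.instance Definition _ m n (f : 'I_m -> 'I_n) (phi : 'End(tpow m)) :=
  GRing.isLinear.Build K (tpow n) (tpow n) *:%R (at_slots f phi)
    (at_slots_is_linear f phi).

Lemma at_slotsC l m n (f : 'I_l -> 'I_n) (g : 'I_m -> 'I_n)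
    (phi : 'End(tpow l)) (psi : 'End(tpow m)) x :
  injective f -> injective g -> (forall d e, f d != g e) ->
  at_slots f phi (at_slots g psi x) = at_slots g psi (at_slots f phi x).
Proof.
move=> f_inj g_inj fg; apply/ffunP => t.
have sp (T : Type) (u : {ffun 'I_n -> T}) a b :
    splice g (splice f u a) b = splice f (splice g u b) a.
  apply/ffunP => k; rewrite !ffunE.
  case: pickP => [e /eqP ek|]; case: pickP => // d /eqP dk.
  by have := fg d e; rewrite ek dk eqxx.
have rf (T : Type) (u : {ffun 'I_n -> T}) b : restr f (splice g u b) = restr f u.
  by apply/ffunP => d; rewrite !ffunE; case: pickP => // e; rewrite eq_sym (negbTE (fg d e)).
have rg (T : Type) (u : {ffun 'I_n -> T}) a : restr g (splice f u a) = restr g u.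
  by apply/ffunP => d; rewrite !ffunE; case: pickP => // e; rewrite (negbTE (fg e d)).
rewrite !at_slots_sum.
under eq_bigr => a _ do rewrite at_slots_sum mulr_suml.
rewrite exchange_big /=; apply: eq_bigr => b _.
rewrite at_slots_sum mulr_suml; apply: eq_bigr => a _.
by rewrite sp rf rg mulrAC.
Qed.

Lemma tensE_basis n (t : mindex n) :
  tens [ffun k => (vbasis {:V})`_(t k)] = tpow_delta t.
Proof.
apply/ffunP => s; rewrite !ffunE; have [->|/eqP st] := eqVneq s t.
  by rewrite big1 // => k _; rewrite ffunE coord_free ?eqxx // (basis_free (vbasisP _)).
have [k kst] : exists k, s k != t k.
  apply/existsP; rewrite -negb_forall; apply/negP => /forallP h; apply: st.
  by apply/ffunP => k; apply/eqP/h.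
rewrite (bigD1 k) //= ffunE coord_free ?(basis_free (vbasisP _)) //.
by rewrite eq_sym (negbTE kst) mul0r.
Qed.

Definition setv n (v : {ffun 'I_n -> V}) k w : {ffun 'I_n -> V} :=
  [ffun l => if l == k then w else v l].

Definition multilinear n (W : lmodType K) (h : {ffun 'I_n -> V} -> W) : Prop :=
  forall v k, linear (fun w => h (setv v k w)).

Lemma tens_multilinear n : multilinear (@tens n).
Proof.
move=> v k c w w'; apply/ffunP => t; rewrite !ffunE (bigD1 k) //=.
rewrite [in X in _ = _ *: X + _](bigD1 k) //= [in X in _ = _ + X](bigD1 k) //=.
rewrite !ffunE eqxx linearP /= mulrDl [_ *: (_ * _)]mulrA.
congr (_ * _ + _ * _); apply: eq_bigr => l lk; by rewrite !ffunE (negbTE lk).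
Qed.

Lemma multilinear_sum n (W : lmodType K) (h : {ffun 'I_n -> V} -> W) :
  multilinear h -> forall v k (I : finType) (c : I -> K) (w : I -> V),
  h (setv v k (\sum_i c i *: w i)) = \sum_i c i *: h (setv v k (w i)).
Proof.
move=> hlin v k I c w.
have h0 : h (setv v k 0) = 0.
  have := hlin v k 1 0 0; rewrite scale1r scale1r addr0 => /eqP.
  by rewrite -subr_eq0 opprD addNKr oppr_eq0 => /eqP.
elim/big_rec2: _ => // i y z _ <-; exact: hlin.
Qed.

Lemma multilinear_ext n (W : lmodType K) (h h' : {ffun 'I_n -> V} -> W) :
  multilinear h -> multilinear h' ->
  (forall t : mindex n, let v := [ffun k => (vbasis {:V})`_(t k)] in h v = h' v) ->
  h =1 h'.
Proof.
move=> hlin hlin' hb.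
have P d : (d <= n)%N -> forall v : {ffun 'I_n -> V},
    (forall k : 'I_n, (d <= k)%N -> exists t : 'I_(\dim {:V}), v k = (vbasis {:V})`_t) ->
    h v = h' v.
  elim: d => [|d IH] dn v vb.
    have /fin_all_exists[t vt] : forall k, exists t : 'I_(\dim {:V}), v k = (vbasis {:V})`_t.
      by move=> k; apply: vb.
    have -> : v = [ffun k => (vbasis {:V})`_([ffun k => t k] k)].
      by apply/ffunP => k; rewrite !ffunE.
    exact: (hb [ffun k => t k]).
  pose k := Ordinal dn.
  have -> : v = setv v k (\sum_i coord (vbasis {:V}) i (v k) *: (vbasis {:V})`_i).
    apply/ffunP => l; rewrite ffunE -(coord_vbasis (memvf _)).
    by have [->|] := eqVneq l k.
  rewrite !multilinear_sum //; apply: eq_bigr => i _; congr (_ *: _).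
  apply: IH => [|l dl]; first exact: ltnW.
  rewrite ffunE; have [lk|lk] := eqVneq l k; first by exists i.
  by apply: vb; rewrite ltn_neqAle dl eq_sym (inj_eq val_inj (l : 'I_n) k) lk.
by move=> v; apply: (P n) => // k; rewrite leqNgt ltn_ord.
Qed.

Lemma tens_universal n (W : lmodType K) (h : {ffun 'I_n -> V} -> W) :
  multilinear h ->
  exists g : {linear tpow n -> W}, (forall v, g (tens v) = h v) /\
    forall g' : {linear tpow n -> W}, (forall v, g' (tens v) = h v) -> g' =1 g.
Proof.
move=> hlin.
pose g0 (x : tpow n) : W :=
  \sum_(t : mindex n) x t *: h [ffun k => (vbasis {:V})`_(t k)].
have g0lin : linear g0.
  move=> c x y; rewrite /g0 scaler_sumr -big_split; apply: eq_bigr => t _ /=.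
  by rewrite !ffunE scalerDl scalerA.
pose gl : {linear tpow n -> W} :=
  HB.pack g0 (GRing.isLinear.Build K (tpow n) W *:%R g0 g0lin).
exists gl; split.
  apply: multilinear_ext => // [v k c w w'|t] /=.
    by rewrite tens_multilinear g0lin.
  rewrite tensE_basis /g0 (bigD1 t) //= ffunE eqxx scale1r big1 ?addr0 //.
  by move=> s st; rewrite ffunE (negbTE st) scale0r.
move=> g' g'h x; rewrite {1}[x]tpow_sum linear_sum /=; apply: eq_bigr => t _.
by rewrite linearZ /= -tensE_basis g'h.
Qed.

(* If phi (v_{f 0} (x) ... (x) v_{f (m - 1)}) = \sum_i c_i w_{i, 0} (x) ... (x) *)
(* w_{i, m - 1}, then at_slots f phi (v_0 (x) ... (x) v_{n - 1}) is the sum of  *)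
(* the c_i v_0 (x) ... (x) v_{n - 1} with each v_{f e} replaced by w_{i, e}.    *)
Lemma at_slots_tens m n (f : 'I_m -> 'I_n) phi (v : {ffun 'I_n -> V})
    (I : finType) (c : I -> K) (w : I -> {ffun 'I_m -> V}) :
  injective f -> linear phi ->
  phi (tens (restr f v)) = \sum_i c i *: tens (w i) ->
  at_slots f phi (tens v) = \sum_i c i *: tens (splice f v (w i)).
Proof.
move=> f_inj philin phiv; apply/ffunP => t.
pose P := fun k : 'I_n => k \in codom f.
have prodE (u : {ffun 'I_n -> V}) (s : mindex n) :
    tens u s = tens (restr f u) (restr f s)
      * \prod_(k | ~~ P k) coord (vbasis {:V}) (s k) (u k).
  rewrite !ffunE (bigID P) /=; congr (_ * _).
  rewrite (eq_bigl (mem (f @: setT))) => [|k]; last first.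
    by apply/codomP/imsetP => [[e ->]|[e _ ->]]; exists e.
  rewrite big_imset /=; last by move=> ? ? _ _; apply: f_inj.
  by rewrite big_mkcond; apply: eq_bigr => e _; rewrite !ffunE inE.
have outP (T : Type) (u : {ffun 'I_n -> T}) a k : ~~ P k -> splice f u a k = u k.
  move=> Pk; apply: splice_out => e; apply: contra Pk => /eqP <-; exact: codom_f.
pose c0 := \prod_(k | ~~ P k) coord (vbasis {:V}) (t k) (v k).
pose phil : {linear tpow m -> tpow m} :=
  HB.pack phi (GRing.isLinear.Build K (tpow m) (tpow m) *:%R phi philin).
rewrite ffunE (_ : [ffun a => _] = c0 *: tens (restr f v)); last first.
  apply/ffunP => a; rewrite ffunE [RHS]ffunE prodE restr_splice // [RHS]mulrC.
  by congr (_ * _); apply: eq_bigr => k Pk; rewrite outP.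
rewrite -[phi _]/(phil _) linearZ /= phiv ffunE !sum_ffunE scaler_sumr.
apply: eq_bigr => i _; rewrite ffunE [in RHS]ffunE prodE restr_splice //.
rewrite [LHS]mulrCA; congr (_ * _); rewrite [LHS]mulrC; congr (_ * _).
by apply: eq_bigr => k Pk; rewrite outP.
Qed.

End TensorPower.

Section GroupHomology.
Variable G : groupType.

Record gmodule := GModule {
  gm_sort :> zmodType;
  gm_act : G -> {additive gm_sort -> gm_sort};
  gm_act1 : forall x, gm_act 1%g x = x;
  gm_actM : forall g h x, gm_act (g * h)%g x = gm_act g (gm_act h x)
}.

Variable M : gmodule.

(* The bar complex B(Z, G, M): chains of degree i are finite sums of symbols    *)
(* [g_1 | ... | g_i] m, with boundary                                           *)
(*   d [g_1 | ... | g_(i+1)] m = [g_2 | ... | g_(i+1)] m                        *)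
(*     + \sum_(0 < k < i+1) (-1)^k [g_1 | ... | g_k g_(k+1) | ... | g_(i+1)] m  *)
(*     + (-1)^(i+1) [g_1 | ... | g_i] (g_(i+1) m).                              *)
(* The tuple is indexed from 0, so that g_(k+1) is g k.                         *)
Definition bar (i : nat) : Type := {malg M[{ffun 'I_i -> G}]}.
HB.instance Definition _ (i : nat) := GRing.Zmodule.on (bar i).

Definition bar_face i (k : 'I_i.+2) (g : {ffun 'I_i.+1 -> G}) :
  {ffun 'I_i -> G} :=
  [ffun j : 'I_i =>
     let gj := g (widen_ord (leqnSn i) j) in
     let gj1 := g (lift ord0 j) in
     if (j.+1 < k)%N then gj else if j.+1 == k then (gj * gj1)%g else gj1].

Definition bar_coef i (k : 'I_i.+2) (g : {ffun 'I_i.+1 -> G}) (m : M) : M :=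
  if k == ord_max then gm_act M (g ord_max) m else m.

Definition bar_bnd i (z : bar i.+1) : bar i :=
  \sum_(g <- msupp z) \sum_(k < i.+2)
    (<< bar_coef k g z@_g *g bar_face k g >> : bar i) *~ (-1) ^+ k.

Lemma bar_bnd_fset i (z : bar i.+1) (S : {fset {ffun 'I_i.+1 -> G}}) :
  (msupp z `<=` S)%fset ->
  bar_bnd z = \sum_(g <- S) \sum_(k < i.+2)
    (<< bar_coef k g z@_g *g bar_face k g >> : bar i) *~ (-1) ^+ k.
Proof.
move=> zS; rewrite /bar_bnd (big_fset_incl _ zS) // => g _ gz.
rewrite big1 // => k _; rewrite mcoeff_outdom // (_ : bar_coef _ _ _ = 0).
  by rewrite monalgU0 mul0rz.
by rewrite /bar_coef raddf0 if_same.
Qed.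

Lemma bar_bnd_is_zmod_morphism i : zmod_morphism (@bar_bnd i).
Proof.
move=> x y; pose S := (msupp x `|` msupp y `|` msupp (x - y))%fset.
have Sx : (msupp x `<=` S)%fset.
  by apply/fsubsetP => g; rewrite !in_fsetU => ->.
have Sy : (msupp y `<=` S)%fset.
  by apply/fsubsetP => g; rewrite !in_fsetU => ->; rewrite orbT.
have Sxy : (msupp (x - y) `<=` S)%fset.
  by apply/fsubsetP => g; rewrite !in_fsetU => ->; rewrite orbT.
rewrite (bar_bnd_fset Sx) (bar_bnd_fset Sy) (bar_bnd_fset Sxy).
rewrite -sumrB; apply: eq_bigr => g _; rewrite -sumrB; apply: eq_bigr => k _.
pose h m : bar i := << bar_coef k g m *g bar_face k g >>.
have hB m m' : h (m - m') = h m - h m'.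
  rewrite /h -monalgUB; congr mkmalgU.
  by rewrite /bar_coef; case: ifP; rewrite ?raddfB.
rewrite mcoeffB -!/(h _); move: h hB => h ->.
exact: mulrzBl.
Qed.

HB.instance Definition _ i :=
  GRing.isZmodMorphism.Build (bar i.+1) (bar i) (@bar_bnd i)
    (@bar_bnd_is_zmod_morphism i).

Lemma bar_bnd0 i : @bar_bnd i 0 = 0.
Proof. exact: raddf0. Qed.

Lemma bar_bndD i : {morph @bar_bnd i : x y / x + y}.
Proof. exact: raddfD. Qed.

Lemma bar_bnd_monom i (g : {ffun 'I_i.+1 -> G}) (m : M) :
  bar_bnd << m *g g >> =
  \sum_(k < i.+2) (<< bar_coef k g m *g bar_face k g >> : bar i) *~ (-1) ^+ k.
Proof.
by rewrite (bar_bnd_fset (S := [fset g])%fset) ?msuppU_le // big_seq_fset1 mcoeffUU.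
Qed.

Lemma bar_faceE i (k : 'I_i.+2) (g : {ffun 'I_i.+1 -> G}) (j : 'I_i) :
  bar_face k g j =
    if (j.+1 < k)%N then g (inord j)
    else if j.+1 == k then (g (inord j) * g (inord j.+1))%g
    else g (inord j.+1).
Proof.
rewrite ffunE; have -> : widen_ord (leqnSn i) j = inord j.
  by apply: val_inj; rewrite /= inordK // ltnW // ltnS.
by have -> : lift ord0 j = inord j.+1 by apply: val_inj; rewrite /= inordK // ltnS.
Qed.

Lemma bar_face_face i (p : 'I_i.+2) (q : 'I_i.+2) (g : {ffun 'I_i.+2 -> G}) :
  (p <= q)%N ->
  bar_face p (bar_face (lift ord0 q) g) = bar_face q (bar_face (inord p) g).
Proof.
move=> pq; apply/ffunP => j; rewrite !bar_faceE.
have pi := ltn_ord p; have qi := ltn_ord q; have ji := ltn_ord j.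
have pE : (inord p : 'I_i.+3) = p :> nat by rewrite inordK //; lia.
have j1 : (inord j : 'I_i.+1) = j :> nat by rewrite inordK //; lia.
have j2 : (inord j.+1 : 'I_i.+1) = j.+1 :> nat by rewrite inordK //; lia.
rewrite /= !pE !j1 !j2 /bump /= add1n !ltnS !eqSS.
have [j1p|j1p|j1p] := ltngtP j.+1 p; have [j1q|j1q|j1q] := ltngtP j.+1 q;
  rewrite ?mulgA //; try (exfalso; lia); repeat (case: ltngtP => ? //; try (exfalso; lia)).
all: by rewrite ?mulgA.
Qed.

Lemma bar_coef_coef i (p : 'I_i.+2) (q : 'I_i.+2) (g : {ffun 'I_i.+2 -> G}) m :
  (p <= q)%N ->
  bar_coef p (bar_face (lift ord0 q) g) (bar_coef (lift ord0 q) g m)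
  = bar_coef q (bar_face (inord p) g) (bar_coef (inord p) g m).
Proof.
move=> pq; rewrite /bar_coef !bar_faceE -!val_eqE /=.
have pi := ltn_ord p; have qi := ltn_ord q.
have pE : (inord p : 'I_i.+3) = p :> nat by rewrite inordK //; lia.
have iE : inord i.+1 = ord_max :> 'I_i.+2 by apply/val_inj; rewrite /= inordK.
rewrite pE iE /bump /= add1n !eqSS ltnS.
have -> : (p == i.+2 :> nat) = false by lia.
have [qE|qE] := eqVneq (q : nat) i.+1; last by rewrite ifF //; lia.
have [pE'|pE'] := eqVneq (p : nat) i.+1.
  by rewrite pE' qE ltnSn ltnn -gm_actM.
by rewrite !ifF //; lia.
Qed.

Lemma alternating_cancel (A : zmodType) i (F : 'I_i.+2 -> 'I_i.+3 -> A) :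
  (forall p q : 'I_i.+2, (p <= q)%N -> F p (lift ord0 q) = F q (inord p)) ->
  \sum_(q < i.+3) \sum_(p < i.+2) F p q *~ (-1) ^+ (p + q) = 0.
Proof.
move=> FE.
under eq_bigr => q _ do rewrite (bigID (fun p : 'I_i.+2 => (p < q)%N)) /=.
rewrite big_split /= big_ord_recl /= big_pred0 // add0r.
rewrite [X in _ + X]big_ord_recr /= [X in _ + (_ + X)]big1 ?addr0; last first.
  by move=> p; rewrite ltn_ord.
rewrite [X in _ + X](exchange_big_dep xpredT) //= -big_split big1 // => q _ /=.
rewrite (eq_bigl (fun p : 'I_i.+2 => ~~ (q < p)%N)) => [|p]; last first.
  by rewrite /bump /= add1n ltnS -leqNgt.
rewrite -big_split big1 // => p; rewrite -leqNgt => pq /=.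
have -> : widen_ord (leqnSn i.+2) p = inord p.
  by apply: val_inj; rewrite /= inordK // ltnW // ltnS.
rewrite FE // /bump /= add1n addnS exprS mulN1r mulrNz [(q + p)%N]addnC.
exact: addNr.
Qed.

Lemma bar_bnd_bnd i (z : bar i.+2) : bar_bnd (bar_bnd z) = 0.
Proof.
pose mon g m : bar i.+2 := << m *g g >>.
suff monom g m : bar_bnd (bar_bnd (mon g m)) = 0.
  have -> : z = \sum_(g <- msupp z) mon g z@_g by exact: monalgE.
  move: mon monom => mon monom.
  elim/big_rec: _ => [|g x _ IH]; first by rewrite bar_bnd0 bar_bnd0.
  have := monom g z@_g; move: (mon g z@_g) => y y0.
  rewrite bar_bndD bar_bndD; apply: etrans (congr2 +%R y0 IH) _; exact: addr0.
rewrite /mon {mon}; rewrite bar_bnd_monom raddf_sum /=.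
pose F (p : 'I_i.+2) (q : 'I_i.+3) : bar i :=
  << bar_coef p (bar_face q g) (bar_coef q g m) *g bar_face p (bar_face q g) >>.
rewrite (eq_bigr (fun q : 'I_i.+3 => \sum_(p < i.+2) F p q *~ (-1) ^+ (p + q))); last first.
  move=> q _; rewrite raddfMz /= bar_bnd_monom mulrz_suml; apply: eq_bigr => p _.
  by rewrite -mulrzA exprD.
have FE (p q : 'I_i.+2) : (p <= q)%N -> F p (lift ord0 q) = F q (inord p).
  by move=> pq; rewrite /F bar_face_face // bar_coef_coef.
by move: F FE => F FE; exact: alternating_cancel.
Qed.

Definition is_cycle i : pred (bar i) :=
  match i with
  | 0 => fun=> true
  | j.+1 => fun z : bar j.+1 => bar_bnd z == 0
  end.

Lemma is_cycle_zmod_closed i : zmod_closed (@is_cycle i).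
Proof.
case: i => [//|i]; split; first by rewrite unfold_in /= raddf0.
move=> x y /eqP x0 /eqP y0; rewrite unfold_in /= raddfB /=.
by rewrite x0 y0 subrr.
Qed.

HB.instance Definition _ i :=
  GRing.isZmodClosed.Build (bar i) (@is_cycle i) (@is_cycle_zmod_closed i).

Record bar_cycle i := BarCycle { cycle_val :> bar i; _ : is_cycle cycle_val }.
HB.instance Definition _ i := [isSub for @cycle_val i].
HB.instance Definition _ i := [Choice of bar_cycle i by <:].
HB.instance Definition _ i := [SubChoice_isSubZmodule of bar_cycle i by <:].

Definition is_boundary i : pred (bar_cycle i) :=
  fun z => `[< exists w : bar i.+1, bar_bnd w = cycle_val z >].

Lemma is_boundary_zmod_closed i : zmod_closed (@is_boundary i).
Proof.
split; first by apply/asboolP; exists 0; rewrite raddf0.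
move=> x y /asboolP[wx wxE] /asboolP[wy wyE]; apply/asboolP; exists (wx - wy).
by rewrite raddfB /= wxE wyE.
Qed.

HB.instance Definition _ i :=
  GRing.isZmodClosed.Build (bar_cycle i) (@is_boundary i)
    (@is_boundary_zmod_closed i).

(* bar_bnd_bnd shows that every bar_bnd w is a cycle; homology_eq0P below       *)
(* unfolds the vanishing of this quotient.                                      *)
Definition homology (i : nat) : zmodType :=
  Quotient.quot (GRing.ZmodClosed.clone (bar_cycle i) (@is_boundary i) _).

Lemma homology_eq0P i :
  (forall c : homology i, c = 0) <->
  (forall z : bar i, is_cycle z -> exists w : bar i.+1, bar_bnd w = z).
Proof.
pose B := GRing.ZmodClosed.clone (bar_cycle i) (@is_boundary i) _.
have piE (z : bar_cycle i) :
    (\pi_(Quotient.quot B) z == 0) = is_boundary z.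
  have p0 : \pi_(Quotient.quot B) (0 : bar_cycle i) = 0 by exact: pi_zeror.
  by rewrite -p0 -(Quotient.idealrBE B) subr0.
split=> [h z zc|h c].
  have /eqP := h (\pi_(Quotient.quot B) (BarCycle zc)).
  by rewrite piE => /asboolP.
rewrite -[c]reprK; apply/eqP; rewrite piE; case: (repr c) => z zc.
exact/asboolP/h.
Qed.

End GroupHomology.

Lemma slot_subproof n (j : 'I_n.-1) (e : 'I_2) : (j + e < n)%N.
Proof.
case: n j => [[//]|n] j; rewrite -addn1 addnC [(_ + e)%N]addnC.
case: e => [[|[|//]]] //= _; rewrite ?add1n ?add0n ltnS ?(ltn_ord j) //.
exact: ltnW (ltn_ord j).
Qed.

(* Positions are numbered from 0: slot j is the pair (j, j + 1), the factors    *)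
(* on which sigma j, the generator sigma_(j+1) in 1-based notation, acts.       *)
Definition slot n (j : 'I_n.-1) (e : 'I_2) : 'I_n := Ordinal (slot_subproof j e).

Lemma slot_inj n (j : 'I_n.-1) : injective (slot j).
Proof. by move=> d e [] /addnI/val_inj. Qed.

(* V (x) V is tpow V 2; R12 and R23 are R (x) id and id (x) R on V^{(x) 3}.     *)
Record braided_space (K : fieldType) := BraidedSpace {
  bs_space :> vectType K;
  bs_R : 'End(tpow bs_space 2);
  bs_R_bij : bijective bs_R;
  bs_yang_baxter :
    let R12 := @at_slots K bs_space 2 3 (@slot 3 (0 : 'I_2)) bs_R in
    let R23 := @at_slots K bs_space 2 3 (@slot 3 (1 : 'I_2)) bs_R in
    R12 \o R23 \o R12 =1 R23 \o R12 \o R23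
}.

Section BraidAction.
Variables (K : fieldType) (V : braided_space K) (n : nat).
Local Notation T := (tpow V n).
Local Notation R := (bs_R V).

Definition letter_act (l : 'I_n.-1 * bool) : T -> T :=
  at_slots (slot l.1) (if l.2 then R else (R^-1)%VF).

HB.instance Definition _ l :=
  GRing.Linear.copy (letter_act l)
    (at_slots (slot l.1) (if l.2 then R else (R^-1)%VF)).

Definition word_act (u : braid_word n) (x : T) : T := foldr letter_act x u.

Lemma bs_R_ker0 : lker R == 0%VS.
Proof. by apply/lker0P/bij_inj/bs_R_bij. Qed.

Lemma word_act_cat u v x : word_act (u ++ v) x = word_act u (word_act v x).
Proof. exact: foldr_cat. Qed.

Lemma word_act_braid_eq u v : braid_eq u v -> word_act u =1 word_act v.
Proof.
elim=> {u v} [//|u v _ IH x|u v w _ IH1 _ IH2 x|u u' v v' _ IH1 _ IH2 x|j b x|j k jk x|j k jk x].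
- by rewrite IH.
- by rewrite IH1.
- by rewrite !word_act_cat IH1 IH2.
- rewrite /= /letter_act at_slots_comp; last exact: slot_inj.
  rewrite -[RHS](at_slots_id (slot j)); apply: at_slots_eq => y /=.
  by case: b => /=; rewrite ?lker0_lfunVK ?lker0_lfunK ?bs_R_ker0.
- rewrite /= /letter_act at_slotsC //; [exact: slot_inj|exact: slot_inj|].
  move=> d e; rewrite -val_eqE /= neq_ltn; apply/orP; left.
  have d1 : (d <= 1)%N by rewrite -ltnS ltn_ord.
  apply: leq_ltn_trans (leq_add (leqnn j) d1) _; rewrite addn1.
  exact: leq_trans jk (leq_addr _ _).
- have lt3 (e : 'I_3) : (j + e < n)%N.
    have := slot_subproof k 1; rewrite jk /= addn1; apply: leq_trans.
    by rewrite ltnS -[X in (_ <= X)%N]addn1 addSnnS leq_add2l -ltnS ltn_ord.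
  pose g e : 'I_n := Ordinal (lt3 e).
  have g_inj : injective g by move=> d e [] /addnI/val_inj.
  have E (l : 'I_n.-1) (m : 'I_2) : l = (j + m)%N :> nat ->
      letter_act (l, true) =1 at_slots g (at_slots (@slot 3 m) R).
    move=> lm y; rewrite at_slots_at_slots //; apply/ffunP => t; rewrite !ffunE.
    have -> : slot l = g \o @slot 3 m.
      by apply/funext => e; apply/val_inj; rewrite /= lm addnA.
    by [].
  have Ej := E j 0 (esym (addn0 j)).
  have Ek := E k 1 (etrans jk (esym (addn1 j))).
  rewrite /= !Ej !Ek !at_slots_comp //; apply: at_slots_eq => y.
  exact: bs_yang_baxter.
Qed.

Definition braid_act (g : braid_group n) : T -> T := word_act (repr g).

Lemma braid_act_is_zmod_morphism g : zmod_morphism (braid_act g).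
Proof.
rewrite /braid_act => x y; elim: (repr g) => //= l u ->; exact: raddfB.
Qed.

HB.instance Definition _ g :=
  GRing.isZmodMorphism.Build T T (braid_act g) (braid_act_is_zmod_morphism g).

Lemma braid_act_word u x : braid_act (braid_of_word u) x = word_act u x.
Proof. exact/word_act_braid_eq/braid_repr. Qed.

Lemma braid_act_sigma j x : braid_act (sigma j) x = at_slots (slot j) R x.
Proof. exact: braid_act_word. Qed.

Lemma braid_act1 x : braid_act 1%g x = x.
Proof. exact: braid_act_word. Qed.

Lemma braid_actM g h x : braid_act (g * h)%g x = braid_act g (braid_act h x).
Proof.
have [u ->] := braid_wordE g; have [v ->] := braid_wordE h.
by rewrite [(_ * _)%g]braid_mulE !braid_act_word word_act_cat.
Qed.

Definition braid_module : gmodule (braid_group n) :=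
  @GModule (braid_group n) T (fun g => braid_act g : {additive T -> T})
    braid_act1 braid_actM.

End BraidAction.

Definition homology_vanishes (K : fieldType) (V : braided_space K) (n i : nat) :
  Prop := forall c : homology (braid_module V n) i, c = 0.

Definition vanishes_with_slope (R : realType) (V : braided_space R[i]) (s : R) :
  Prop :=
  exists t : R, forall n i : nat, (1 <= n)%N ->
    i%:R <= s * n%:R + t -> homology_vanishes V n i.

(* Main.v *)
From HB Require Import structures.
Require Import Defs.
From mathcomp Require Import all_boot all_order all_algebra.
From mathcomp Require Import finmap.
From mathcomp.multinomials Require Import monalg.
From mathcomp Require Import zify boolp reals complex.
From Corelib Require Import Setoid Morphisms.

(* Write T for V^(x)n as a B_n-module. Squier's resolution computes H_*(B_n, T) *)
(* as the homology of a small complex with one copy of T for each set U of      *)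
(* standard generators (that is, for each composition of n into blocks of       *)
(* consecutive strands), whose differential removes a generator by a signed sum *)
(* over shuffles. Its exactness over Z[B_n] is a Koszul argument in the positive *)
(* braid monoid: filtered by length, the leading part of the differential is    *)
(* the simplicial complex of the generators dividing a given element, by        *)
(* Garside's theorem on least common multiples.                                 *)
(* In the small complex, the chains whose first block has p strands form the    *)
(* small complex of V^(x)(n - p), shifted by p - 1. As long as the groups       *)
(* H_(i - p + 1)(B_(n - p), V^(x)(n - p)) vanish for p >= 2, every cycle of      *)
(* degree i can be moved into V (x) (the complex of n - 1). After N such steps  *)
(* it lies in V^(x)N (x) (the complex of n - N), where it is a boundary because *)
(* the coinvariants of V^(x)N vanish. By induction on i, this gives vanishing   *)
(* for n >= N + (N + 1) i, which is the bound of the theorem.                   *)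

Set Implicit Arguments.
Unset Strict Implicit.
Unset Printing Implicit Defensive.

(** * Least common multiples in the positive braid monoid *)

(** Two results carry the theorem: exactness of the small complex implies vanishing of group
    homology ([homology_eq0]), and the small complex is exact in the required range ([vanishing]).
    For the first, [left_module_exact] shows that the shuffle complex over the group ring is a
    resolution. [garside_lcm] controls divisibility by [twist U] in the positive monoid, and
    [word_gen_inj] carries this to the group. For a positive braid y of positive length, the sets U
    with [twist U] dividing y are closed under adjoining the least generator that divides y
    ([least_gen_in]). They therefore form a cone, and coning off removes the leading part of every
    cycle ([filtered_step]). The double complex of [double_complex_exact] then compares the
    resolution with the bar complex. For the second, vanishing of the coinvariants of the N-th
    tensor power gives linear operators h_l such that the sum over l of h_l - sigma_l h_l is the
    identity ([coinvariant_section]). They act on the first N factors and commute with the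
    generators from N on, so they contract the chains whose first N strands are blocks of their own
    ([coinvariant_contract]). [first_block_elim] moves a cycle into such chains one strand at a
    time. Its obstructions lie in smaller degree on fewer strands and vanish by induction on i: a
    first block of q strands behind j single ones leaves n - (j + q) strands and lowers the degree
    by q - 1. The most expensive case, q = 2 and j = N - 1, spends N + 1 strands on one degree,
    which is the origin of the slope 1/(N + 1). *)

Definition far (i j : nat) : bool := (i.+1 < j) || (j.+1 < i).
Definition adj (i j : nat) : bool := (i.+1 == j) || (j.+1 == i).

Lemma farC i j : far i j = far j i. Proof. by rewrite /far orbC. Qed.
Lemma adjC i j : adj i j = adj j i. Proof. by rewrite /adj orbC. Qed.

Variant letters_spec (i j : nat) : Prop :=
| LettersEq of i = j
| LettersFar of far i j
| LettersAdj of adj i j.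

Lemma lettersP i j : letters_spec i j.
Proof.
have [e|] := boolP (i == j); first by apply: LettersEq; apply/eqP.
have [f|] := boolP (far i j); first by move=> _; apply: LettersFar.
by rewrite /far => f e; apply: LettersAdj; rewrite /adj; lia.
Qed.

Inductive step : seq nat -> seq nat -> Prop :=
| step_cons i u v : step u v -> step (i :: u) (i :: v)
| step_far i j u : far i j -> step (i :: j :: u) (j :: i :: u)
| step_adj i j u : adj i j -> step (i :: j :: i :: u) (j :: i :: j :: u).

Lemma step_sym u v : step u v -> step v u.
Proof.
elim=> {u v} [i u v _|i j u ij|i j u ij]; first exact: step_cons.
  by apply: step_far; rewrite farC.
by apply: step_adj; rewrite adjC.
Qed.

Lemma step_cat u v w : step u v -> step (u ++ w) (v ++ w).
Proof.
by elim=> {u v} [i u v _|i j u|i j u]; [exact: step_cons|exact: step_far|exact: step_adj].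
Qed.

Lemma step_size u v : step u v -> size u = size v.
Proof. by elim=> {u v} //= i u v _ ->. Qed.

Lemma step_all (P : pred nat) u v : step u v -> all P u = all P v.
Proof.
by elim=> {u v} [i u v _ /= ->|i j u _|i j u _] //=;
  case: (P i); case: (P j); rewrite ?andbF ?andbT.
Qed.

(** The steps are counted because [garside_lcm] needs an inner induction on their number. *)
Inductive steps : nat -> seq nat -> seq nat -> Prop :=
| steps0 u : steps 0 u u
| stepsS k u v w : step u v -> steps k v w -> steps k.+1 u w.

Lemma stepsSP k u w : steps k.+1 u w -> exists2 v, step u v & steps k v w.
Proof. by inversion 1; subst; exists v. Qed.

Definition peq u v := exists k, steps k u v.

Lemma peq_refl u : peq u u. Proof. by exists 0; apply: steps0. Qed.
#[local] Hint Resolve peq_refl : core.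

Lemma peq_step u v : step u v -> peq u v.
Proof. by move=> uv; exists 1; apply: stepsS uv (steps0 _). Qed.

Lemma peq_trans u v w : peq u v -> peq v w -> peq u w.
Proof.
case=> k; elim: k u => [|k IH] u; first by inversion 1; subst.
case/stepsSP=> x ux xv vw; have [l h] := IH _ xv vw.
by exists l.+1; apply: stepsS ux h.
Qed.

Lemma peq_ind (P : seq nat -> seq nat -> Prop) :
  (forall u, P u u) -> (forall u v w, step u v -> P v w -> P u w) ->
  forall u v, peq u v -> P u v.
Proof.
move=> P0 P1 u v [k]; elim: k u => [|k IH] u; first by inversion 1; subst.
by case/stepsSP=> w uw wv; apply: P1 uw (IH _ wv).
Qed.

Lemma peq_sym u v : peq u v -> peq v u.
Proof.
elim/peq_ind=> {u v} // u v w /step_sym/peq_step vu wv; exact: peq_trans wv vu.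
Qed.

Lemma peq_cons i u v : peq u v -> peq (i :: u) (i :: v).
Proof.
elim/peq_ind=> {u v} // u v w uv; apply: peq_trans; apply: peq_step.
exact: step_cons.
Qed.

Lemma peq_cat u u' v v' : peq u u' -> peq v v' -> peq (u ++ v) (u' ++ v').
Proof.
move=> uu vv; apply: (@peq_trans _ (u' ++ v)).
  elim/peq_ind: uu => {u u'} // u u' w uu; apply: peq_trans; apply: peq_step.
  exact: step_cat.
by elim: u' {uu} => //= i u' IH; exact: peq_cons.
Qed.

Lemma peq_size u v : peq u v -> size u = size v.
Proof. by elim/peq_ind=> {u v} // u v w /step_size ->. Qed.

Lemma peq_all (P : pred nat) u v : peq u v -> all P u = all P v.
Proof. by elim/peq_ind=> {u v} // u v w /(step_all P) ->. Qed.

Lemma peq_far i j u : far i j -> peq (i :: j :: u) (j :: i :: u).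
Proof. by move=> ij; apply/peq_step/step_far. Qed.

Lemma peq_adj i j u : adj i j -> peq (i :: j :: i :: u) (j :: i :: j :: u).
Proof. by move=> ij; apply/peq_step/step_adj. Qed.

#[local] Instance peq_equiv : Equivalence peq.
Proof. by split=> [u|u v|u v w]; [exact: peq_refl|exact: peq_sym|exact: peq_trans]. Qed.
#[local] Instance peq_cons_proper i : Proper (peq ==> peq) (cons i).
Proof. by move=> u v; exact: peq_cons. Qed.
#[local] Instance peq_cat_proper : Proper (peq ==> peq ==> peq) cat.
Proof. by move=> u v uv u' v'; exact: peq_cat. Qed.

(** Says that the common value of [i :: a] and [j :: b] is a right multiple of the least common
    multiple of the letters i and j, which is i, ij or iji according to their distance; c is the
    cofactor. *)
Variant lcm_spec (i j : nat) (a b : seq nat) : Prop :=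
| LcmEq of i = j & peq a b
| LcmFar c of far i j & peq a (j :: c) & peq b (i :: c)
| LcmAdj c of adj i j & peq a (j :: i :: c) & peq b (i :: j :: c).

Lemma lcm_peql i j a a' b : peq a' a -> lcm_spec i j a b -> lcm_spec i j a' b.
Proof.
move=> aa; case=> [e ab|c f ac bc|c f ac bc].
- by apply: LcmEq => //; apply: peq_trans ab.
- by apply: LcmFar bc => //; apply: peq_trans ac.
- by apply: LcmAdj bc => //; apply: peq_trans ac.
Qed.

Lemma lcm_eq i a b : lcm_spec i i a b -> peq a b.
Proof. by case=> // c; rewrite /far/adj; lia. Qed.
Lemma lcm_far i j a b : far i j -> lcm_spec i j a b ->
  exists2 c, peq a (j :: c) & peq b (i :: c).
Proof. by move=> ij; case=> [e|c|c]; [|by exists c|]; move: ij; rewrite /far/adj; lia. Qed.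
Lemma lcm_adj i j a b : adj i j -> lcm_spec i j a b ->
  exists2 c, peq a (j :: i :: c) & peq b (i :: j :: c).
Proof. by move=> ij; case=> [e|c|c]; [| |by exists c]; move: ij; rewrite /far/adj; lia. Qed.

Lemma lcm_sym i j a b : lcm_spec i j a b -> lcm_spec j i b a.
Proof.
case=> [e ab|c f ac bc|c f ac bc].
- by apply: LcmEq => //; apply: peq_sym.
- by apply: LcmFar ac => //; rewrite farC.
- by apply: LcmAdj ac => //; rewrite adjC.
Qed.

Lemma lcm_peqr i j a b b' : peq b' b -> lcm_spec i j a b -> lcm_spec i j a b'.
Proof. by move=> bb /lcm_sym/(lcm_peql bb)/lcm_sym. Qed.

Ltac far_adj := unfold far, adj in *; lia.

(** The two hypotheses give two factorizations of the middle tail t. Its first letters are compared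
    by Garside's theorem for words shorter than t, and the resulting cofactors are reassembled with
    the braid relations. *)
Lemma lcm_trans i j k a b t :
  (forall i j a b, size a < size t -> peq (i :: a) (j :: b) -> lcm_spec i j a b) ->
  lcm_spec i k a t -> lcm_spec k j t b -> lcm_spec i j a b.
Proof.
have F p q x : far p q -> peq (p :: q :: x) (q :: p :: x) by exact: peq_far.
have A p q x : adj p q -> peq (p :: q :: p :: x) (q :: p :: q :: x) by exact: peq_adj.
(* Exchanging the two ends turns the case adjacent-far into far-adjacent, so only the latter is
   computed. *)
wlog : i j a b / ~~ (adj i k && far k j) => [W|W] G ik kj.
  have [h|] := boolP (adj i k && far k j); last by move/W; apply.
  apply: lcm_sym; apply: (W j i) => //; [far_adj| |]; exact: lcm_sym.
case: ik W => [e au|u ik au tu|u ik au tu].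
- by move=> _; subst; apply: (lcm_peql au).
- case: kj => [<- tb|c kj tc bc|c kj tc bc] W.
  + by apply: lcm_peqr (peq_sym tb) _; apply: LcmFar au tu.
  + have ts : size u < size t by rewrite (peq_size tu).
    have /(G _ _ _ _ ts) : peq (i :: u) (j :: c) by rewrite -tu.
    case=> [ij uc|d ij ud cd|d ij ud cd].
    * by apply: LcmEq => //; rewrite au bc uc.
    * apply: (LcmFar (c := k :: d)) => //.
        by rewrite au ud F.
      by rewrite bc cd F // farC.
    * apply: (LcmAdj (c := k :: d)) => //.
        by rewrite au ud (F k j) // (F k i) // farC.
      by rewrite bc cd (F k i) 1?farC // (F k j).
  + have [ts cs] : size u < size t /\ size c < size t.
      by rewrite (peq_size tu); have := peq_size tc; rewrite (peq_size tu) /=; lia.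
    have /(G _ _ _ _ ts) : peq (i :: u) (j :: k :: c) by rewrite -tu.
    case=> [ij|d ij ud cd|d ij ud cd]; first by exfalso; far_adj.
    * have [e ce de] := lcm_far (etrans (farC k i) ik) (G _ _ _ _ cs cd).
      apply: (LcmFar (c := k :: j :: e)) => //.
        by rewrite au ud de (A k j).
      by rewrite bc ce (F j i) 1?farC // (F k i) // farC.
    * have [e ce de] := lcm_far (etrans (farC k i) ik) (G _ _ _ _ cs cd).
      have ds : size (j :: d) < size t.
        by have := peq_size tu; have := peq_size ud; rewrite /=; lia.
      have [|f df ef] := lcm_adj (etrans (adjC j k) kj) (G _ _ d e _ de).
        by apply: leq_trans ds; rewrite ltnW.
      apply: (LcmAdj (c := k :: j :: i :: f)) => //.
        rewrite au ud df (F i k) // (A k j) // (A j i) 1?adjC //.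
        by rewrite (F k i) // farC.
      rewrite bc ce ef (A j i) 1?adjC // (F i k f) // (F k i) 1?farC //.
      by rewrite (A k j).
- case: kj => [<- tb|c kj tc bc|c kj tc bc] W.
  + by apply: lcm_peqr (peq_sym tb) _; apply: LcmAdj au tu.
  + by move: W; rewrite ik kj.
  + have [ts cs] : (size u).+1 < size t /\ (size c).+1 < size t.
      by have := peq_size tc; rewrite (peq_size tu) /=; lia.
    have /(G i j (k :: u) (k :: c) ts) : peq (i :: k :: u) (j :: k :: c) by rewrite -tu.
    have [eij|ij|ij] := lettersP i j; last by exfalso; far_adj.
      subst j => /lcm_eq/G h; apply: LcmEq => //; rewrite au bc.
      by have /lcm_eq -> := h (ltnW ts).
    case/(lcm_far ij) => d ud cd.
    have kj' : adj j k by rewrite adjC.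
    have ki' : adj k i by rewrite adjC.
    have [e ue de] := lcm_adj kj (G k j u d (ltnW ts) ud).
    have [e' ce' de'] := lcm_adj ki' (G k i c d (ltnW cs) cd).
    have ds : (size e).+2 < size t.
      by have := peq_size de; have := peq_size ud; rewrite /=; lia.
    have /(G k k (j :: e) (i :: e') (ltnW ds))/lcm_eq : peq (k :: j :: e) (k :: i :: e').
      by rewrite -de.
    move/(G j i e e' (ltnW (ltnW ds))) => h.
    have [g eg eg'] := lcm_far (etrans (farC j i) ij) h.
    apply: (LcmFar (c := k :: j :: i :: k :: g)) => //.
      by rewrite au ue eg (F i j) // (A i k) // (A k j).
    rewrite bc ce' eg' (F j i) 1?farC // (A j k) // (A k i) //.
    by rewrite (F i j).
Qed.

(** Outer induction on the length, inner induction on the number of rewriting steps. The first step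
    either leaves the first letter alone or replaces it by some k; in the second case [lcm_trans]
    passes through the word that starts with k. *)
Theorem garside_lcm i j a b : peq (i :: a) (j :: b) -> lcm_spec i j a b.
Proof.
have [L] := ubnP (size a); elim: L i j a b => // L IH i j a b aL [t].
have {}IH i' j' a' b' : size a' < size a -> peq (i' :: a') (j' :: b') ->
    lcm_spec i' j' a' b' by move=> h; apply: IH; lia.
elim: t i a aL IH => [|t IHt] i a aL IH.
  by inversion 1; subst; apply: LcmEq.
case/stepsSP=> v st vb.
inversion st as [i' u' v' uv|i' k u ik|i' k u ik]; subst.
- have va := step_size uv.
  apply: (lcm_peql (peq_step uv)); apply: IHt vb; first by rewrite -va.
  by rewrite -va.
- apply: (lcm_trans (k := k) (t := i :: u)); first exact: IH.
    exact: LcmFar ik (peq_refl _) (peq_refl _).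
  exact: IHt vb.
- apply: (lcm_trans (k := k) (t := i :: k :: u)); first exact: IH.
    exact: LcmAdj ik (peq_refl _) (peq_refl _).
  exact: IHt vb.
Qed.

Lemma peq_cancel u v w : peq (u ++ v) (u ++ w) -> peq v w.
Proof. by elim: u => //= i u IH /garside_lcm/lcm_eq/IH. Qed.

Lemma peq_rev u v : peq u v -> peq (rev u) (rev v).
Proof.
elim/peq_ind=> {u v} // u v w uv; apply: peq_trans.
elim: uv => {u v w} [i u v _ IH|i j u ij|i j u ij]; rewrite !rev_cons -!cats1.
- exact: peq_cat.
- rewrite -!catA; apply: peq_cat => //=; apply: peq_far; by rewrite farC.
- rewrite -!catA; apply: peq_cat => //=; exact: peq_adj.
Qed.

(** * Commutation rules, crossings of blocks and half twists *)

Lemma peq_far_cat i u : all (far i) u -> peq (i :: u) (u ++ [:: i]).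
Proof.
elim: u => //= j u IH /andP[ij /IH iu].
by rewrite peq_far // iu.
Qed.

Lemma peq_comm u v : all (fun i => all (far i) v) u -> peq (u ++ v) (v ++ u).
Proof.
elim: u => [|i u IH] /=; first by rewrite cats0.
case/andP=> iv /IH uv.
by rewrite uv -cat_cons (peq_far_cat iv) -catA.
Qed.

Lemma peq_comm_lt c u v : all (fun i => i.+1 < c) u -> all (leq c) v ->
  peq (u ++ v) (v ++ u).
Proof.
move=> uc vc; apply: peq_comm; apply/allP => i /(allP uc) ic.
by apply/allP => j /(allP vc) jc; rewrite /far; lia.
Qed.

(** The word [iota i q] carries one strand past q others, so a crossing of two of those others is
    renumbered by one when moved through it. *)
Lemma peq_shift i q j : i <= j -> j.+1 < i + q ->
  peq (j.+1 :: iota i q) (iota i q ++ [:: j]).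
Proof.
move=> ij jq.
have -> : q = (j - i) + (i + q - j.+2).+2 by lia.
rewrite iotaD subnKC //=; set u := iota i _; set v := iota _ _.
have uj : all (far j.+1) u by apply/allP => k; rewrite mem_iota /far; lia.
have vj : all (far j) v by apply/allP => k; rewrite mem_iota /far; lia.
rewrite -cat_cons (peq_far_cat uj) -!catA /=.
apply: peq_cat => //; rewrite (peq_adj (i := j.+1)); last by rewrite /adj eqxx orbT.
by rewrite (peq_far_cat vj).
Qed.

Lemma peq_shift_cat i q u : all (fun j => (i <= j) && (j.+1 < i + q)) u ->
  peq (map succn u ++ iota i q) (iota i q ++ u).
Proof.
elim: u => [|j u IH] /=; first by rewrite cats0.
case/andP=> /andP[ij jq] /IH uE.
by rewrite uE -cat_cons peq_shift // -catA.
Qed.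

(* The longest (p, q)-shuffle of the strands a, ..., a + p + q - 1; half_twist   *)
(* is the longest permutation of the strands a, ..., a + k - 1.                  *)
Fixpoint crossing (a p q : nat) : seq nat :=
  if p is p'.+1 then iota (a + p') q ++ crossing a p' q else [::].

Fixpoint half_twist (a k : nat) : seq nat :=
  if k is k'.+1 then half_twist a k' ++ rev (iota a k') else [::].

Lemma crossing_letters a p q : all (fun j => (a <= j) && (j.+1 < a + p + q)) (crossing a p q).
Proof.
elim: p => //= p IH; rewrite all_cat; apply/andP; split.
  by apply/allP => j; rewrite mem_iota; lia.
by apply: sub_all IH => j; lia.
Qed.

Lemma half_twist_letters a k : all (fun j => (a <= j) && (j.+1 < a + k)) (half_twist a k).
Proof.
elim: k => //= k IH; rewrite all_cat all_rev; apply/andP; split.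
  by apply: sub_all IH => j; lia.
by apply/allP => j; rewrite mem_iota; lia.
Qed.

Lemma iotaS_map i q : iota i.+1 q = map succn (iota i q).
Proof. exact: (iotaDl 1). Qed.

Lemma crossingS a p q : crossing a.+1 p q = map succn (crossing a p q).
Proof. by elim: p => //= p ->; rewrite map_cat -iotaS_map. Qed.

Lemma half_twistS a k : half_twist a.+1 k = map succn (half_twist a k).
Proof. by elim: k => //= k ->; rewrite map_cat map_rev -iotaS_map. Qed.

Lemma crossingn0 a p : crossing a p 0 = [::].
Proof. by elim: p. Qed.

Lemma crossingn1 a p : crossing a p 1 = rev (iota a p).
Proof. by elim: p => // p IH; rewrite -[in RHS]addn1 iotaD rev_cat -IH. Qed.

(** Both sides lift the permutation that reverses the order of three blocks, with each pair of
    strands from different blocks crossing once. *)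
Lemma crossing_assoc a p q r :
  peq (crossing a p q ++ crossing a (p + q) r)
      (crossing (a + p) q r ++ crossing a p (q + r)).
Proof.
elim: p => [|p IH] /=; first by rewrite addn0 cats0.
rewrite addnS crossingS.
have h : peq (crossing a p q ++ iota (a + (p + q)) r)
             (iota (a + (p + q)) r ++ crossing a p q).
  apply: (peq_comm_lt (c := a + (p + q))).
    by apply: sub_all (crossing_letters a p q) => j; lia.
  by apply/allP => j; rewrite mem_iota; lia.
rewrite [X in peq _ X]catA peq_shift_cat; last first.
  by apply: sub_all (crossing_letters (a + p) q r) => j; lia.
rewrite -catA (catA (crossing a p q)) h iotaD -!catA addnA.
by rewrite IH.
Qed.

(** The longest permutation is the product of the longest permutations of two blocks and the longest
    shuffle of these blocks. *)
Lemma half_twist_cat a p q :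
  peq (half_twist a p ++ half_twist (a + p) q ++ crossing a p q) (half_twist a (p + q)).
Proof.
elim: q => [|q IH]; first by rewrite crossingn0 cats0 addn0 cats0.
rewrite addnS [half_twist (a + p) _]/= [X in peq _ X]/= -!crossingn1 -[q.+1]addn1.
by rewrite -(catA (half_twist (a + p) q)) -crossing_assoc !catA -(catA _ _ (crossing a p q)) IH.
Qed.

Lemma half_twist_iota a k :
  peq (half_twist a.+1 k ++ iota a k) (iota a k ++ half_twist a k).
Proof.
rewrite half_twistS; apply: peq_shift_cat; exact: half_twist_letters.
Qed.

Lemma half_twist_consr a k : peq (half_twist a k.+1) (half_twist a.+1 k ++ iota a k).
Proof.
symmetry; have := half_twist_cat a 1 k.
by rewrite add1n addn1 [crossing _ _ _]/= addn0 cats0.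
Qed.

Lemma half_twist_consl a k : peq (half_twist a k.+1) (iota a k ++ half_twist a k).
Proof. by rewrite half_twist_consr half_twist_iota. Qed.

Lemma half_twist_dvd a k j : a <= j -> j.+1 < a + k ->
  exists x, peq (half_twist a k) (j :: x).
Proof.
move=> aj jk; have -> : k = (j - a) + (a + k - j.+2).+2 by lia.
have uj : all (far j) (half_twist a (j - a)).
  by apply: sub_all (half_twist_letters a (j - a)) => i; rewrite /far; lia.
have h v : peq (half_twist a (j - a) ++ j :: v) (j :: half_twist a (j - a) ++ v).
  by rewrite -cat1s catA -(peq_far_cat uj).
by eexists; rewrite -half_twist_cat subnKC // half_twist_consl; exact: h.
Qed.

(** Conjugation by the half twist reflects the order of the strands; reflecting twice gives the
    centrality of [full_twist]. *)
Lemma half_twist_conj k j : j.+1 < k ->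
  peq (j :: half_twist 0 k) (half_twist 0 k ++ [:: k - j.+2]).
Proof.
elim: k j => // k IH j jk.
have [jk'|jk'] := ltnP j.+1 k.
  have h : peq ([:: k - j.+2] ++ rev (iota 0 k)) (rev (iota 0 k) ++ [:: (k - j.+2).+1]).
    have := peq_rev (@peq_shift 0 k (k - j.+2) isT _).
    rewrite rev_cons rev_cat -cats1 => h; symmetry; apply: h; lia.
  rewrite /= -cat_cons IH // -catA h -catA.
  by have -> : (k - j.+2).+1 = k.+1 - j.+2 by lia.
case: k IH jk jk' => [|[|k]] IH jk jk'; [lia| |].
  by have -> : j = 0 by lia.
have -> : j = k.+1 by lia.
rewrite half_twist_consl -cat_cons peq_shift //.
by rewrite -!catA cat1s IH // !subnn /= !catA.
Qed.

(** * The central full twist, and divisibility by half twists *)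

Definition full_twist k := half_twist 0 k ++ half_twist 0 k.

Lemma full_twist_central k u : all (fun j => j.+1 < k) u ->
  peq (u ++ full_twist k) (full_twist k ++ u).
Proof.
elim: u => [|j u IH] /=; first by rewrite cats0.
case/andP=> jk /IH ->; rewrite -cat_cons.
have -> : peq (j :: full_twist k) (full_twist k ++ [:: j]).
  rewrite /full_twist -cat_cons half_twist_conj // -!catA.
  rewrite cat1s half_twist_conj; last by lia.
  by have -> : k - (k - j.+2).+2 = j by lia.
by rewrite -catA.
Qed.

Lemma far_dvd i z v u : all (far i) v -> peq (i :: z) (v ++ u) ->
  exists2 u', peq u (i :: u') & peq z (v ++ u').
Proof.
elim: v z => [|j v IH] z /=; first by move=> _ h; exists z => //; symmetry.
case/andP=> ij iv /garside_lcm h; have [c zc vc] := lcm_far ij h.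
have [|u' uu cu] := IH c iv; first by symmetry.
by exists u' => //; rewrite zc cu.
Qed.

(** The letters a and a + 1 are adjacent, so Garside's theorem makes a and then a + 1 divide what
    follows; a passes the far letters, and the argument repeats with a + 1. *)
Lemma iota_dvd a q z u : peq (a :: z) (iota a.+1 q ++ u) ->
  exists u', peq u (iota a q.+1 ++ u').
Proof.
elim: q a z u => [|q IH] a z u /=; first by move=> h; exists z; symmetry.
have aa : adj a a.+1 by rewrite /adj eqxx.
move=> /garside_lcm h0; have [c _ h] := lcm_adj aa h0.
have fa : all (far a) (iota a.+2 q) by apply/allP => j; rewrite mem_iota /far; lia.
have [u1 uu1 cu1] := far_dvd fa (peq_sym h).
by have [u' u1u] := IH _ _ _ cu1; exists u'; rewrite uu1 u1u.
Qed.

(** With [half_twist_consr] this says that the half twist of one more strand divides every common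
    multiple of the new generator a and of the half twist starting at a + 1. *)
Lemma half_twist_lcm a q z x : peq (a :: z) (half_twist a.+1 q ++ x) ->
  exists x', peq x (iota a q ++ x').
Proof.
elim: q z x => [|q IH] z x; first by move=> _; exists x.
rewrite half_twist_consl -catA => /iota_dvd[u hu].
have [|x1 xx1] := IH (iota a.+1 q ++ u) x.
  by rewrite -[a :: _]/(iota a q.+1 ++ u); symmetry.
have /peq_cancel h : peq (iota a q ++ (a + q) :: u) (iota a q ++ half_twist a q ++ x1).
  rewrite catA -half_twist_iota -catA -xx1 hu -[q.+1]addn1 iotaD -catA; exact: peq_refl.
have fa : all (far (a + q)) (half_twist a q).
  by apply: sub_all (half_twist_letters a q) => j; rewrite /far; lia.
have [x2 xx2 _] := far_dvd fa h.
by exists x2; rewrite xx1 xx2 -[q.+1]addn1 iotaD -catA; exact: peq_refl.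
Qed.

(** * The shuffle complex *)

Import Order.TTheory GRing.Theory Num.Theory.
Local Open Scope ring_scope.

Definition braid_ops (X : zmodType) (s : nat -> {additive X -> X}) : Prop :=
  (forall i j x, far i j -> s i (s j x) = s j (s i x)) /\
  (forall i j x, adj i j -> s i (s j (s i x)) = s j (s i (s j x))).

Section Shuffle.
Variables (X : zmodType) (s : nat -> {additive X -> X}).

Definition act (u : seq nat) (x : X) : X := foldr (fun j => s j) x u.

(* The signed sum of the (p, q)-shuffles of the strands a, ..., a + p + q - 1,   *)
(* split according to the block that contains the last strand.                  *)
Fixpoint shuffle (a p : nat) : nat -> X -> X :=
  if p is p'.+1 then
    fix shuffle_p q := if q is q'.+1 then fun x =>
      shuffle_p q' x + act (iota (a + p') q) (shuffle a p' q x) *~ (-1) ^+ q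
    else id
  else fun=> id.

Lemma shuffle0n a q x : shuffle a 0 q x = x. Proof. by []. Qed.
Lemma shufflen0 a p x : shuffle a p 0 x = x. Proof. by case: p. Qed.
Lemma shuffleSS a p q x : shuffle a p.+1 q.+1 x =
  shuffle a p.+1 q x + act (iota (a + p) q.+1) (shuffle a p q.+1 x) *~ (-1) ^+ q.+1.
Proof. by []. Qed.

Lemma act_cat u v x : act (u ++ v) x = act u (act v x).
Proof. exact: foldr_cat. Qed.

Lemma act_is_zmod_morphism u : zmod_morphism (act u).
Proof. by move=> x y; elim: u => //= j u ->; rewrite raddfB. Qed.

HB.instance Definition _ u :=
  GRing.isZmodMorphism.Build X X (act u) (act_is_zmod_morphism u).

Lemma shuffle_is_zmod_morphism a p q : zmod_morphism (shuffle a p q).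
Proof.
elim: p q => [|p IHp] q //; elim: q => [|q IHq] // x y.
by rewrite !shuffleSS IHq IHp raddfB mulrzBl opprD addrACA.
Qed.

HB.instance Definition _ a p q :=
  GRing.isZmodMorphism.Build X X (shuffle a p q) (shuffle_is_zmod_morphism a p q).

Lemma shuffleD a p q x y : shuffle a p q (x + y) = shuffle a p q x + shuffle a p q y.
Proof. exact: raddfD. Qed.
Lemma shuffleMz a p q n x : shuffle a p q (x *~ n) = shuffle a p q x *~ n.
Proof. exact: raddfMz. Qed.

Hypothesis s_ops : braid_ops s.

Lemma act_peq u v x : peq u v -> act u x = act v x.
Proof.
elim/peq_ind=> {u v} // u v w uv <-.
by elim: uv => {u v w} [i u v _ /= ->|i j u ij|i j u ij] //=; [apply s_ops.1|apply s_ops.2].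
Qed.

End Shuffle.

(** Writing the positions as [k + a] and [k' + a] lets one induction yield commutation with far
    operators, renumbering of strands ([shuffle_shift]) and transport to another module
    ([rho_diff]). *)
Lemma shuffle_morph (X Y : zmodType) (s : nat -> {additive X -> X})
    (s' : nat -> {additive Y -> Y}) (f : {additive X -> Y}) k k' a p q x :
  (forall j y, (a <= j)%N -> (j.+1 < a + p + q)%N ->
     f (s (k + j)%N y) = s' (k' + j)%N (f y)) ->
  f (shuffle s (k + a) p q x) = shuffle s' (k' + a) p q (f x).
Proof.
move=> fs.
have fact u y : all (fun j => (a <= j)%N && (j.+1 < a + p + q)%N) u ->
    f (act s (map (addn k) u) y) = act s' (map (addn k') u) (f y).
  by elim: u => //= j u IH /andP[/andP[aj jq] /IH uE]; rewrite fs // uE.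
elim: p q x fs fact => [|p IHp] q // x fs fact.
elim: q x fs fact => [|q IHq] // x fs fact.
rewrite !shuffleSS raddfD raddfMz; congr (_ + _ *~ _).
  by apply: IHq => [j y aj jq|u y uq]; [apply: fs|apply: fact; apply: sub_all uq => j]; lia.
rewrite -(addnA k) -(addnA k') (iotaDl k) (iotaDl k') fact; last first.
  by apply/allP => j; rewrite mem_iota; lia.
by rewrite IHp // => [j y aj jq|u y uq]; [apply: fs|apply: fact; apply: sub_all uq => j]; lia.
Qed.

(** * Shuffles of three blocks *)

Section Coassociativity.
Variables (X : zmodType) (s : nat -> {additive X -> X}).
Hypothesis s_ops : braid_ops s.
Local Notation shuffle := (shuffle s).
Local Notation act := (act s).

Lemma act_comm u v x : all (fun i => all (far i) v) u ->
  act u (act v x) = act v (act u x).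
Proof. by move=> uv; rewrite -!act_cat; apply: act_peq => //; exact: peq_comm. Qed.

Lemma shuffle_act_comm a p q u x : all (leq (a + p + q)) u ->
  shuffle a p q (act u x) = act u (shuffle a p q x).
Proof.
move=> uc; rewrite -[a]add0n; symmetry; apply: shuffle_morph => j y aj jq.
apply: (@act_comm u [:: (0 + j)%N]); apply/allP => i /(allP uc) /=.
by rewrite andbT /far add0n; lia.
Qed.

Lemma shuffle_comm a p q b p' q' x : (a + p + q <= b)%N ->
  shuffle a p q (shuffle b p' q' x) = shuffle b p' q' (shuffle a p q x).
Proof.
move=> ab; rewrite -[b]add0n; apply: shuffle_morph => j y bj _.
apply: (@shuffle_act_comm _ _ _ [:: (0 + j)%N]).
by rewrite /= andbT add0n (leq_trans ab).
Qed.

Lemma shuffle_shift a p q i r x : (i <= a)%N -> (a + p + q <= i + r)%N ->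
  shuffle a.+1 p q (act (iota i r) x) = act (iota i r) (shuffle a p q x).
Proof.
move=> ia ar; rewrite -[a]add0n -[_.+1]add1n addnA; symmetry.
apply: shuffle_morph => j y aj jq.
have : act (iota i r ++ [:: j]) y = act (j.+1 :: iota i r) y.
  by apply: act_peq => //; apply/peq_sym/peq_shift => //; lia.
by rewrite act_cat.
Qed.

(** Three blocks can be shuffled in two stages in two ways. Induction on the total size, splitting
    both sides by the block that contains the last strand. *)
Lemma shuffle_assoc a p q r x :
  shuffle a p q (shuffle a (p + q) r x) = shuffle (a + p) q r (shuffle a p (q + r) x).
Proof.
have [n] := ubnP (p + q + r); elim: n p q r x => // n IH [|p] [|q] [|r] x pqr;
  rewrite ?shuffle0n ?shufflen0 ?addn0 ?add0n ?shufflen0 ?shuffle0n //.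
set P := p.+1; set Q := q.+1; set R := r.+1.
have -> : shuffle a (P + Q) R x = shuffle a (P + Q) r x
    + act (iota (a + p + Q) R) (shuffle a (p + Q) R x) *~ (-1) ^+ R.
  by rewrite [(P + Q)%N]addSn shuffleSS addnA.
have -> : shuffle a P (Q + R) x = shuffle a P (Q + r) x
    + act (iota (a + p) (Q + R)) (shuffle a p (Q + R) x) *~ (-1) ^+ (Q + R).
  by rewrite addnS shuffleSS.
rewrite [LHS]shuffleD [RHS]shuffleD !shuffleMz IH; last by lia.
(* Here the last strand has already moved past the third block; the two summands say whether it
   belongs to the second block or to the first. *)
have -> : shuffle a P Q (act (iota (a + p + Q) R) (shuffle a (p + Q) R x))
   = act (iota (a + p + Q) R) (shuffle (a + P) q R (shuffle a P (Q + r) x))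
     + act (iota (a + p) (Q + R)) (shuffle (a + p) Q R (shuffle a p (Q + R) x)) *~ (-1) ^+ Q.
  have cP : all (leq (a + P + q)) (iota (a + p + Q) R).
    by apply/allP => j; rewrite mem_iota; lia.
  have cQ : all (leq (a + p + Q)) (iota (a + p + Q) R).
    by apply/allP => j; rewrite mem_iota; lia.
  rewrite shuffleSS !shuffle_act_comm // -IH; last by lia.
  rewrite iotaD act_cat; congr (act _ _ + act _ (act _ _) *~ _).
  have -> : (p + Q = P + q)%N by lia.
  by rewrite IH ?addnS //; lia.
have -> : shuffle (a + P) Q R (act (iota (a + p) (Q + R)) (shuffle a p (Q + R) x))
    = act (iota (a + p) (Q + R)) (shuffle (a + p) Q R (shuffle a p (Q + R) x)).
  by rewrite addnS shuffle_shift //; lia.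
have -> : shuffle (a + P) Q R (shuffle a P (Q + r) x)
    = shuffle (a + P) Q r (shuffle a P (Q + r) x)
      + act (iota (a + p + Q) R) (shuffle (a + P) q R (shuffle a P (Q + r) x)) *~ (-1) ^+ R.
  have -> : (a + p + Q = a + P + q)%N by lia.
  exact: shuffleSS.
by rewrite mulrzDl -addrA -mulrzA -exprD.
Qed.

End Coassociativity.

(** * Sets of generators as compositions into blocks of strands *)

Section Runs.
Variable m : nat.
Implicit Types (U : {set 'I_m}) (i : 'I_m).

Definition in_gens U (j : nat) : bool := if insub j is Some i then i \in U else false.

Lemma in_gensE U i : in_gens U i = (i \in U).
Proof. by rewrite /in_gens valK. Qed.

Lemma in_gens_lt U j : in_gens U j -> (j < m)%N.
Proof. by rewrite /in_gens; case: insubP => // i ->. Qed.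

Lemma in_gensU1 U i j : in_gens (i |: U) j = (j == i) || in_gens U j.
Proof.
rewrite /in_gens; case: insubP => [k _ <-|jm]; first by rewrite !inE.
by rewrite orbF; apply/esym; apply: contraNF jm => /eqP ->.
Qed.

Fixpoint run_lo U (j : nat) : nat :=
  if j is j'.+1 then if in_gens U j' then run_lo U j' else j else 0.

(** The argument k is fuel; m steps suffice because no generator of U is m or larger. *)
Fixpoint run_up U (j k : nat) : nat :=
  if k is k'.+1 then if in_gens U j then run_up U j.+1 k' else j else j.

Definition run_hi U (j : nat) : nat := run_up U j.+1 m.

(* [lo, hi) is the largest interval around i all of whose elements other than i *)
(* belong to U: then i joins the blocks [lo, i] and [i + 1, hi] of strands.     *)
Variant is_run U (lo i hi : nat) : Prop :=
  IsRun of (lo <= i)%N & (i < hi)%N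
    & (forall j, (lo <= j)%N -> (j < hi)%N -> j != i -> in_gens U j)
    & (forall j, j.+1 = lo -> ~~ in_gens U j) & ~~ in_gens U hi.

Lemma run_loP U (i : nat) : [/\ (run_lo U i <= i)%N,
    (forall j, (run_lo U i <= j)%N -> (j < i)%N -> in_gens U j)
    & (forall j, j.+1 = run_lo U i -> ~~ in_gens U j)].
Proof.
elim: i => [|i [h1 h2 h3]] /=; first by split=> // j; rewrite ltn0.
case: ifP => hi; last by split=> // j; [lia|case=> ->; rewrite hi].
split=> //; first exact: leqW.
by move=> j lj; rewrite ltnS leq_eqVlt => /orP[/eqP -> //|]; exact: h2.
Qed.

Lemma run_upP U j k : (m <= j + k)%N -> [/\ (j <= run_up U j k)%N,
    (forall l, (j <= l)%N -> (l < run_up U j k)%N -> in_gens U l)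
    & ~~ in_gens U (run_up U j k)].
Proof.
elim: k j => [|k IH] j mj /=.
  split=> // [l|]; first lia.
  by apply/negP => /in_gens_lt; lia.
case: ifP => hj; last by split=> [//|l|]; [lia|rewrite hj].
have [|h1 h2 h3] := IH j.+1; first by lia.
split=> //; first exact: ltnW.
by move=> l; rewrite leq_eqVlt => /orP[/eqP <- //|]; exact: h2.
Qed.

Lemma runP U (i : nat) : is_run U (run_lo U i) i (run_hi U i).
Proof.
have [h1 h2 h3] := run_loP U i.
have [|u1 u2 u3] := @run_upP U i.+1 m; first by lia.
split=> // j lj ju; rewrite neq_ltn => /orP[ji|ij]; [exact: h2|exact: u2].
Qed.

Lemma run_uniq U lo (i : nat) hi lo' hi' : is_run U lo i hi -> is_run U lo' i hi' ->
  lo = lo' /\ hi = hi'.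
Proof.
have W lo1 hi1 lo2 hi2 : is_run U lo1 i hi1 -> is_run U lo2 i hi2 ->
    (lo1 <= lo2)%N /\ (hi2 <= hi1)%N.
  move=> [h1 h2 h3 h4 h5] [k1 k2 k3 k4 k5]; split; rewrite leqNgt; apply/negP => h.
    by have /negP := h4 lo1.-1 ltac:(lia); apply; apply: k3; lia.
  by move/negP: h5; apply; apply: k3; lia.
by move=> r r'; have [h1 h2] := W _ _ _ _ r r'; have [h3 h4] := W _ _ _ _ r' r; lia.
Qed.

Definition rank U i : nat := #|[set j in U | (j < i)%N]|.

Lemma rankU1 U i j : j \notin U -> rank (j |: U) i = ((j < i) + rank U i)%N.
Proof.
move=> jU; rewrite /rank; case: ltnP => ij.
  have := cardsU1 j [set k in U | (k < i)%N]; rewrite inE (negbTE jU) /= => <-.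
  apply: eq_card => k; rewrite !inE.
  by case: eqP => // ->; rewrite ij.
apply: eq_card => k; rewrite !inE; case: eqP => //= ->.
by rewrite (negbTE jU) ltnNge ij.
Qed.

End Runs.

Lemma sum_antisym (X : zmodType) (I : finType) (lt : rel I) (P : rel I) (F : I -> I -> X) :
  (forall i j, i != j -> lt i j = ~~ lt j i) -> irreflexive lt ->
  (forall i j, P i j = P j i) -> (forall i, ~~ P i i) ->
  (forall i j, P i j -> lt i j -> F i j = - F j i) ->
  \sum_i \sum_(j | P i j) F i j = 0.
Proof.
move=> ltC lt0 PC P0 FC.
rewrite (eq_bigr (fun i => \sum_(j | P i j && lt i j) F i j
   + \sum_(j | P i j && ~~ lt i j) F i j)); last by move=> i _; exact: bigID.
rewrite big_split /=.
have -> : \sum_i \sum_(j | P i j && ~~ lt i j) F i j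
    = \sum_i \sum_(j | P i j && lt i j) F j i.
  rewrite (exchange_big_dep predT) //=; apply: eq_bigr => i _; apply: eq_bigl => j.
  rewrite PC; case Pij : (P i j) => //=; rewrite -ltC //.
  by apply: contraTneq Pij => ->; rewrite (negbTE (P0 _)).
rewrite -big_split big1 // => i _ /=; rewrite -big_split big1 // => j /andP[Pij ij] /=.
by rewrite (FC i j) // addNr.
Qed.

(** * The differential and its square *)

Section Complex.
Variables (m : nat) (X : zmodType) (s : nat -> {additive X -> X}).
Implicit Types (U : {set 'I_m}) (i : 'I_m).

Definition chain := {ffun {set 'I_m} -> X}.
HB.instance Definition _ := GRing.Zmodule.on chain.

Lemma chain_subE (z w : chain) U : (z - w) U = z U - w U.
Proof. by rewrite !ffunE. Qed.

Definition chain_eval U (z : chain) : X := z U.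
Lemma chain_eval_zmod_morphism U : zmod_morphism (chain_eval U).
Proof. by move=> x y; rewrite /chain_eval chain_subE. Qed.
HB.instance Definition _ U :=
  GRing.isZmodMorphism.Build chain X (chain_eval U) (chain_eval_zmod_morphism U).

Lemma chain_mulrzE (z : chain) k U : (z *~ k) U = z U *~ k.
Proof. exact: (raddfMz (chain_eval U)). Qed.

Definition merge_op U i : X -> X :=
  shuffle s (run_lo U i) (i - run_lo U i).+1 (run_hi U i - i).
HB.instance Definition _ U i := GRing.Additive.copy (merge_op U i)
  (shuffle s (run_lo U i) (i - run_lo U i).+1 (run_hi U i - i)).

(** Used twice: on [left_module], where it gives a resolution of the coefficients, and on a braid
    module itself, where it gives the small complex. *)
Definition diff (x : chain) : chain :=
  [ffun U : {set 'I_m} => \sum_(i | i \notin U) merge_op U i (x (i |: U)) *~ (-1) ^+ rank U i].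

Lemma merge_opE U i lo hi : is_run U lo i hi ->
  merge_op U i = shuffle s lo (i - lo).+1 (hi - i).
Proof. by move=> r; have [-> ->] := run_uniq r (runP U i). Qed.

Lemma diff_is_zmod_morphism : zmod_morphism diff.
Proof.
move=> x y; apply/ffunP => U; rewrite !ffunE -sumrB; apply: eq_bigr => i _.
by rewrite !ffunE raddfB mulrzBl.
Qed.
HB.instance Definition _ :=
  GRing.isZmodMorphism.Build chain chain diff diff_is_zmod_morphism.

Hypothesis s_ops : braid_ops s.

(** If j is the next break after i, three consecutive blocks are involved and [shuffle_assoc]
    applies. Otherwise the two pairs of blocks are disjoint and [shuffle_comm] applies. *)
Lemma merge_opC U (i j : 'I_m) x : (i < j)%N -> i \notin U -> j \notin U ->
  merge_op U i (merge_op (i |: U) j x) = merge_op U j (merge_op (j |: U) i x).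
Proof.
move=> ij iU jU; have [l1 h1 in1 out1 top1] := runP U i.
have [l2 h2 in2 out2 top2] := runP U j.
set lo1 := run_lo U i in l1 in1 out1; set hi1 := run_hi U i in h1 in1 top1.
set lo2 := run_lo U j in l2 in2 out2; set hi2 := run_hi U j in h2 in2 top2.
have hij : (hi1 <= j)%N.
  by rewrite leqNgt; apply/negP => h; move/negP: jU; apply; rewrite -in_gensE in1; lia.
have ilo : (i < lo2)%N.
  by rewrite ltnNge; apply/negP => h; move/negP: iU; apply; rewrite -in_gensE in2; lia.
have hilo : (hi1 < j)%N -> (hi1 < lo2)%N.
  move=> h; rewrite ltnNge; apply/negP => lo2h.
  by move/negP: top1; apply; rewrite in2; lia.
move: hij; rewrite leq_eqVlt => /orP[/eqP hij|hij].
- have lo2E : lo2 = i.+1.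
    have [//|lo2i] := eqVneq lo2 i.+1.
    by have /negP := out2 lo2.-1 ltac:(lia); case; apply: in1; lia.
  rewrite (merge_opE (lo := lo1) (hi := j) (U := U)); last by rewrite -hij.
  rewrite (merge_opE (lo := lo1) (hi := hi2) (i := j)); last first.
    split; [lia|lia| | |]; rewrite ?in_gensU1.
    + move=> k k1 k2 kj; rewrite in_gensU1.
      have [->//|ki] := eqVneq k i; case: (ltnP k j) => kj'; [apply: in1|apply: in2]; lia.
    + by move=> k k1; rewrite in_gensU1 negb_or out1 // andbT; lia.
    + by rewrite negb_or top2 andbT; lia.
  rewrite (merge_opE (lo := i.+1) (hi := hi2) (U := U)); last by rewrite -lo2E.
  rewrite (merge_opE (lo := lo1) (hi := hi2) (i := i)); last first.
    split; [lia|lia| | |]; rewrite ?in_gensU1.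
    + move=> k k1 k2 kj; rewrite in_gensU1.
      have [->//|ki] := eqVneq k j; case: (ltnP k j) => kj'; [apply: in1|apply: in2]; lia.
    + by move=> k k1; rewrite in_gensU1 negb_or out1 // andbT; lia.
    + by rewrite negb_or top2 andbT; lia.
  have := shuffle_assoc s_ops lo1 (i - lo1).+1 (j - i) (hi2 - j) x.
  have -> : ((i - lo1).+1 + (j - i) = (j - lo1).+1)%N by lia.
  have -> : (lo1 + (i - lo1).+1 = i.+1)%N by lia.
  have -> : ((j - i) + (hi2 - j) = hi2 - i)%N by lia.
  by have -> : ((j - i.+1).+1 = j - i)%N by lia.
- have {}hilo := hilo hij.
  rewrite (merge_opE (lo := lo1) (hi := hi1) (U := U)) //.
  rewrite (merge_opE (lo := lo2) (hi := hi2) (i := j)); last first.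
    split=> //; rewrite ?in_gensU1.
    + by move=> k k1 k2 kj; rewrite in_gensU1 in2 ?orbT.
    + by move=> k k1; rewrite in_gensU1 negb_or out2 // andbT; lia.
    + by rewrite negb_or top2 andbT; lia.
  rewrite (merge_opE (lo := lo2) (hi := hi2) (U := U)) //.
  rewrite (merge_opE (lo := lo1) (hi := hi1) (i := i)); last first.
    split=> //; rewrite ?in_gensU1.
    + by move=> k k1 k2 kj; rewrite in_gensU1 in1 ?orbT.
    + by move=> k k1; rewrite in_gensU1 negb_or out1 // andbT; lia.
    + by rewrite negb_or top1 andbT; lia.
  by rewrite shuffle_comm //; lia.
Qed.

Lemma diff_diff x : diff (diff x) = 0.
Proof.
apply/ffunP => U; rewrite [LHS]ffunE [RHS]ffunE.
pose F i j := merge_op U i (merge_op (i |: U) j (x (j |: (i |: U))))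
   *~ ((-1) ^+ rank U i * (-1) ^+ rank (i |: U) j).
rewrite big_mkcond /= (eq_bigr (fun i => \sum_(j | [&& i \notin U, j \notin U & i != j]) F i j)).
  apply: (sum_antisym (lt := fun i j => (i < j)%N)).
  - by move=> i j ij; rewrite -leqNgt ltn_neqAle ij.
  - by move=> i; rewrite ltnn.
  - by move=> i j; rewrite andbCA [j == i]eq_sym.
  - by move=> i; rewrite eqxx !andbF.
  move=> i j /and3P[iU jU _] ij; rewrite /F merge_opC //.
  rewrite setUCA !rankU1 // ij ltnNge (ltnW ij) add0n add1n exprS mulN1r mulrN mulrNz.
  by rewrite [(-1) ^+ _ * _]mulrC.
move=> i _; case: ifP => iU; last by rewrite big_pred0 // => j.
rewrite ffunE raddf_sum mulrz_suml; apply: eq_big => [j|j _].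
  by rewrite !inE negb_or andbC eq_sym.
by rewrite raddfMz -mulrzA mulrC.
Qed.

End Complex.

Lemma diff_morph (m : nat) (X Y : zmodType) (s : nat -> {additive X -> X})
    (s' : nat -> {additive Y -> Y}) (f : {additive X -> Y}) (z : chain m X) :
  (forall j x, f (s j x) = s' j (f x)) ->
  diff s' [ffun U => f (z U)] = [ffun U => f (diff s z U)].
Proof.
move=> fs; apply/ffunP => U; rewrite !ffunE raddf_sum; apply: eq_bigr => i _.
rewrite raddfMz ffunE /=; congr (_ *~ _); rewrite /merge_op -[run_lo U i]add0n.
by symmetry; apply: shuffle_morph.
Qed.

(** * Half twists of parabolic submonoids and their divisibility *)

Section ParabolicTwist.
Local Open Scope nat_scope.
Variable m : nat.
Implicit Types (U V : {set 'I_m}) (i : 'I_m).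

Lemma run_lo_uniq U lo j : lo <= j -> (forall k, lo <= k -> k < j -> in_gens U k) ->
  (forall k, k.+1 = lo -> ~~ in_gens U k) -> run_lo U j = lo.
Proof.
have [h1 h2 h3] := run_loP U j => l1 l2 l3; apply/eqP; rewrite eqn_leq.
apply/andP; split; rewrite leqNgt; apply/negP => h.
  by have /negP := h3 (run_lo U j).-1 ltac:(lia); apply; apply: l2; lia.
by have /negP := l3 lo.-1 ltac:(lia); apply; apply: h2; lia.
Qed.

Definition twist_part U a k : seq nat :=
  flatten [seq if in_gens U j then rev (iota (run_lo U j) (j - run_lo U j).+1) else [::]
          | j <- iota a k].

(* The half twist of the standard parabolic subgroup generated by U, that is,   *)
(* the least common multiple of the generators in U.                            *)
Definition twist U : seq nat := twist_part U 0 m.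

Lemma twist_partD U a k l : twist_part U a (k + l) = twist_part U a k ++ twist_part U (a + k) l.
Proof. by rewrite /twist_part iotaD map_cat flatten_cat. Qed.

Lemma twist_part_eq U V a k :
  (forall j, a <= j -> j < a + k -> in_gens U j = in_gens V j) ->
  (forall j, a <= j -> j < a + k -> in_gens U j -> run_lo U j = run_lo V j) ->
  twist_part U a k = twist_part V a k.
Proof.
move=> h h'; congr flatten; apply/eq_in_map => j; rewrite mem_iota => /andP[aj jk].
by rewrite -h //; case: ifP => // Uj; rewrite h'.
Qed.

Lemma twist_part_block U lo k : (forall j, lo <= j -> j < lo + k -> in_gens U j) ->
  (forall j, j.+1 = lo -> ~~ in_gens U j) -> twist_part U lo k = half_twist lo k.+1.
Proof.
move=> h1 h2; elim: k h1 => [|k IH] h1 //.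
rewrite -[in LHS]addn1 twist_partD IH; last by move=> j l1 l2; apply: h1; lia.
rewrite [RHS]/=; congr (_ ++ _); rewrite /twist_part /= h1; [|lia|lia].
rewrite (run_lo_uniq (lo := lo)) ?cats0 //; [|lia|].
  by rewrite addKn.
by move=> j l1 l2; apply: h1; lia.
Qed.

Lemma twist_part_letters U a k :
  all (fun l => in_gens U l && (l < a + k)) (twist_part U a k).
Proof.
apply/allP => l /flattenP[u /mapP[j]]; rewrite mem_iota => /andP[aj jk] ->.
case: ifP => // Uj; rewrite mem_rev mem_iota => /andP[l1 l2].
have [h1 h2 _] := run_loP U j; rewrite (_ : l < a + k); last by lia.
by rewrite andbT; have [->//|lj] := eqVneq l j; apply: h2; lia.
Qed.

Lemma twist_part_above U a k : ~~ in_gens U a ->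
  all (leq a.+1) (twist_part U a k).
Proof.
move=> Ua; apply/allP => l /flattenP[u /mapP[j]]; rewrite mem_iota => /andP[aj jk] ->.
case: ifP => // Uj; rewrite mem_rev mem_iota => /andP[l1 l2].
have [h1 h2 _] := run_loP U j; rewrite ltnNge; apply: contra Ua => la.
by have [->//|aj'] := eqVneq a j; apply: h2; lia.
Qed.

Lemma twist_block U lo hi : lo <= hi -> hi <= m ->
  (forall j, lo <= j -> j < hi -> in_gens U j) ->
  (forall j, j.+1 = lo -> ~~ in_gens U j) ->
  twist U = twist_part U 0 lo ++ half_twist lo (hi - lo).+1 ++ twist_part U hi (m - hi).
Proof.
move=> lohi him h1 h2; rewrite /twist -[X in twist_part U 0 X](subnKC him).
rewrite twist_partD -[X in twist_part U 0 X ++ _](subnKC lohi) twist_partD -catA.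
by rewrite [twist_part U (0 + lo) _]twist_part_block // => j l1 l2; apply: h1; lia.
Qed.

Lemma is_run_hi U lo i hi : is_run U lo i hi -> hi <= m.
Proof.
case=> lo_i i_hi h _ _; have [->|hi1] := eqVneq hi i.+1; first exact: ltn_ord.
by have := in_gens_lt (h hi.-1 ltac:(lia) ltac:(lia) ltac:(lia)); lia.
Qed.

Lemma twistU1_block U lo i hi : is_run U lo i hi ->
  twist (i |: U) = twist_part U 0 lo ++ half_twist lo (hi - lo).+1
                   ++ twist_part U hi (m - hi).
Proof.
move=> r; have him := is_run_hi r; case: r => lo_i i_hi h out top.
rewrite (twist_block (lo := lo) (hi := hi)) //; [|lia| |].
- congr (_ ++ (_ ++ _)); apply: twist_part_eq => j j1 j2.
  + by rewrite in_gensU1; case: eqP => // ?; lia.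
  + rewrite in_gensU1 => /orP[/eqP|Uj]; first lia.
    have [r1 r2 r3] := run_loP U j; apply: run_lo_uniq => // k k1.
      by move=> k2; rewrite in_gensU1 r2 ?orbT.
    by rewrite in_gensU1 negb_or r3 // andbT; lia.
  + by rewrite in_gensU1; case: eqP => // ?; lia.
  + rewrite in_gensU1 => /orP[/eqP|Uj]; first lia.
    have [r1 r2 r3] := run_loP U j; apply: run_lo_uniq => // k k1.
      by move=> k2; rewrite in_gensU1 r2 ?orbT.
    rewrite in_gensU1 negb_or r3 // andbT; apply/negP => /eqP ki.
    have hij : hi < j by rewrite ltn_neqAle j1 andbT; apply: contraNneq top => ->.
    by move/negP: top; apply; apply: r2; lia.
- move=> j j1 j2; rewrite in_gensU1; case: eqP => //= /eqP; exact: h.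
- by move=> j j1; rewrite in_gensU1 negb_or out // andbT; lia.
Qed.

Lemma twist_split U lo i hi : is_run U lo i hi -> i \notin U ->
  twist U = twist_part U 0 lo ++ half_twist lo (i - lo).+1
            ++ half_twist i.+1 (hi - i) ++ twist_part U hi (m - hi).
Proof.
move=> r iU; have him := is_run_hi r; case: r => lo_i i_hi h out top.
have {}iU : in_gens U i = false by rewrite in_gensE (negbTE iU).
rewrite (twist_block (lo := lo) (hi := i)) //; [|exact: ltnW| ]; last first.
  by move=> j j1 j2; apply: h; lia.
congr (_ ++ (_ ++ _)); have -> : m - i = 1 + ((hi - i.+1) + (m - hi)) by lia.
rewrite !twist_partD {1}/twist_part /= iU addn1 subnKC //; congr (_ ++ _).
rewrite twist_part_block; last by move=> j [->]; rewrite iU.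
  by have -> : (hi - i.+1).+1 = hi - i by lia.
by move=> j j1 j2; apply: h; lia.
Qed.

(** This is [half_twist_cat] in the block that i creates; the half twists of the later blocks
    commute with the crossing. *)
Lemma twistU1 U lo i hi : is_run U lo i hi -> i \notin U ->
  peq (twist U ++ crossing lo (i - lo).+1 (hi - i)) (twist (i |: U)).
Proof.
move=> r iU; rewrite (twist_split r iU) (twistU1_block r).
case: r => lo_i i_hi h out top; rewrite -(catA (twist_part U 0 lo)).
apply: peq_cat; first exact: peq_refl.
rewrite -(catA (half_twist lo _)) -(catA (half_twist i.+1 _)).
set B := twist_part U hi _; set c := crossing _ _ _.
have Bc : peq (B ++ c) (c ++ B).
  apply: peq_sym; apply: (peq_comm_lt (c := hi.+1)).
    by apply: sub_all (crossing_letters _ _ _) => j; lia.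
  exact: twist_part_above.
rewrite Bc (catA (half_twist i.+1 _)) (catA (half_twist lo _)).
apply: peq_cat; last exact: peq_refl.
rewrite /c.
have -> : i.+1 = lo + (i - lo).+1 by lia.
have -> : (hi - lo).+1 = (i - lo).+1 + (hi - i) by lia.
exact: half_twist_cat.
Qed.

(** As i precedes all of U, it is alone in front of the run that it joins: the half twists of the
    other blocks commute with everything involved, and [half_twist_lcm] applies to this run. *)
Lemma twist_lcm U lo i hi (z x : seq nat) : is_run U lo i hi -> i \notin U ->
  (forall j, in_gens U j -> i < j) -> peq ((i : nat) :: z) (twist U ++ x) ->
  exists x', peq x (crossing lo (i - lo).+1 (hi - i) ++ x').
Proof.
move=> r iU minU; rewrite (twist_split r iU); case: r => lo_i i_hi h out top.
have -> : lo = i.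
  apply/eqP; rewrite eqn_leq lo_i leqNgt; apply/negP => loi.
  by have := minU lo (h lo (leqnn _) ltac:(lia) ltac:(lia)); lia.
have -> : twist_part U 0 i = [::].
  case E : (twist_part U 0 i) => [//|l u].
  have := twist_part_letters U 0 i; rewrite E /= => /andP[/andP[/minU il li] _]; lia.
rewrite subnn /= addn0 cats0 -!catA.
set B := twist_part U hi _ => zx.
have Bl : all (leq hi.+1) B by exact: twist_part_above.
have Bi : all (far i) B by apply: sub_all Bl => l; rewrite /far; lia.
have BD : peq (half_twist i.+1 (hi - i) ++ B) (B ++ half_twist i.+1 (hi - i)).
  apply: (peq_comm_lt (c := hi.+1)) => //.
  by apply: sub_all (half_twist_letters _ _) => j; lia.
have h1 : peq ((i : nat) :: z) (B ++ half_twist i.+1 (hi - i) ++ x).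
  rewrite zx (catA _ B) BD -(catA B); exact: peq_refl.
have [u' /peq_sym uu' _] := far_dvd Bi h1.
exact: half_twist_lcm uu'.
Qed.

Lemma twist_dvd U i : i \in U -> exists x : seq nat, peq (twist U) ((i : nat) :: x).
Proof.
move=> iU; have r := runP (U :\ i) i; rewrite -(setD1K iU) (twistU1_block r).
have him := is_run_hi r; case: r; set lo := run_lo _ _; set hi := run_hi _ _.
move=> lo_i i_hi h out top.
have [|x hx] := @half_twist_dvd lo (hi - lo).+1 i lo_i; first by lia.
set A := twist_part _ 0 lo.
have Ai : all (far i) A.
  apply: sub_all (twist_part_letters _ _ _) => l /andP[Ul l1].
  have ll : l.+1 != lo by apply: contraTneq Ul => /out.
  by rewrite /far; lia.
exists (A ++ x ++ twist_part (U :\ i) hi (m - hi)).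
rewrite hx -cat_cons (peq_far_cat Ai) -(catA A); exact: peq_refl.
Qed.

Lemma twist_letters U : all (in_gens U) (twist U).
Proof. by apply: sub_all (twist_part_letters _ _ _) => l /andP[]. Qed.

End ParabolicTwist.

(** * Positive braids in the braid group *)

Section PositiveBraids.
Variable n : nat.
Local Notation G := (braid_group n).
Local Notation m := n.-1.

Definition gen (j : nat) : G := if insub j is Some i then sigma i else 1%g.

Definition word_gen (u : seq nat) : G := foldr (fun j g => (gen j * g)%g) 1%g u.

Lemma genE (i : 'I_m) : gen i = sigma i.
Proof. by rewrite /gen valK. Qed.

Lemma word_gen_cat u v : word_gen (u ++ v) = (word_gen u * word_gen v)%g.
Proof. by elim: u => [|j u IH] /=; rewrite ?mul1g // IH mulgA. Qed.

Lemma sigma_mul (u : braid_word n) i :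
  (sigma i * braid_of_word u)%g = braid_of_word ((i, true) :: u).
Proof. exact: (@braid_mulE n [:: (i, true)] u). Qed.

Lemma sigma_mul2 (i j : 'I_m) : (sigma i * sigma j)%g = braid_of_word [:: (i, true); (j, true)].
Proof. exact: (@braid_mulE n [:: (i, true)] [:: (j, true)]). Qed.

Definition strands : pred nat := fun j => (j < m)%N.

Lemma gen_far i j : far i j -> (gen i * gen j)%g = (gen j * gen i)%g.
Proof.
rewrite /gen; case: insubP => [i' _ <-|_] /=; last by rewrite mul1g mulg1.
case: insubP => [j' _ <-|_] /=; last by rewrite mul1g mulg1.
have W (k l : 'I_m) : (k.+1 < l)%N -> (sigma k * sigma l = sigma l * sigma k)%g.
  by move=> kl; rewrite !sigma_mul2; apply/braid_of_wordP/braid_eq_comm.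
by case/orP=> /W.
Qed.

Lemma gen_adj a b : strands a -> strands b -> adj a b ->
  (gen a * (gen b * gen a) = gen b * (gen a * gen b))%g.
Proof.
rewrite /strands => am bm; rewrite -[a]/(val (Ordinal am)) -[b]/(val (Ordinal bm)) !genE.
have W (k l : 'I_m) : k.+1 = l ->
    (sigma k * (sigma l * sigma k) = sigma l * (sigma k * sigma l))%g.
  by move=> kl; rewrite !sigma_mul2 !sigma_mul; apply/braid_of_wordP/braid_eq_braid/esym.
by case/orP=> /eqP/W.
Qed.

Lemma word_gen_peq u v : all strands u -> peq u v -> word_gen u = word_gen v.
Proof.
move=> us uv; elim/peq_ind: uv us => {u v} // u v w uv IH us.
rewrite -IH; last by rewrite -(step_all _ uv).
elim: uv us => {u v w IH} [i u v _ IH /= /andP[_ /IH ->]//|i j u ij _|i j u ij].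
  by rewrite /= !mulgA gen_far.
case/and4P=> im jm _ _.
have E a b c : word_gen [:: a, b, c & u] = (gen a * (gen b * gen c) * word_gen u)%g.
  by rewrite /= !mulgA.
by rewrite !E gen_adj.
Qed.

Definition pos (g : G) : Prop := exists2 u, all strands u & g = word_gen u.

Lemma pos1 : pos 1%g. Proof. by exists [::]. Qed.
Lemma posM g h : pos g -> pos h -> pos (g * h)%g.
Proof.
by move=> [u us ->] [v vs ->]; exists (u ++ v); rewrite ?all_cat ?us ?word_gen_cat.
Qed.

Lemma in_full_twist (i : 'I_m) : exists x, peq (full_twist n) ((i : nat) :: x).
Proof.
have [||x hx] := @half_twist_dvd 0 n i; [by []|by have := ltn_ord i; lia|].
by exists (x ++ half_twist 0 n); rewrite /full_twist hx.
Qed.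

Lemma strands_full_twist : all strands (full_twist n).
Proof.
by rewrite all_cat andbb; apply: sub_all (half_twist_letters 0 n) => j; rewrite /strands; lia.
Qed.

Lemma full_twist_comm u : all strands u -> peq (u ++ full_twist n) (full_twist n ++ u).
Proof.
move=> us; apply: full_twist_central; apply: sub_all us => j; rewrite /strands; lia.
Qed.

(* Every braid word is, up to a power of the central full twist, a positive word; *)
(* as the positive monoid is cancellative, it therefore embeds in the group.      *)
Theorem word_gen_inj u v : all strands u -> all strands v ->
  word_gen u = word_gen v -> peq u v.
Proof.
have /fin_all_exists[star starP] := in_full_twist.
have star_strands i : all strands (star i).
  by have := peq_all strands (starP i); rewrite strands_full_twist /= => /esym/andP[].
have star_cancel i : peq (star i ++ [:: i : nat]) (full_twist n).
  apply: (@peq_cancel [:: i : nat]); rewrite /= -cat_cons -starP.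
  by rewrite -full_twist_comm //= andbT; exact: ltn_ord.
pose F k := flatten (nseq k (full_twist n)).
have FD k l : F (k + l)%N = F k ++ F l by rewrite /F nseqD flatten_cat.
have FC k w : all strands w -> peq (w ++ F k) (F k ++ w).
  move=> ws; elim: k => [|k IH]; first by rewrite cats0.
  rewrite -add1n FD catA {1}/F /= cats0 (full_twist_comm ws) -catA IH catA.
  by rewrite [in X in peq _ X]/F /= cats0; exact: peq_refl.
pose pw (x : 'I_m * bool) : seq nat := if x.2 then [:: x.1 : nat] else star x.1.
pose P (w : braid_word n) := flatten [seq pw x | x <- w].
pose neg (w : braid_word n) := count (fun x => ~~ x.2) w.
have Pcat w w' : P (w ++ w') = P w ++ P w' by rewrite /P map_cat flatten_cat.
have negcat w w' : neg (w ++ w') = (neg w + neg w')%N by exact: count_cat.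
have Pstrands w : all strands (P w).
  elim: w => //= -[i b] w IH; rewrite /P /= all_cat IH andbT.
  by case: b => //=; rewrite ?star_strands // andbT; exact: ltn_ord.
(* In the group, [P w] is w times the full twist to the power [neg w], because each inverse
   generator was multiplied by one central full twist. The equivalence compares such expressions
   with denominators cleared, and is checked on each rule of [braid_eq] inside the positive
   monoid. *)
have key w w' : braid_eq w w' -> peq (P w ++ F (neg w')) (P w' ++ F (neg w)).
  elim=> {w w'} [w|w w' _ ->|a b c _ ab _ bc|a a' b b' _ aa _ bb|i b|i j ij|i j ij].
  - exact: peq_refl.
  - exact: peq_refl.
  - apply: (@peq_cancel (F (neg b))); rewrite !catA -!(FC (neg b)) // ab.
    by rewrite -catA -FD addnC FD catA bc.
  - rewrite !Pcat !negcat !FD.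
    rewrite -(catA (P a)) (catA (P b)) (FC _ (P b)) // -(catA (F (neg a'))).
    rewrite bb catA aa -(catA (P a')).
    by rewrite -(catA (P a')) (catA (P b')) (FC (neg a) (P b')) // -(catA (F (neg a))).
  - have -> : neg [:: (i, b); (i, ~~ b)] = 1 by case: b.
    rewrite /F /= /P /= !cats0 /pw /=; case: b => /=.
      by rewrite -starP.
    by rewrite star_cancel.
  - by rewrite /P /= /pw /=; apply: peq_far; rewrite /far ij.
  - by rewrite /P /= /pw /=; apply: peq_adj; rewrite /adj ij eqxx.
pose lift (w : seq nat) : braid_word n := [seq (i, true) | i <- pmap insub w].
have liftE w : all strands w -> P (lift w) = w /\ word_gen w = braid_of_word (lift w).
  elim: w => //= j w IH /andP[jm /IH[PE wE]]; rewrite /lift /= insubT /=.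
  split; first by rewrite /P /= -/(P _) PE.
  by rewrite wE -sigma_mul -genE.
have neg_lift w : neg (lift w) = 0 by rewrite /neg /lift count_map; elim: (pmap _ _).
move=> us vs; have [Pu ->] := liftE u us; have [Pv ->] := liftE v vs.
by move/braid_of_wordP/key; rewrite Pu Pv !neg_lift !cats0.
Qed.

(** The homomorphism to the integers that sends every generator to 1. On positive braids it is the
    word length, which will grade the filtration. *)
Definition exponent (w : braid_word n) : int := \sum_(x <- w) (-1) ^+ (~~ x.2).

Lemma exponent_eq u v : braid_eq u v -> exponent u = exponent v.
Proof.
elim=> {u v} // [u v w _ -> _ -> //|u u' v v' _ e _ e'|j b|j k _|j k _]; rewrite /exponent.
- by rewrite !big_cat /= -!/(exponent _) e e'.
- by rewrite !big_cons !big_nil; case: b.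
- by rewrite !big_cons.
- by rewrite !big_cons.
Qed.

Definition len (g : G) : int := exponent (repr g).

Lemma lenE u : len (braid_of_word u) = exponent u.
Proof. exact/exponent_eq/braid_repr. Qed.

Lemma lenM g h : len (g * h)%g = len g + len h.
Proof.
have [u ->] := braid_wordE g; have [v ->] := braid_wordE h.
by rewrite [(_ * _)%g]braid_mulE !lenE /exponent big_cat.
Qed.

Lemma len1 : len 1%g = 0. Proof. by rewrite lenE /exponent big_nil. Qed.

Lemma lenV g : len g^-1%g = - len g.
Proof. by apply/eqP; rewrite -addr_eq0 -lenM mulVg len1. Qed.

Lemma len_gen j : strands j -> len (gen j) = 1.
Proof. by move=> jm; rewrite /gen insubT lenE /exponent big_cons big_nil addr0. Qed.

Lemma len_word u : all strands u -> len (word_gen u) = (size u)%:Z.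
Proof.
elim: u => [|j u IH] /=; first by rewrite len1.
by case/andP=> jm /IH uE; rewrite lenM uE len_gen // -PoszD.
Qed.

End PositiveBraids.

(** * Exactness over the group ring *)

Section MalgLift.
Variables (K : choiceType) (A Y : zmodType).

(** The additivity proof is an argument so that every [mlift F_add] carries a canonical additive
    structure. *)
Definition mlift (F : K -> A -> Y) (_ : forall k, zmod_morphism (F k))
  (x : {malg A[K]}) : Y := \sum_(k <- msupp x) F k x@_k.

Variables (F : K -> A -> Y) (F_add : forall k, zmod_morphism (F k)).

Lemma mlift0 k : F k 0 = 0.
Proof. by have := F_add k 0 0; rewrite !subrr. Qed.

Lemma mlift_fset (x : {malg A[K]}) (S : {fset K}) :
  (msupp x `<=` S)%fset -> mlift F_add x = \sum_(k <- S) F k x@_k.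
Proof.
move=> xS; rewrite /mlift (big_fset_incl _ xS) // => k _ kx.
by rewrite mcoeff_outdom // mlift0.
Qed.

Lemma mlift_is_zmod_morphism : zmod_morphism (mlift F_add).
Proof.
move=> x y; pose S := (msupp x `|` msupp y `|` msupp (x - y))%fset.
rewrite (mlift_fset (S := S) (x := x)); last by apply/fsubsetP => k; rewrite !in_fsetU => ->.
rewrite (mlift_fset (S := S) (x := y)); last first.
  by apply/fsubsetP => k; rewrite !in_fsetU => ->; rewrite orbT.
rewrite (mlift_fset (S := S) (x := x - y)); last first.
  by apply/fsubsetP => k; rewrite !in_fsetU => ->; rewrite orbT.
by rewrite -sumrB; apply: eq_bigr => k _; rewrite mcoeffB F_add.
Qed.
HB.instance Definition _ :=
  GRing.isZmodMorphism.Build {malg A[K]} Y (mlift F_add) mlift_is_zmod_morphism.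

Lemma mliftU k a : mlift F_add << a *g k >> = F k a.
Proof. by rewrite (mlift_fset msuppU_le) big_seq_fset1 mcoeffUU. Qed.

Lemma malg_additive_ext (f g : {additive {malg A[K]} -> Y}) :
  (forall k a, f << a *g k >> = g << a *g k >>) -> f =1 g.
Proof.
by move=> fg x; rewrite [x]monalgE !raddf_sum; apply: eq_bigr => k _; exact: fg.
Qed.

End MalgLift.

Section BraidModule.
Variables (n : nat) (M : gmodule (braid_group n)).

(* With the value 0 out of range, the braid relations hold for all indices.     *)
Definition ops_fun (j : nat) (x : M) : M := if (j < n.-1)%N then gm_act M (gen n j) x else 0.

Lemma ops_is_zmod_morphism j : zmod_morphism (ops_fun j).
Proof. by move=> x y; rewrite /ops_fun; case: ifP => _; rewrite ?raddfB ?subrr. Qed.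
HB.instance Definition _ j :=
  GRing.isZmodMorphism.Build M M (ops_fun j) (ops_is_zmod_morphism j).

Definition ops (j : nat) : {additive M -> M} := ops_fun j.

Lemma opsE j x : (j < n.-1)%N -> ops j x = gm_act M (gen n j) x.
Proof. by rewrite /= /ops_fun => ->. Qed.

Lemma ops_out j x : ~~ (j < n.-1)%N -> ops j x = 0.
Proof. by rewrite /= /ops_fun => /negbTE ->. Qed.

Lemma ops_braid : braid_ops ops.
Proof.
split=> i j x ij; have [im|im] := boolP (i < n.-1)%N; have [jm|jm] := boolP (j < n.-1)%N;
  rewrite ?(ops_out _ im) ?(ops_out _ jm) ?raddf0 ?(ops_out _ im) ?(ops_out _ jm) ?raddf0 //.
  by rewrite !opsE // -!gm_actM gen_far.
by rewrite !opsE // -!gm_actM -!mulgA gen_adj.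
Qed.

Lemma act_ops u x : all (strands n) u -> act ops u x = gm_act M (word_gen n u) x.
Proof.
elim: u => [|j u IH] /=; first by rewrite gm_act1.
by case/andP=> jm /IH ->; rewrite gm_actM -opsE.
Qed.

End BraidModule.

(** * The group ring with coefficients, and supports of shuffles *)

Section FreeModule.
Variables (n : nat) (T : zmodType).
Local Notation G := (braid_group n).
Local Notation m := n.-1.
Local Notation TG := {malg T[G]}.

Lemma monalgU_zmod_morphism (k : G) : zmod_morphism (fun t : T => << t *g k >> : TG).
Proof. by move=> x y; rewrite monalgUB. Qed.

Definition lmul (h : G) : TG -> TG := mlift (fun g => monalgU_zmod_morphism (h * g)%g).
HB.instance Definition _ h := GRing.Additive.on (lmul h).

Lemma lmulU h t g : lmul h << t *g g >> = << t *g (h * g)%g >>.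
Proof. exact: mliftU. Qed.

Lemma lmul1 x : lmul 1%g x = x.
Proof.
by apply: (malg_additive_ext (f := lmul 1%g) (g := idfun)) => g t /=; rewrite lmulU mul1g.
Qed.

Lemma lmulM h k x : lmul (h * k)%g x = lmul h (lmul k x).
Proof.
apply: (malg_additive_ext (f := lmul (h * k)%g) (g := lmul h \o lmul k)) => g t /=.
by rewrite !lmulU mulgA.
Qed.

Definition left_module : gmodule G :=
  @GModule G TG (fun h => lmul h : {additive TG -> TG}) lmul1 lmulM.

Lemma lmul_coef h x g : (lmul h x)@_g = x@_(h^-1 * g)%g.
Proof.
apply: (malg_additive_ext (f := mcoeff g \o lmul h) (g := mcoeff (h^-1 * g)%g)) => k t /=.
rewrite lmulU !mcoeffU; congr (_ *+ nat_of_bool _).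
by apply/eqP/eqP => [<-|->]; rewrite ?mulKg ?mulVKg.
Qed.

(** Right multiplication commutes with the left operators, hence with the differential: it clears
    denominators in [left_module_exact]. *)
Definition rmul (h : G) : TG -> TG := mlift (fun g => monalgU_zmod_morphism (g * h)%g).
HB.instance Definition _ h := GRing.Additive.on (rmul h).

Lemma rmulU h t g : rmul h << t *g g >> = << t *g (g * h)%g >>.
Proof. exact: mliftU. Qed.

Lemma rmulK h : cancel (rmul h) (rmul h^-1%g).
Proof.
apply: (malg_additive_ext (f := rmul h^-1%g \o rmul h) (g := idfun)) => g t /=.
by rewrite !rmulU mulgK.
Qed.

Lemma rmul_coef h x g : (rmul h x)@_g = x@_(g * h^-1)%g.
Proof.
apply: (malg_additive_ext (f := mcoeff g \o rmul h) (g := mcoeff (g * h^-1)%g)) => k t /=.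
rewrite rmulU !mcoeffU; congr (_ *+ nat_of_bool _).
by apply/eqP/eqP => [<-|->]; rewrite ?mulgK ?mulgVK.
Qed.

Definition aug : TG -> T := mlift (fun g : G => (fun x y => erefl) : zmod_morphism (@id T)).
HB.instance Definition _ := GRing.Additive.on aug.

Lemma augU t g : aug << t *g g >> = t.
Proof. exact: mliftU. Qed.

Local Notation X := left_module.
Local Notation d := (@diff m X (ops X)).

Lemma rmul_lmul h k x : rmul h (lmul k x) = lmul k (rmul h x).
Proof.
apply: (malg_additive_ext (f := rmul h \o lmul k) (g := lmul k \o rmul h)) => g t /=.
by rewrite !(rmulU, lmulU) mulgA.
Qed.

Lemma aug_lmul h x : aug (lmul h x) = aug x.
Proof.
apply: (malg_additive_ext (f := aug \o lmul h) (g := aug)) => g t /=.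
by rewrite lmulU !augU.
Qed.

Lemma rmul_ops h j x : rmul h (ops X j x) = ops X j (rmul h x).
Proof.
have [jm|jm] := boolP (j < m)%N; first by rewrite !opsE //; exact: rmul_lmul.
by rewrite !ops_out // raddf0.
Qed.

Lemma mcoeffMz g (x : TG) k : (x *~ k)@_g = x@_g *~ k.
Proof. exact: raddfMz. Qed.

Definition bounded (l : int) (x : X) := forall g, x@_g != 0 -> len g <= l.

Lemma bounded_sum l (x y : X) : bounded l x -> bounded l y -> bounded l (x + y).
Proof.
move=> bx by_ g; rewrite mcoeffD; have [->|/bx//] := eqVneq (x@_g) 0.
by rewrite add0r; exact: by_.
Qed.

Lemma bounded_mulrz l k (x : X) : bounded l x -> bounded l (x *~ k).
Proof.
move=> bx g xg; apply: bx; apply: contraNneq xg => xg0.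
by rewrite mcoeffMz xg0 mul0rz.
Qed.

Lemma bounded_le l l' x : l <= l' -> bounded l x -> bounded l' x.
Proof. by move=> ll bx g /bx h; apply: le_trans ll. Qed.

Lemma bounded_act l u (x : X) : bounded l x -> bounded (l + (size u)%:Z) (act (ops X) u x).
Proof.
elim: u => [|j u IH] /=; first by rewrite addr0.
move/IH => bx; have [jm|jm] := boolP (j < m)%N; last first.
  by rewrite -[ops_fun _ _]/(ops X j _) ops_out // => g; rewrite mcoeff0 eqxx.
rewrite -[ops_fun _ _]/(ops X j _) opsE // => g; rewrite lmul_coef => /bx.
by rewrite lenM lenV len_gen //; lia.
Qed.

Lemma bounded_shuffle l a p q (x : X) : bounded l x ->
  bounded (l + (p * q)%N%:Z) (shuffle (ops X) a p q x).
Proof.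
move=> bx; elim: p q => [|p IHp] q; first by rewrite mul0n addr0.
elim: q => [|q IHq]; first by rewrite muln0 addr0.
rewrite shuffleSS; apply: bounded_sum.
  by apply: bounded_le IHq; rewrite lerD2l lez_nat leq_mul2l leqnSn orbT.
apply: bounded_mulrz; have := bounded_act (u := iota (a + p) q.+1) (IHp q.+1).
by apply: bounded_le; rewrite size_iota -addrA -PoszD mulSn addnC.
Qed.

(** All shuffles other than [crossing a p q] are shorter than p q, so in the top length this one
    alone contributes, with its sign. *)
Lemma shuffle_lead l a p q (x : X) g : bounded l x -> (a + p + q <= m.+1)%N ->
  len g = l + (p * q)%N%:Z ->
  (shuffle (ops X) a p q x)@_g
  = x@_((word_gen n (crossing a p q))^-1 * g)%g *~ (-1) ^+ (p * q).
Proof.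
move=> bx; elim: p q g => [|p IHp] q g; first by rewrite /= invg1 mul1g.
case: q => [|q]; first by rewrite crossingn0 muln0 /= invg1 mul1g.
move=> am lg; rewrite shuffleSS mcoeffD mcoeffMz.
have -> : (shuffle (ops X) a p.+1 q x)@_g = 0.
  apply/eqP; apply: contraT => /(bounded_shuffle bx).
  by rewrite lg lerD2l lez_nat leq_mul2l /= ltnn.
have sl : all (strands n) (iota (a + p) q.+1).
  by apply/allP => j; rewrite mem_iota /strands; lia.
rewrite add0r act_ops // lmul_coef IHp; last 2 first.
- by lia.
- by rewrite lenM lenV len_word // lg size_iota mulSn; lia.
rewrite -mulrzA -exprD [crossing a p.+1 q.+1](_ : _ = iota (a + p) q.+1 ++ crossing a p q.+1) //.
rewrite mulgA -invgM -word_gen_cat; by congr (_ *~ _ ^+ _); rewrite mulSn addnC.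
Qed.

Definition pos_supp (x : X) := forall g, x@_g != 0 -> pos g.

Lemma pos_supp_shuffle a p q x : pos_supp x -> pos_supp (shuffle (ops X) a p q x).
Proof.
have pos_act u y : pos_supp y -> pos_supp (act (ops X) u y).
  elim: u => //= j u IH /IH py; have [jm|jm] := boolP (j < m)%N; last first.
    by rewrite -[ops_fun _ _]/(ops X j _) ops_out // => g; rewrite mcoeff0 eqxx.
  rewrite -[ops_fun _ _]/(ops X j _) opsE // => g; rewrite lmul_coef => /py h.
  rewrite -(mulVKg (gen n j) g); apply: posM => //.
  by exists [:: j]; rewrite /= ?mulg1 ?andbT.
move=> px; elim: p q => [|p IHp] q //; elim: q => [|q IHq] // g.
rewrite shuffleSS mcoeffD; have [h0|/IHq//] := eqVneq (shuffle (ops X) a p.+1 q x)@_g 0.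
rewrite h0 add0r mcoeffMz => h; apply: (pos_act (iota (a + p) q.+1)) (IHp q.+1) _ _.
by apply: contraNneq h => ->; rewrite mul0rz.
Qed.

End FreeModule.

(** * The shuffle complex over the group ring is a resolution *)

Section Exactness.
Variables (n : nat) (T : zmodType).
Local Notation G := (braid_group n).
Local Notation m := n.-1.
Local Notation X := (left_module n T).
Local Notation d := (@diff m X (ops X)).
Local Notation C := (chain m X).
Implicit Types (U : {set 'I_m}) (i : 'I_m) (z : C) (g y : G) (L : nat).

Definition tw U : G := word_gen n (twist U).

Lemma strands_twist U : all (strands n) (twist U).
Proof. by apply: sub_all (twist_letters U) => j; exact: in_gens_lt. Qed.

Lemma pos_tw U : pos (tw U).
Proof. by exists (twist U); rewrite ?strands_twist. Qed.

Lemma len_tw U : len (tw U) = (size (twist U))%:Z.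
Proof. by rewrite len_word ?strands_twist. Qed.

Lemma pos_gen (j : 'I_m) : pos (gen n j).
Proof. by exists [:: val j]; rewrite /= ?mulg1 // andbT; exact: ltn_ord. Qed.

Lemma pos_len g : pos g -> 0 <= len g.
Proof. by move=> [u us ->]; rewrite len_word. Qed.

Lemma twU1 U i lo hi : is_run U lo i hi -> i \notin U ->
  tw (i |: U) = (tw U * word_gen n (crossing lo (i - lo).+1 (hi - i)))%g.
Proof.
move=> r iU; rewrite /tw -word_gen_cat; symmetry; apply: word_gen_peq (twistU1 r iU).
have him := is_run_hi r; case: r => lo_i i_hi _ _ _.
rewrite all_cat strands_twist andTb; apply: sub_all (crossing_letters _ _ _) => j.
by rewrite /strands; lia.
Qed.

Lemma size_twistU1 U i lo hi : is_run U lo i hi -> i \notin U ->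
  size (twist (i |: U)) = (size (twist U) + (i - lo).+1 * (hi - i))%N.
Proof.
move=> r iU; rewrite -(peq_size (twistU1 r iU)) size_cat; congr (_ + _)%N.
by elim: (_.+1) => //= p IH; rewrite size_cat size_iota IH mulSn.
Qed.

(** The apex of the cone for y. It depends on y only, so it serves all U with [twist U] dividing y;
    least, because [twist_lcm] adjoins a generator below U. *)
Definition least_gen y : option 'I_m :=
  [pick a : 'I_m | `[< pos ((gen n a)^-1 * y)%g /\
     forall b : 'I_m, pos ((gen n b)^-1 * y)%g -> (a <= b)%N >]].

Lemma least_genP y : pos y -> 0 < len y -> exists a, least_gen y = Some a.
Proof.
move=> [[|j u] us ->]; first by rewrite len1.
move=> _; have [jm us'] := andP us.
pose S := [set b : 'I_m | `[< pos ((gen n b)^-1 * word_gen n (j :: u))%g >]].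
have jS : Ordinal jm \in S.
  by rewrite inE; apply/asboolP; rewrite /= mulKg; exists u.
rewrite /least_gen; case: pickP => [a _|/(_ [arg min_(b < Ordinal jm in S) b])].
  by exists a.
case: arg_minnP => // a; rewrite inE => /asboolP aS amin /asboolP; case; split=> // b bS.
by apply: amin; rewrite inE; apply/asboolP.
Qed.

(** Every generator in U divides y, so a lies below U and [twist_lcm] applies; [word_gen_inj] turns
    the equality of braids into an equivalence of positive words. *)
Lemma least_gen_in y U a : least_gen y = Some a -> pos ((tw U)^-1 * y)%g ->
  a \notin U -> pos ((tw (a |: U))^-1 * y)%g.
Proof.
rewrite /least_gen; case: pickP => // a' /asboolP[ay amin] [<-] {a} Uy aU.
have minU j : in_gens U j -> (a' < j)%N.
  move=> jU; have jm := in_gens_lt jU; move: jU.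
  rewrite -[j]/(val (Ordinal jm)) in_gensE => jU.
  rewrite ltn_neqAle amin ?andbT; last first.
    have [x xU] := twist_dvd jU; have := strands_twist U.
    rewrite (peq_all _ xU) => /andP[_ xs].
    have -> : y = (tw U * ((tw U)^-1 * y))%g by rewrite mulVKg.
    rewrite {1}/tw (word_gen_peq (strands_twist U) xU) /= -mulgA mulKg.
    by apply: posM Uy; exists x.
  by apply: contraNneq aU => /val_inj ->.
have r := runP U a'; rewrite (twU1 r aU) invgM -mulgA.
move: ay Uy => [z zs zE] [x xs xE]; rewrite xE.
have /(twist_lcm r aU minU)[x' xx'] : peq ((a' : nat) :: z) (twist U ++ x).
  apply: (@word_gen_inj n).
  - by apply/andP; split=> //; exact: ltn_ord.
  - by rewrite all_cat strands_twist.
  - by rewrite word_gen_cat -xE mulVKg /= -zE mulVKg.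
exists x'; first by move: xs; rewrite (peq_all _ xx') all_cat => /andP[].
by rewrite (word_gen_peq xs xx') word_gen_cat mulKg.
Qed.

(* g in the component U stands for the element y = tw U * g, whose length is the *)
(* filtration degree; the leading part of the differential keeps y fixed and is *)
(* the simplicial differential on the subsets U whose twist divides y.          *)
Definition filtered L z := forall U g, (z U)@_g != 0 ->
  pos g /\ len g + (size (twist U))%:Z <= L%:Z.

Definition lead z U y : T := (z U)@_((tw U)^-1 * y)%g.

Definition sgn U i : int :=
  (-1) ^+ ((i - run_lo U i).+1 * (run_hi U i - i) + rank U i).

Lemma sgnK U i (t : T) : t *~ sgn U i *~ sgn U i = t.
Proof. by rewrite -mulrzA -expr2 sqrr_sign mulr1z. Qed.

(** In top length only the longest shuffle survives ([shuffle_lead]), and by [twU1] it is the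
    quotient of the two twists, so y does not change. *)
Lemma lead_diff L z U y : filtered L z -> len y = L%:Z ->
  lead (d z) U y = \sum_(i | i \notin U) lead z (i |: U) y *~ sgn U i.
Proof.
move=> zL yL; rewrite /lead ffunE raddf_sum; apply: eq_bigr => i iU.
have r := runP U i; have him := is_run_hi r.
have lo_i : (run_lo U i <= i)%N by case: r.
have i_hi : (i < run_hi U i)%N by case: r.
rewrite /= mcoeffMz (@shuffle_lead n T (L%:Z - (size (twist (i |: U)))%:Z)); last 3 first.
- by move=> g /zL[_]; lia.
- by lia.
- by rewrite lenM lenV len_tw yL (size_twistU1 r iU) PoszD; lia.
by rewrite mulgA -invgM -(twU1 r iU) -mulrzA -exprD.
Qed.

Lemma mcoeff_sum_neq0 (I : Type) (s : seq I) (P : pred I) (F : I -> X) g :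
  (\sum_(i <- s | P i) F i)@_g != 0 -> exists2 i, P i & (F i)@_g != 0.
Proof.
elim/big_rec: _ => [|i x Pi IH]; first by rewrite mcoeff0 eqxx.
rewrite mcoeffD; have [F0|] := eqVneq (F i)@_g 0; last by exists i.
by rewrite F0 add0r.
Qed.

Lemma filtered_diff L z : filtered L z -> filtered L (d z).
Proof.
move=> zL U g; rewrite ffunE => /mcoeff_sum_neq0[i iU].
rewrite mcoeffMz => h; have {}h : (merge_op (ops X) U i (z (i |: U)))@_g != 0.
  by apply: contraNneq h => ->; rewrite mul0rz.
split; first by apply: pos_supp_shuffle h => k /zL[].
have bz : bounded (L%:Z - (size (twist (i |: U)))%:Z) (z (i |: U)).
  by move=> k /zL[_]; lia.
have := bounded_shuffle bz h; rewrite (size_twistU1 (runP U i) iU) PoszD; lia.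
Qed.

Lemma filteredB L z z' : filtered L z -> filtered L z' -> filtered L (z - z').
Proof.
move=> zL zL' U g; rewrite !ffunE mcoeffB.
have [z0|/zL//] := eqVneq (z U)@_g 0; rewrite z0 sub0r oppr_eq0; exact: zL'.
Qed.

Lemma aug_diff z : aug (d z set0) = 0.
Proof.
rewrite ffunE raddf_sum big1 // => i _; rewrite raddfMz /=.
have run0 : is_run (set0 : {set 'I_m}) i i i.+1.
  have in0 j : in_gens (set0 : {set 'I_m}) j = false.
    by rewrite /in_gens; case: insub => // k; rewrite inE.
  split=> [//|//|j ij ji|j _|]; rewrite ?in0 //; lia.
rewrite (merge_opE _ run0) subSnn subnn shuffleSS shufflen0 /= raddfD raddfMz /=.
rewrite -[ops_fun _ _]/(ops X _ _) opsE; last by rewrite addn0 ltn_ord.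
by rewrite aug_lmul mulrN1z addrN mul0rz.
Qed.

Lemma diffB z z' : d (z - z') = d z - d z'.
Proof. exact: raddfB. Qed.

Lemma diff_diff0 z : d (d z) = 0.
Proof. exact/diff_diff/ops_braid. Qed.

(** For each y of length L + 1, the leading part of z is a cycle on a cone of subsets whose apex is
    the least generator of y; u is the cone on the part of z away from the apex. *)
Lemma filtered_step L z : filtered L.+1 z -> d z = 0 ->
  exists u, filtered L (z - d u).
Proof.
move=> zL dz0.
pose Y := undup (flatten [seq [seq (tw U * g)%g | g <- msupp (z U)] | U <- enum {set 'I_m}]).
have YP U y : lead z U y != 0 -> y \in Y.
  rewrite mcoeff_neq0 => yz; rewrite mem_undup; apply/flattenP.
  exists [seq (tw U * g)%g | g <- msupp (z U)]; first exact/map_f/mem_enum.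
  by apply/mapP; exists ((tw U)^-1 * y)%g => //; rewrite mulVKg.
(* The sign is the one with which [lead_diff] takes U to [U :\ a], so that it cancels there. *)
pose c U y : T := if least_gen y is Some a then
  if (len y == L.+1%:Z) && (a \in U) then lead z (U :\ a) y *~ sgn (U :\ a) a else 0 else 0.
pose u : C := [ffun U => \sum_(y <- Y) << c U y *g ((tw U)^-1 * y)%g >>].
have uE U y : lead u U y = c U y.
  rewrite /lead ffunE raddf_sum /=; have [yY|yY] := boolP (y \in Y).
    rewrite (bigD1_seq y) ?undup_uniq //= mcoeffUU big1 ?addr0 // => y' y'y.
    rewrite mcoeffU; case: eqP => // /mulgI e; by rewrite e eqxx in y'y.
  rewrite big_seq big1 => [|y' y'Y].
    rewrite /c; case: least_gen => // a; case: ifP => // _.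
    have [->|/YP h] := eqVneq (lead z (U :\ a) y) 0; first by rewrite mul0rz.
    by rewrite h in yY.
  by rewrite mcoeffU; case: eqP => // /mulgI e; rewrite -e y'Y in yY.
have uL : filtered L.+1 u.
  move=> U g; have -> : g = ((tw U)^-1 * (tw U * g))%g by rewrite mulKg.
  set y := (tw U * g)%g; rewrite -/(lead u U y) uE /c.
  case E : (least_gen y) => [a|]; last by rewrite eqxx.
  case: ifP => [/andP[/eqP yl aU]|_]; last by rewrite eqxx.
  move=> h; have {}h : lead z (U :\ a) y != 0 by apply: contraNneq h => ->; rewrite mul0rz.
  split; last by rewrite lenM lenV len_tw yl; lia.
  rewrite -(setD1K aU); apply: (least_gen_in E); last by rewrite !inE eqxx.
  by have [] := zL _ _ h.
exists u; set z' := z - d u.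
have z'L : filtered L.+1 z' by apply: filteredB => //; exact: filtered_diff.
have dz' : d z' = 0 by rewrite diffB dz0 diff_diff0 subrr.
have leadB z1 z2 U y : lead (z1 - z2) U y = lead z1 U y - lead z2 U y.
  by rewrite /lead !ffunE mcoeffB.
suff top U y : len y = L.+1%:Z -> lead z' U y = 0.
  move=> U g h; have [gp gl] := z'L U g h; split=> //.
  suff : len g + (size (twist U))%:Z != L.+1%:Z by lia.
  apply: contraNneq h => gE; have := top U (tw U * g)%g.
  by rewrite /lead mulKg lenM len_tw addrC gE => ->.
move=> yl; apply/eqP; apply: contraT => h.
have yp : pos y.
  have -> : y = (tw U * ((tw U)^-1 * y))%g by rewrite mulVKg.
  by apply: posM (pos_tw U) _; have [] := z'L _ _ h.
have [a aE] := least_genP yp ltac:(by rewrite yl).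
(* At length L + 1, u lives on sets containing a, so only the summand i = a of its differential
   reaches V, and it returns the value of z at V. *)
have top0 (V : {set 'I_m}) : a \notin V -> lead z' V y = 0.
  move=> aV; rewrite leadB (lead_diff V uL yl) (bigD1 a) //= big1.
    rewrite uE /c aE yl eqxx !inE eqxx /= setU1K // sgnK addr0 subrr //.
  move=> i /andP[iV ia]; rewrite uE /c aE.
  by rewrite in_setU1 [a == i]eq_sym (negbTE ia) (negbTE aV) andbF mul0rz.
have [aU|/top0 h0] := boolP (a \in U); last by rewrite h0 eqxx in h.
(* By [top0] the cycle equation at [U :\ a] has a single remaining term, the value at U. *)
have := lead_diff (U :\ a) z'L yl; rewrite dz' /lead ffunE mcoeff0.
rewrite (bigD1 a) /= ?inE ?eqxx // big1 ?addr0 => [|i /andP[iU ia]]; last first.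
  rewrite -/(lead z' (i |: U :\ a) y) top0 ?mul0rz // !inE eqxx /= orbF.
  by rewrite eq_sym.
rewrite setD1K // -/(lead z' U y) => e; move: h.
by rewrite -(sgnK (U :\ a) a (lead z' U y)) -e mul0rz eqxx.
Qed.

Lemma filtered_exact L z : filtered L z -> d z = 0 -> aug (z set0) = 0 ->
  exists w, d w = z.
Proof.
elim: L z => [|L IH] z zL dz az; last first.
  have [u uz] := filtered_step zL dz.
  have [||w wE] := IH _ uz.
  - by rewrite diffB dz diff_diff0 subrr.
  - by rewrite chain_subE raddfB /= az aug_diff subrr.
  - by exists (w + u); rewrite raddfD /= wE subrK.
(* In filtration degree 0 a chain can only be nonzero at the unit braid in the component [set0], and
   [aug] reads off this coefficient. *)
exists 0; rewrite raddf0; apply/esym/ffunP => U; apply/malgP => g.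
rewrite ffunE mcoeff0; apply/eqP; apply: contraT => h.
have [gp gl] := zL _ _ h; have g0 := pos_len gp.
have U0 : U = set0.
  apply/setP => i; rewrite inE; apply/negP => /twist_dvd[x /peq_size]; rewrite /=; lia.
have g1 : g = 1%g.
  case: gp gl {g0 h} => [[|j u] us ->] //; rewrite len_word //=; lia.
have zE : z set0 = << (z set0)@_1%g *g 1%g >>.
  apply/malgP => k; rewrite mcoeffU; have [->|k1] := eqVneq 1%g k; first by rewrite mulr1n.
  apply/eqP; apply: contraT => /zL[kp kl].
  by case: kp kl k1 => [[|j u] us ->]; rewrite ?eqxx // len_word //=; lia.
by move: h az; rewrite U0 g1 {2}zE augU => /eqP.
Qed.

(** An inverse generator becomes positive after multiplication by the full twist, which every
    generator divides; as the full twist is central, it can be multiplied on the right. *)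
Lemma ore (s : seq G) : exists h, forall g, g \in s -> pos (g * h)%g.
Proof.
have ore1 g : exists2 h, pos h & pos (g * h)%g.
  have [u ->] := braid_wordE g; elim: u => [|[j b] u [h hp uh]].
    by exists 1%g; rewrite ?mulg1; exact: pos1.
  have uE : braid_of_word ((j, b) :: u)
      = ((if b then gen n j else (gen n j)^-1) * braid_of_word u)%g.
    rewrite -[(j, b) :: u]cat1s -braid_mulE genE; case: b => //.
    by rewrite [in RHS]/sigma [((braid_of_word _)^-1)%g]braid_invE.
  rewrite uE; case: b {uE}.
    by exists h; rewrite // -mulgA; apply: posM uh; exact: pos_gen.
  have [x xE] := in_full_twist j; have fs := strands_full_twist n.
  exists (h * word_gen n (full_twist n))%g; first by apply: posM => //; exists (full_twist n).
  rewrite -mulgA (mulgA _ h); case: uh => v vs ->.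
  rewrite -word_gen_cat (word_gen_peq _ (full_twist_comm vs)); last by rewrite all_cat vs.
  rewrite word_gen_cat (word_gen_peq fs xE) /= -mulgA mulKg -word_gen_cat.
  exists (x ++ v) => //; rewrite all_cat vs andbT.
  by move: fs; rewrite (peq_all _ xE) => /andP[].
suff [h hp hs] : exists2 h, pos h & forall g, g \in s -> pos (g * h)%g by exists h.
elim: s => [|g s [h hp hs]]; first by exists 1%g; first exact: pos1.
have [k kp gk] := ore1 (g * h)%g; exists (h * k)%g; first exact: posM.
move=> g'; rewrite inE mulgA => /orP[/eqP -> //|/hs hg1]; exact: posM.
Qed.

(** A common right factor from [ore] makes the finite support of z positive. It commutes with the
    differential and preserves [aug], so [filtered_exact] applies, and the factor is divided out of
    the primitive. *)
Theorem left_module_exact z : d z = 0 -> aug (z set0) = 0 -> exists w, d w = z.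
Proof.
move=> dz az.
have [h hP] := ore (flatten [seq enum_fset (msupp (z U)) | U <- enum {set 'I_m}]).
have {}hP U g : (z U)@_g != 0 -> pos (g * h)%g.
  rewrite mcoeff_neq0 => gz; apply: hP; apply/flattenP.
  by exists (enum_fset (msupp (z U))) => //; apply/map_f/mem_enum.
pose R k (x : C) : C := [ffun U => rmul k (x U)].
have dR k x : d (R k x) = R k (d x).
  by apply: diff_morph => j y; exact: rmul_ops.
have aug_rmul k (x : X) : aug (rmul k x) = aug x.
  apply: (malg_additive_ext (f := @aug n T \o rmul k) (g := @aug n T)) => g t /=.
  by rewrite rmulU !augU.
(* Any bound on the filtration degrees of the finitely many terms would do; the sum dominates each
   of them. *)
pose L := (\sum_U (size (twist U) + \sum_(g <- msupp (z U)) `|len (g * h)%g|%N))%N.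
have zL : filtered L (R h z).
  move=> U g; rewrite ffunE rmul_coef => gz; have := hP _ _ gz; rewrite mulgVK => gp.
  split=> //; rewrite /L (bigD1 U) //= (big_fsetD1 (g * h^-1)%g) /=; last first.
    by rewrite -mcoeff_neq0.
  by rewrite mulgVK !PoszD; lia.
have [||w wE] := filtered_exact zL.
- by rewrite dR dz; apply/ffunP => U; rewrite !ffunE raddf0.
- by rewrite ffunE aug_rmul.
exists (R h^-1%g w); rewrite dR wE; apply/ffunP => U; rewrite !ffunE; exact: rmulK.
Qed.

End Exactness.

(** * Comparison with the bar complex *)

Section BarFunctor.
Variables (G : groupType) (A B : gmodule G).

Lemma monalgU_comp_zmod_morphism (I : choiceType) (Y Z : zmodType)
  (f : {additive Y -> Z}) (k : I) : zmod_morphism (fun y => << f y *g k >> : {malg Z[I]}).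
Proof. by move=> x y; rewrite raddfB monalgUB. Qed.

Definition bar_map (f : {additive A -> B}) i : bar A i -> bar B i :=
  mlift (fun gs : {ffun 'I_i -> G} => monalgU_comp_zmod_morphism f gs).
HB.instance Definition _ f i := GRing.Additive.on (@bar_map f i).

Lemma bar_mapU f i gs a : @bar_map f i << a *g gs >> = << f a *g gs >>.
Proof. exact: mliftU. Qed.

Lemma bar_map_coef f i x gs : (@bar_map f i x)@_gs = f x@_gs.
Proof.
apply: (malg_additive_ext (f := mcoeff gs \o @bar_map f i) (g := f \o mcoeff gs)) => k a /=.
by rewrite bar_mapU !mcoeffU raddfMn.
Qed.

Lemma bar_map_bnd (f : {additive A -> B}) i x :
  (forall g a, f (gm_act A g a) = gm_act B g (f a)) ->
  bar_bnd (@bar_map f i.+1 x) = bar_map f (bar_bnd x).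
Proof.
move=> fG.
apply: (malg_additive_ext (f := @bar_bnd _ B i \o @bar_map f i.+1)
  (g := @bar_map f i \o @bar_bnd _ A i)) => gs a /=.
rewrite bar_mapU !bar_bnd_monom raddf_sum; apply: eq_bigr => k _ /=.
by rewrite raddfMz /= bar_mapU /bar_coef; case: ifP => _; rewrite ?fG.
Qed.

End BarFunctor.

(** * Contraction of the bar complex of an induced module *)

Section InducedModule.
Variables (n : nat) (M : gmodule (braid_group n)).
Local Notation G := (braid_group n).
Local Notation X := (left_module n M).

Lemma conj_act_zmod_morphism (h g : G) :
  zmod_morphism (fun t : M => << gm_act M h t *g (g * h^-1)%g >> : {malg M[G]}).
Proof. by move=> x y; rewrite raddfB monalgUB. Qed.

Definition conj_act (h : G) : X -> X := mlift (conj_act_zmod_morphism h).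
HB.instance Definition _ h := GRing.Additive.on (conj_act h).

Lemma conj_actU h t g : conj_act h << t *g g >> = << gm_act M h t *g (g * h^-1)%g >>.
Proof. exact: mliftU. Qed.

Lemma conj_act1 x : conj_act 1%g x = x.
Proof.
apply: (malg_additive_ext (f := conj_act 1%g) (g := idfun)) => g t /=.
by rewrite conj_actU gm_act1 invg1 mulg1.
Qed.

Lemma conj_actM h k x : conj_act (h * k)%g x = conj_act h (conj_act k x).
Proof.
apply: (malg_additive_ext (f := conj_act (h * k)%g) (g := conj_act h \o conj_act k)) => g t /=.
by rewrite !conj_actU gm_actM invgM mulgA.
Qed.

(* Z[G] (x) M, where g (x) t is << t *g g^-1 >>, with the diagonal action of G. *)
Definition conj_module : gmodule G :=
  @GModule G X (fun h => conj_act h : {additive X -> X}) conj_act1 conj_actM.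

Lemma eval_act_zmod_morphism (g : G) : zmod_morphism (gm_act M g).
Proof. exact: raddfB. Qed.

Definition eval_act : X -> M := mlift eval_act_zmod_morphism.
HB.instance Definition _ := GRing.Additive.on eval_act.

Lemma eval_actU t g : eval_act << t *g g >> = gm_act M g t.
Proof. exact: mliftU. Qed.

Lemma eval_act_conj h x : eval_act (conj_act h x) = eval_act x.
Proof.
apply: (malg_additive_ext (f := eval_act \o conj_act h) (g := eval_act)) => g t /=.
by rewrite conj_actU !eval_actU -gm_actM mulgVK.
Qed.

Lemma eval_act_ops j x : eval_act (ops X j x) = ops M j (eval_act x).
Proof.
have [jm|jm] := boolP (j < n.-1)%N; last by rewrite !ops_out // raddf0.
rewrite !opsE //.
apply: (malg_additive_ext (f := eval_act \o lmul (gen n j))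
  (g := gm_act M (gen n j) \o eval_act)) => g t /=.
by rewrite lmulU !eval_actU gm_actM.
Qed.

Lemma conj_act_ops h j x : conj_act h (ops X j x) = ops X j (conj_act h x).
Proof.
have [jm|jm] := boolP (j < n.-1)%N; last by rewrite !ops_out // raddf0.
rewrite !opsE //.
apply: (malg_additive_ext (f := conj_act h \o lmul (gen n j))
  (g := lmul (gen n j) \o conj_act h)) => g t /=.
by rewrite lmulU !conj_actU lmulU mulgA.
Qed.

Lemma aug_conj h x : aug (conj_act h x) = gm_act M h (aug x).
Proof.
apply: (malg_additive_ext (f := @aug n M \o conj_act h) (g := gm_act M h \o @aug n M)) => g t /=.
by rewrite conj_actU !augU.
Qed.

Definition ffrcons i (gs : {ffun 'I_i -> G}) (h : G) : {ffun 'I_i.+1 -> G} :=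
  [ffun j => if unlift ord_max j is Some k then gs k else h].

Lemma ffrcons_max i (gs : {ffun 'I_i -> G}) h : ffrcons gs h ord_max = h.
Proof. by rewrite ffunE unlift_none. Qed.

Lemma ffrcons_lift i (gs : {ffun 'I_i -> G}) h k : ffrcons gs h (lift ord_max k) = gs k.
Proof. by rewrite ffunE liftK. Qed.

Lemma ffrcons_inord i (gs : {ffun 'I_i.+1 -> G}) h (j : nat) : (j <= i)%N ->
  ffrcons gs h (inord j) = gs (inord j).
Proof.
move=> ji; have -> : inord j = lift ord_max (inord j : 'I_i.+1).
  apply: val_inj; rewrite /= !inordK; [|lia|lia].
  by rewrite /bump leqNgt ltnS ji.
exact: ffrcons_lift.
Qed.

Lemma ffrcons_last i (gs : {ffun 'I_i -> G}) h : ffrcons gs h (inord i) = h.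
Proof.
have -> : inord i = ord_max :> 'I_i.+1 by apply: val_inj; rewrite /= inordK.
exact: ffrcons_max.
Qed.

Lemma bar_face_max i (gs : {ffun 'I_i -> G}) h : bar_face ord_max (ffrcons gs h) = gs.
Proof.
apply/ffunP => j; case: i gs j => [|i] gs j; first by case: j.
rewrite bar_faceE /= ltnS ltn_ord ffrcons_inord; last by rewrite -ltnS.
by congr (gs _); apply: val_inj; rewrite /= inordK.
Qed.

Lemma bar_face_rcons i (gs : {ffun 'I_i.+1 -> G}) h (k : 'I_i.+2) :
  bar_face (widen_ord (leqnSn _) k) (ffrcons gs h)
  = if k == ord_max then ffrcons (bar_face k gs) (gs ord_max * h)%g
    else ffrcons (bar_face k gs) h.
Proof.
apply/ffunP => j; rewrite bar_faceE /=.
have ki := ltn_ord k; have ji := ltn_ord j.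
rewrite (fun_if (fun f : {ffun _ -> _} => f j)).
have [->|jm] := eqVneq j ord_max.
  rewrite !ffrcons_max -val_eqE /= ffrcons_last ffrcons_inord //.
  have -> : (i.+1 < k)%N = false by lia.
  rewrite eq_sym; case: eqP => // _; congr (gs _ * _)%g.
  by apply: val_inj; rewrite /= inordK.
have {}jm : (j < i)%N by move: jm; rewrite -val_eqE /=; lia.
have jE : j = lift ord_max (Ordinal jm).
  by apply: val_inj; rewrite /= /bump leqNgt jm.
rewrite [in RHS]jE !ffrcons_lift if_same.
case: i gs k j ki ji jm jE => // i gs k j ki ji jm jE.
by rewrite bar_faceE /= !ffrcons_inord //; lia.
Qed.

Local Notation Xc := conj_module.

Lemma contract_monom_zmod_morphism i (gs : {ffun 'I_i -> G}) (g : G) :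
  zmod_morphism (fun t : M =>
    << (<< gm_act M g t *g 1%g >> : Xc) *g ffrcons gs g^-1%g >> : bar Xc i.+1).
Proof.
move=> x y; rewrite raddfB.
rewrite -[RHS]monalgUB; congr mkmalgU; exact: monalgUB.
Qed.

Definition contract_at i (gs : {ffun 'I_i -> G}) : Xc -> bar Xc i.+1 :=
  mlift (contract_monom_zmod_morphism gs).
HB.instance Definition _ i gs := GRing.Additive.on (@contract_at i gs).

Lemma contract_at_zmod_morphism i (gs : {ffun 'I_i -> G}) : zmod_morphism (contract_at gs).
Proof. exact: raddfB. Qed.

(** Appends the entry g^-1 and moves the coefficient from g to the unit ([contractU]), so that the
    last face, which acts by g^-1, restores the original symbol. *)
Definition contract i : bar Xc i -> bar Xc i.+1 := mlift (@contract_at_zmod_morphism i).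
HB.instance Definition _ i := GRing.Additive.on (@contract i).

Lemma contractD i (x y : bar Xc i) : contract (x + y) = contract x + contract y.
Proof. exact: raddfD. Qed.

Lemma contractU i (gs : {ffun 'I_i -> G}) (g : G) (t : M) :
  contract << (<< t *g g >> : Xc) *g gs >>
  = << (<< gm_act M g t *g 1%g >> : Xc) *g ffrcons gs g^-1%g >>.
Proof.
rewrite [LHS](mliftU (@contract_at_zmod_morphism i)).
exact: (mliftU (contract_monom_zmod_morphism gs)).
Qed.

Lemma bar_conj_ind i (P : bar Xc i -> Prop) :
  (forall x y, P x -> P y -> P (x + y)) ->
  (forall gs (g : G) (t : M), P << (<< t *g g >> : Xc) *g gs >>) -> forall x, P x.
Proof.
move=> PD PU; have P0 : P 0.
  have := PU [ffun=> 1%g] 1%g 0.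
  have -> : (<< (0 : M) *g 1%g >> : Xc) = 0 by exact: monalgU0.
  by rewrite monalgU0.
move=> x; rewrite [x]monalgE; elim/big_rec: _ => // gs y _ Py.
apply: (PD) Py; move: (x@_gs) => a {x y}.
have aE : a = \sum_(g <- msupp (a : {malg M[G]})) (<< (a : {malg M[G]})@_g *g g >> : Xc).
  exact: monalgE.
rewrite aE raddf_sum /=; elim/big_rec: _ => [//|g y _ Py]; exact: PD (PU _ _ _) Py.
Qed.

Lemma contract_face i (gs : {ffun 'I_i.+1 -> G}) (g : G) (t : M) (k : 'I_i.+2) :
  (<< bar_coef (widen_ord (leqnSn _) k) (ffrcons gs g^-1%g) (<< gm_act M g t *g 1%g >> : Xc)
     *g bar_face (widen_ord (leqnSn _) k) (ffrcons gs g^-1%g) >> : bar Xc i.+1)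
  = contract << bar_coef k gs (<< t *g g >> : Xc) *g bar_face k gs >>.
Proof.
have -> hs (x : Xc) : bar_coef (widen_ord (leqnSn i.+2) k) hs x = x.
  by rewrite /bar_coef ifF //; apply/negbTE; rewrite -val_eqE neq_ltn /= ltn_ord.
rewrite bar_face_rcons /bar_coef; case: ifP => _; last exact/esym/contractU.
have -> : gm_act Xc (gs ord_max) (<< t *g g >> : Xc)
    = << gm_act M (gs ord_max) t *g (g * (gs ord_max)^-1)%g >> by exact: conj_actU.
by rewrite contractU -gm_actM mulgVK invgM invgK.
Qed.

Lemma contract_last i (gs : {ffun 'I_i -> G}) (g : G) (t : M) :
  (<< bar_coef ord_max (ffrcons gs g^-1%g) (<< gm_act M g t *g 1%g >> : Xc)
     *g bar_face ord_max (ffrcons gs g^-1%g) >> : bar Xc i)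
  = << (<< t *g g >> : Xc) *g gs >>.
Proof.
rewrite /bar_coef eqxx ffrcons_max bar_face_max; congr mkmalgU.
have -> : gm_act Xc g^-1%g (<< gm_act M g t *g 1%g >> : Xc)
    = << gm_act M g^-1 (gm_act M g t) *g (1 * g^-1^-1)%g >> by exact: conj_actU.
by rewrite -gm_actM mulVg gm_act1 invgK mul1g.
Qed.

Lemma contractMz i (x : bar Xc i) k : contract (x *~ k) = contract x *~ k.
Proof. exact: raddfMz. Qed.

Lemma contract_sum i (I : finType) (F : I -> bar Xc i) :
  contract (\sum_k F k) = \sum_k contract (F k).
Proof. exact: raddf_sum. Qed.

(** Every face but the last commutes with the contraction ([contract_face]), and the last one
    returns x ([contract_last]). *)
Lemma bnd_contract i (x : bar Xc i.+1) :
  bar_bnd (contract x) = contract (bar_bnd x) + x *~ (-1) ^+ i.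
Proof.
elim/bar_conj_ind: x => [x y hx hy|gs g t].
  rewrite contractD (bar_bndD (contract x)) (bar_bndD x) contractD.
  have gen (V : zmodType) (a b c c' e e' : V) k :
      a = c + e *~ k -> b = c' + e' *~ k -> a + b = c + c' + (e + e') *~ k.
    by move=> -> ->; rewrite mulrzDl addrACA.
  exact (gen (bar Xc i.+1) (bar_bnd (contract x)) (bar_bnd (contract y))
    (contract (bar_bnd x)) (contract (bar_bnd y)) x y ((-1) ^+ i) hx hy).
rewrite contractU !bar_bnd_monom big_ord_recr contract_sum contract_last.
congr (_ + _ *~ _); last by rewrite !exprS !mulN1r opprK.
apply: eq_bigr => k _; symmetry.
exact (etrans (contractMz _ _)
  (congr1 (fun v : bar Xc i.+1 => v *~ (-1) ^+ k) (esym (contract_face gs g t k)))).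
Qed.

Definition bar_eval0 : bar Xc 0 -> M := mlift (fun _ : {ffun 'I_0 -> G} =>
  (raddfB eval_act : zmod_morphism eval_act)).
HB.instance Definition _ := GRing.Additive.on bar_eval0.

Lemma bar_eval0U gs x : bar_eval0 << x *g gs >> = eval_act x.
Proof. exact: mliftU. Qed.

(** The bottom of the same homotopy: it joins the identity to the map that evaluates in M and puts
    the result back at the unit. *)
Lemma bnd_contract0 (x : bar Xc 0) : bar_eval0 x = 0 -> bar_bnd (contract x) = - x.
Proof.
pose base (t : M) : bar Xc 0 := << (<< t *g 1%g >> : Xc) *g [ffun=> 1%g] >>.
have base0 : base 0 = 0.
  rewrite /base; have -> : (<< (0 : M) *g 1%g >> : Xc) = 0 by exact: monalgU0.
  exact: monalgU0.
have baseD s t : base (s + t) = base s + base t.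
  rewrite /base -[RHS]monalgUD; congr mkmalgU; exact: monalgUD.
move=> x0; suff : bar_bnd (contract x) = base (bar_eval0 x) - x by rewrite x0 base0 sub0r.
elim/bar_conj_ind: x {x0} => [x y hx hy|gs g t].
  have evD : bar_eval0 (x + y) = bar_eval0 x + bar_eval0 y by exact: raddfD.
  rewrite contractD (bar_bndD (contract x)) evD baseD.
  have gen (V : zmodType) (a b c c' e e' : V) : a = c - e -> b = c' - e' ->
      a + b = c + c' - (e + e').
    by move=> -> ->; rewrite opprD addrACA.
  exact (gen (bar Xc 0) (bar_bnd (contract x)) (bar_bnd (contract y))
    (base (bar_eval0 x)) (base (bar_eval0 y)) x y hx hy).
rewrite contractU bar_bnd_monom big_ord_recr contract_last big_ord1 bar_eval0U eval_actU.
have gen (V : zmodType) (a b c : V) : a = c -> a *~ (-1) ^+ 0 + b *~ (-1) ^+ 1 = c - b.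
  by move=> ->; rewrite mulrN1z mulr1z.
apply: (gen (bar Xc 0)); rewrite /base; congr mkmalgU.
by apply/ffunP => - [].
Qed.

Lemma bar_eval0_bnd (x : bar Xc 1) : bar_eval0 (bar_bnd x) = 0.
Proof.
elim/bar_conj_ind: x => [x y hx hy|gs g t].
  have evD (u v : bar Xc 0) : bar_eval0 (u + v) = bar_eval0 u + bar_eval0 v by exact: raddfD.
  exact (etrans (congr1 bar_eval0 (bar_bndD x y))
    (etrans (evD _ _) (etrans (congr2 +%R hx hy) (addr0 0)))).
have evMz (u v : bar Xc 0) : bar_eval0 (u *~ (-1) ^+ 0 + v *~ (-1) ^+ 1)
    = bar_eval0 u - bar_eval0 v.
  by rewrite raddfD !raddfMz /= mulr1z mulrN1z.
rewrite bar_bnd_monom big_ord_recr big_ord1; apply: etrans (evMz _ _) _.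
rewrite !bar_eval0U /bar_coef eqxx.
have -> : (widen_ord (leqnSn 1) ord0 == ord_max) = false by [].
have -> : eval_act (gm_act Xc (gs ord_max) << t *g g >>) = eval_act (<< t *g g >> : Xc).
  exact: eval_act_conj.
exact: addrN.
Qed.

End InducedModule.

(* E a b (encoded by the predicates deg b on E a) is a double complex whose rows  *)
(* resolve B and whose columns resolve F: a diagram chase compares B with F.      *)
Section DoubleComplex.
Variables (E B : nat -> zmodType) (F : zmodType).
Variables (dh : forall a, {additive E a.+1 -> E a}) (dv : forall a, {additive E a -> E a}).
Variables (eps : forall a, {additive E a -> B a}) (dB : forall a, B a.+1 -> B a).
Variables (pi : {additive E 0 -> F}) (dF : F -> F).
Variables (deg : forall a, nat -> E a -> Prop) (degF : nat -> F -> Prop).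
Arguments deg {a}.
Arguments dh {a}.
Arguments dv {a}.
Arguments eps {a}.
Arguments dB {a}.

Hypothesis dh_dh : forall a (x : E a.+2), dh (dh x) = 0.
Hypothesis dv0 : forall a (x : E a), deg 0 x -> dv x = 0.
Hypothesis dv_dv : forall a (x : E a), dv (dv x) = 0.
Hypothesis dh_dv : forall a (x : E a.+1), dh (dv x) = dv (dh x).
Hypothesis eps_dh : forall a (x : E a.+1), eps (dh x) = dB (eps x).
Hypothesis eps_dv : forall a (x : E a), eps (dv x) = 0.
Hypothesis pi_dh : forall x : E 1, pi (dh x) = 0.
Hypothesis pi_dv : forall x : E 0, pi (dv x) = dF (pi x).
Hypothesis dF0 : forall u, degF 0 u -> dF u = 0.
Hypothesis degB : forall a b (x y : E a), deg b x -> deg b y -> deg b (x - y).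
Hypothesis deg_dh : forall a b (x : E a.+1), deg b x -> deg b (dh x).
Hypothesis deg_dv : forall a b (x : E a), deg b.+1 x -> deg b (dv x).
Hypothesis deg_eps : forall a b (x : E a), deg b.+1 x -> eps x = 0.
Hypothesis deg_pi : forall b (x : E 0), deg b x -> degF b (pi x).
Hypothesis row_exact : forall a b (x : E a), deg b x -> dv x = 0 -> eps x = 0 ->
  exists2 y, deg b.+1 y & dv y = x.
Hypothesis eps_surj : forall a (z : B a), exists2 x, deg 0 x & eps x = z.
Hypothesis col_exact : forall a b (x : E a.+1), deg b x -> dh x = 0 ->
  exists2 y, deg b y & dh y = x.
Hypothesis col_exact0 : forall b (x : E 0), deg b x -> pi x = 0 ->
  exists2 y, deg b y & dh y = x.
Hypothesis pi_surj : forall b u, degF b u -> exists2 x, deg b x & pi x = u.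

(** A staircase: [dh x] lifts along [dv] to an element with a lowered and b raised by one, and so on
    down to a = 0, where exactness of F gives a primitive. Exactness of the columns carries the
    splitting back up. The [match] states that the next step of the staircase is possible. *)
Lemma double_complex_split i a b (x : E a) :
  (forall u, degF i u -> dF u = 0 -> exists2 w, degF i.+1 w & dF w = u) ->
  (a + b = i)%N -> deg b x ->
  match a return E a -> Prop with
  | 0 => fun x => dF (pi x) = 0
  | a'.+1 => fun x => dv (dh x) = 0 /\ eps (dh x) = 0
  end x ->
  exists v w, [/\ deg b.+1 v, deg b w & x = dv v + dh w].
Proof.
move=> F_exact; elim: a b x => [|a IH] b x abi bx hx.
  rewrite add0n in abi; rewrite abi in bx *.
  have [u uw uE] := F_exact _ (deg_pi bx) hx.
  have [v bv vE] := pi_surj uw.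
  have [|w bw wE] := col_exact0 (degB bx (deg_dv bv)).
    by rewrite raddfB /= pi_dv vE uE subrr.
  by exists v, w; split=> //; rewrite wE addrC subrK.
case: hx => dvx epsx.
have [x1 bx1 x1E] := row_exact (deg_dh bx) dvx epsx.
have x1h : match a return E a -> Prop with
  | 0 => fun x => dF (pi x) = 0
  | a'.+1 => fun x => dv (dh x) = 0 /\ eps (dh x) = 0
  end x1.
  case: a IH x abi bx dvx epsx x1 bx1 x1E => [|a] _ x _ bx _ _ x1 bx1 x1E.
    by rewrite -pi_dv x1E pi_dh.
  by rewrite -dh_dv x1E dh_dh (deg_eps (deg_dh bx1)).
have [|v1 [w1 [bv1 bw1 x1s]]] := IH b.+1 x1 _ bx1 x1h; first by rewrite addnS -addSn.
have [|w bw wE] := col_exact (degB bx (deg_dv bw1)).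
  by rewrite raddfB /= dh_dv -x1E x1s raddfD /= dv_dv add0r subrr.
by exists w1, w; split=> //; rewrite wE addrC subrK.
Qed.

Lemma double_complex_exact i (z : B i) :
  (forall u, degF i u -> dF u = 0 -> exists2 w, degF i.+1 w & dF w = u) ->
  match i return B i -> Prop with 0 => fun=> True | j.+1 => fun z => dB z = 0 end z ->
  exists w, dB w = z.
Proof.
move=> F_exact hz; have [x x0 xz] := eps_surj z.
have [|v [w [_ _ xE]]] := double_complex_split F_exact (addn0 i) x0.
  case: i {F_exact} z hz x x0 xz => [|j] z hz x x0 xz.
    by apply: dF0; exact: deg_pi.
  by rewrite eps_dh xz; split=> //; apply/dv0/deg_dh.
by exists (eps w); rewrite -eps_dh -xz xE raddfD /= eps_dv add0r.
Qed.

End DoubleComplex.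

Definition homogeneous (m : nat) (X : zmodType) (k : nat) (z : chain m X) : Prop :=
  forall U : {set 'I_m}, #|U| <> k -> z U = 0.

Definition exact_at (m : nat) (X : zmodType) (s : nat -> {additive X -> X}) (k : nat) : Prop :=
  forall z : chain m X, homogeneous k z -> diff s z = 0 ->
  exists2 w : chain m X, homogeneous k.+1 w & diff s w = z.

Lemma homogeneous_diff (m : nat) (Y : zmodType) (s : nat -> {additive Y -> Y}) b
    (z : chain m Y) :
  homogeneous b.+1 z -> homogeneous b (diff s z).
Proof.
move=> zb U Ub; rewrite ffunE big1 // => i iU; rewrite zb ?raddf0 ?mul0rz //.
by rewrite cardsU1 iU add1n => -[].
Qed.

Lemma diff_homogeneous0 (m : nat) (Y : zmodType) (s : nat -> {additive Y -> Y})
    (z : chain m Y) :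
  homogeneous 0 z -> diff s z = 0.
Proof.
move=> z0; apply/ffunP => U; rewrite !ffunE big1 // => i iU.
by rewrite z0 ?raddf0 ?mul0rz // cardsU1 iU.
Qed.

(** * The double complex of bar chains with values in the resolution *)

Section BarExact.
Variables (n : nat) (M : gmodule (braid_group n)).
Local Notation G := (braid_group n).
Local Notation m := n.-1.
Local Notation X := (left_module n M).
Local Notation Xc := (conj_module M).
Local Notation d := (@diff m X (ops X)).
Local Notation C := (chain m X).

Definition chain_act (h : G) (q : C) : C := [ffun U => conj_act h (q U)].

Lemma chain_act_zmod_morphism h : zmod_morphism (chain_act h).
Proof. by move=> x y; apply/ffunP => U; rewrite !ffunE raddfB. Qed.
HB.instance Definition _ h :=
  GRing.isZmodMorphism.Build C C (chain_act h) (chain_act_zmod_morphism h).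

Lemma chain_act1 q : chain_act 1%g q = q.
Proof. by apply/ffunP => U; rewrite ffunE conj_act1. Qed.

Lemma chain_actM h k q : chain_act (h * k)%g q = chain_act h (chain_act k q).
Proof. by apply/ffunP => U; rewrite !ffunE conj_actM. Qed.

Definition chain_module : gmodule G :=
  @GModule G C (fun h => chain_act h : {additive C -> C}) chain_act1 chain_actM.

Local Notation Q := chain_module.

Definition chain_diff : Q -> Q := d.
HB.instance Definition _ := GRing.Additive.copy chain_diff d.

Definition chain_aug (q : Q) : M := aug (q (set0 : {set 'I_m})).
Lemma chain_aug_zmod_morphism : zmod_morphism chain_aug.
Proof. by move=> x y; rewrite /chain_aug !ffunE raddfB. Qed.
HB.instance Definition _ :=
  GRing.isZmodMorphism.Build Q M chain_aug chain_aug_zmod_morphism.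

Definition component (U : {set 'I_m}) (q : Q) : Xc := q U.
Lemma component_zmod_morphism U : zmod_morphism (component U).
Proof. by move=> x y; rewrite /component !ffunE. Qed.
HB.instance Definition _ U :=
  GRing.isZmodMorphism.Build Q Xc (component U) (component_zmod_morphism U).

Definition single (U : {set 'I_m}) (x : Xc) : Q := [ffun V => if V == U then x else 0].
Lemma single_zmod_morphism U : zmod_morphism (single U).
Proof.
by move=> x y; apply/ffunP => V; rewrite !ffunE; case: ifP => _; rewrite ?subrr.
Qed.
HB.instance Definition _ U :=
  GRing.isZmodMorphism.Build Xc Q (single U) (single_zmod_morphism U).

Lemma chain_diff_act h q : chain_diff (gm_act Q h q) = gm_act Q h (chain_diff q).
Proof. by apply: diff_morph => j x; exact: conj_act_ops. Qed.

Lemma chain_aug_act h q : chain_aug (gm_act Q h q) = gm_act M h (chain_aug q).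
Proof. by rewrite /chain_aug ffunE; exact: aug_conj. Qed.

Lemma component_act U h q : component U (gm_act Q h q) = gm_act Xc h (component U q).
Proof. exact: ffunE. Qed.

Lemma single_act U h x : single U (gm_act Xc h x) = gm_act Q h (single U x).
Proof.
apply/ffunP => V; rewrite ffunE [RHS]ffunE ffunE; case: ifP => // _.
by rewrite raddf0.
Qed.

Definition bar_deg a b (x : bar Q a) : Prop := forall gs, homogeneous b (x@_gs : C).

Definition trunc b (q : C) : C := [ffun U : {set 'I_m} => if #|U| == b then q U else 0].

Lemma trunc_homogeneous b q : homogeneous b (trunc b q).
Proof. by move=> U Ub; rewrite ffunE; case: eqP. Qed.

Lemma diff_trunc b q : d (trunc b.+1 q) = trunc b (d q).
Proof.
apply/ffunP => U; rewrite !ffunE; case: eqP => Ub; last first.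
  apply: big1 => i iU; rewrite ffunE cardsU1 iU add1n eqSS; case: eqP => // _.
  by rewrite raddf0 mul0rz.
by apply: eq_bigr => i iU; rewrite ffunE cardsU1 iU add1n eqSS Ub eqxx.
Qed.

Lemma trunc_id b q : homogeneous b q -> trunc b q = q.
Proof. by move=> qb; apply/ffunP => U; rewrite ffunE; case: eqP => // /qb ->. Qed.

Lemma trunc_zmod_morphism b : zmod_morphism (trunc b : Q -> Q).
Proof.
by move=> x y; apply/ffunP => U; rewrite !ffunE; case: ifP => _; rewrite ?subrr.
Qed.
HB.instance Definition _ b :=
  GRing.isZmodMorphism.Build Q Q (trunc b : Q -> Q) (trunc_zmod_morphism b).

Lemma trunc_act b h q : trunc b (gm_act Q h q) = gm_act Q h (trunc b q).
Proof.
suff : trunc b (chain_act h q) = chain_act h (trunc b q) by [].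
by apply/ffunP => U; rewrite 4!ffunE; case: ifP => // _; rewrite raddf0.
Qed.

(** Being fixed by an equivariant additive map is preserved by [bar_bnd] through [bar_map_bnd]; this
    form yields [bar_deg_bnd]. *)
Lemma bar_degP a b (x : bar Q a) : bar_deg b x <-> bar_map (trunc b : {additive Q -> Q}) x = x.
Proof.
split=> [bx|<-]; last by move=> gs; rewrite bar_map_coef; exact: trunc_homogeneous.
by apply/malgP => gs; rewrite bar_map_coef; exact: trunc_id.
Qed.

Lemma bar_deg_bnd a b (x : bar Q a.+1) : bar_deg b x -> bar_deg b (bar_bnd x).
Proof.
by move/bar_degP => xE; apply/bar_degP; rewrite -bar_map_bnd ?xE //; exact: trunc_act.
Qed.

Lemma bar_degB a b (x y : bar Q a) : bar_deg b x -> bar_deg b y -> bar_deg b (x - y).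
Proof.
move=> bx by_ gs U Ub; have -> : (x - y)@_gs = x@_gs - y@_gs by exact: mcoeffB.
by rewrite !ffunE bx // by_ // subrr.
Qed.

Lemma bar_component_deg a b (x : bar Q a) (U : {set 'I_m}) :
  bar_deg b x -> #|U| <> b -> bar_map (component U) x = 0.
Proof.
by move=> bx Ub; apply/malgP => gs; rewrite bar_map_coef mcoeff0 /= /component bx.
Qed.

Definition bar_eval (x : bar Q 0) : chain m M :=
  [ffun U => bar_eval0 (bar_map (component U) x)].

Lemma bar_eval_zmod_morphism : zmod_morphism bar_eval.
Proof. by move=> x y; apply/ffunP => U; rewrite !ffunE !raddfB. Qed.
HB.instance Definition _ :=
  GRing.isZmodMorphism.Build (bar Q 0) (chain m M) bar_eval bar_eval_zmod_morphism.

Lemma bar_evalU q gs : bar_eval << q *g gs >> = [ffun U => eval_act (component U q)].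
Proof. by apply/ffunP => U; rewrite !ffunE bar_mapU bar_eval0U. Qed.

Lemma bar_eval_bnd (x : bar Q 1) : bar_eval (bar_bnd x) = 0.
Proof.
apply/ffunP => U; rewrite !ffunE -bar_map_bnd; first exact: bar_eval0_bnd.
exact: component_act.
Qed.

Lemma bar_eval_diff (x : bar Q 0) :
  bar_eval (bar_map chain_diff x) = diff (ops M) (bar_eval x).
Proof.
apply: (malg_additive_ext (f := bar_eval \o @bar_map _ Q Q chain_diff 0)
  (g := @diff m M (ops M) \o bar_eval)) => gs q /=.
rewrite bar_mapU !bar_evalU; symmetry; apply: diff_morph => j v; exact: eval_act_ops.
Qed.

(** [left_module_exact] is applied to each coefficient, and the primitives are truncated to the
    right degree. *)
Lemma bar_row_exact a b (x : bar Q a) : bar_deg b x ->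
  bar_map chain_diff x = 0 -> bar_map chain_aug x = 0 ->
  exists2 y : bar Q a, bar_deg b.+1 y & bar_map chain_diff y = x.
Proof.
move=> bx dx ex.
have /choice[w wP] : forall gs, exists w : C, homogeneous b.+1 w /\ d w = x@_gs.
  move=> gs; have dgs : d (x@_gs) = 0.
    by have := bar_map_coef chain_diff x gs; rewrite dx mcoeff0.
  have egs : aug ((x@_gs : C) set0) = 0.
    by have := bar_map_coef chain_aug x gs; rewrite ex mcoeff0.
  have [w wE] := left_module_exact dgs egs.
  exists (trunc b.+1 w); split; first exact: trunc_homogeneous.
  by rewrite diff_trunc wE trunc_id.
pose y : bar Q a := \sum_(gs <- msupp x) << (w gs : Q) *g gs >>.
have yE gs : y@_gs = if gs \in msupp x then w gs else 0.
  rewrite /y raddf_sum /=; case: ifP => gx.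
    rewrite (big_fsetD1 gs) //= mcoeffUU big_seq big1 ?addr0 // => gs'.
    by rewrite !inE => /andP[/negbTE ne _]; rewrite mcoeffU ne.
  rewrite big_seq big1 // => gs' gx'; rewrite mcoeffU; case: eqP => // e.
  by rewrite -e gx' in gx.
exists y.
  move=> gs; rewrite yE; case: ifP => _; first by have [] := wP gs.
  by move=> U _; rewrite ffunE.
apply/malgP => gs; rewrite bar_map_coef yE; case: ifP => gx.
  by have [_ <-] := wP gs.
by rewrite mcoeff_outdom ?gx // raddf0.
Qed.

Lemma bar_aug_surj a (z : bar M a) :
  exists2 x : bar Q a, bar_deg 0 x & bar_map chain_aug x = z.
Proof.
exists (bar_map (single set0 \o (mkmalgU (1%g : G) : {additive M -> Xc}) : {additive M -> Q}) z).
  move=> gs U U0; rewrite bar_map_coef ffunE /= ifF //; apply/negP => /eqP UE.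
  by rewrite UE cards0 in U0.
apply/malgP => gs; rewrite !bar_map_coef /= /chain_aug ffunE eqxx; exact: augU.
Qed.

Lemma sum_single (F : {set 'I_m} -> Xc) V : (\sum_U single U (F U) : C) V = F V.
Proof.
rewrite sum_ffunE (bigD1 V) //= ffunE eqxx big1 ?addr0 // => U UV.
by rewrite ffunE eq_sym (negbTE UV).
Qed.

Lemma single_component (q : Q) : \sum_U single U (component U q) = q.
Proof. by apply/ffunP => V; rewrite sum_single. Qed.

(** As a module, Q is a finite sum of copies of [conj_module], one for each U, and each copy has its
    own contraction. *)
Definition bar_contract a (x : bar Q a) : bar Q a.+1 :=
  \sum_U bar_map (single U) (contract (bar_map (component U) x)).

Lemma bar_contract_coef a (x : bar Q a) gs (U : {set 'I_m}) :
  ((bar_contract x)@_gs : C) U = (contract (bar_map (component U) x))@_gs.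
Proof.
have -> : (bar_contract x)@_gs
    = \sum_V single V (contract (bar_map (component V) x))@_gs.
  rewrite /bar_contract raddf_sum; apply: eq_bigr => V _; exact: bar_map_coef.
exact: (sum_single (fun V => (contract (bar_map (component V) x))@_gs)).
Qed.

Lemma bar_contract_deg a b (x : bar Q a) : bar_deg b x -> bar_deg b (bar_contract x).
Proof.
move=> bx gs U Ub; rewrite bar_contract_coef (bar_component_deg bx Ub).
by rewrite raddf0 mcoeff0.
Qed.

Lemma bar_single_component a (x : bar Q a) :
  \sum_U bar_map (single U) (bar_map (component U) x) = x.
Proof.
apply/malgP => gs; rewrite raddf_sum -[RHS]single_component; apply: eq_bigr => U _.
exact: (etrans (bar_map_coef _ _ _) (congr1 (single U) (bar_map_coef _ _ _))).
Qed.

Lemma bar_contract_exact a b (x : bar Q a) (k : int) : k * k = 1 -> bar_deg b x ->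
  (forall U, bar_bnd (contract (bar_map (component U) x)) = bar_map (component U) x *~ k) ->
  exists2 y : bar Q a.+1, bar_deg b y & bar_bnd y = x.
Proof.
move=> kk bx h; exists (bar_contract x *~ k).
  move=> gs U Ub; have -> : (bar_contract x *~ k)@_gs = (bar_contract x)@_gs *~ k.
    exact: raddfMz.
  by rewrite chain_mulrzE (bar_contract_deg bx) // mul0rz.
have -> : bar_bnd (bar_contract x *~ k) = bar_bnd (bar_contract x) *~ k by exact: raddfMz.
have -> : bar_bnd (bar_contract x)
    = \sum_U bar_bnd (bar_map (single U) (contract (bar_map (component U) x))).
  exact: raddf_sum.
rewrite -[RHS](bar_single_component x) mulrz_suml; apply: eq_bigr => U _.
have -> : bar_bnd (bar_map (single U) (contract (bar_map (component U) x)))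
    = bar_map (single U) (bar_bnd (contract (bar_map (component U) x))).
  by apply: bar_map_bnd; exact: single_act.
rewrite h; have -> : bar_map (single U) (bar_map (component U) x *~ k)
    = bar_map (single U) (bar_map (component U) x) *~ k by exact: raddfMz.
have gen (V : zmodType) (v : V) : v *~ k *~ k = v by rewrite -mulrzA kk.
exact: (gen (bar Q a)).
Qed.

Lemma bar_col_exact a b (x : bar Q a.+1) : bar_deg b x -> bar_bnd x = 0 ->
  exists2 y : bar Q a.+2, bar_deg b y & bar_bnd y = x.
Proof.
move=> bx dx; apply: (@bar_contract_exact _ _ _ ((-1) ^+ a)) => // [|U].
  by rewrite -expr2 sqrr_sign.
apply: etrans (bnd_contract _) _.
have -> : bar_bnd (bar_map (component U) x) = bar_map (component U) (bar_bnd x).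
  by apply: bar_map_bnd; exact: component_act.
rewrite dx; have -> : contract (bar_map (component U) (0 : bar Q a)) = 0.
  by rewrite raddf0; exact: raddf0.
exact: add0r.
Qed.

Lemma bar_col_exact0 b (x : bar Q 0) : bar_deg b x -> bar_eval x = 0 ->
  exists2 y : bar Q 1, bar_deg b y & bar_bnd y = x.
Proof.
move=> bx ex; apply: (@bar_contract_exact _ _ _ (-1)) => // U.
apply: etrans (bnd_contract0 _) _; last exact: esym (mulrN1z _).
by have := congr1 (fun z : chain m M => z U) ex; rewrite !ffunE.
Qed.

Lemma bar_eval_surj b (u : chain m M) : homogeneous b u ->
  exists2 x : bar Q 0, bar_deg b x & bar_eval x = u.
Proof.
move=> ub; pose q : C := [ffun U => << u U *g 1%g >>].
exists << (q : Q) *g [ffun=> 1%g] >>.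
  move=> gs U Ub; rewrite mcoeffU; case: eqP => _; last by rewrite ffunE.
  by rewrite ffunE ub // monalgU0.
apply/ffunP => U; rewrite bar_evalU ffunE /component ffunE.
by apply: etrans (eval_actU _ _) _; rewrite gm_act1.
Qed.

(** The rows are bar chains with values in the resolution Q of M. The columns are bar complexes of
    induced modules, hence resolve their coinvariants, which are the chains with values in M. So
    exactness of the small complex passes to the bar complex of M. *)
Theorem homology_eq0 i : exact_at m (ops M) i -> forall c : homology M i, c = 0.
Proof.
move=> Ex; apply/homology_eq0P => z zc.
apply: (@double_complex_exact (bar Q) (bar M) (chain m M)
  (fun a => @bar_bnd G Q a) (fun a => @bar_map G Q Q chain_diff a)
  (fun a => @bar_map G Q M chain_aug a) (fun a => @bar_bnd G M a)
  bar_eval (diff (ops M)) (fun a b => @bar_deg a b) (@homogeneous m M)).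
- exact: bar_bnd_bnd.
- move=> a x x0; apply/malgP => gs; rewrite bar_map_coef mcoeff0.
  exact: diff_homogeneous0.
- move=> a x; apply/malgP => gs; rewrite !bar_map_coef mcoeff0.
  exact/diff_diff/ops_braid.
- by move=> a x; apply: bar_map_bnd; exact: chain_diff_act.
- by move=> a x; symmetry; apply: bar_map_bnd; exact: chain_aug_act.
- by move=> a x; apply/malgP => gs; rewrite !bar_map_coef mcoeff0; exact: aug_diff.
- exact: bar_eval_bnd.
- exact: bar_eval_diff.
- exact: diff_homogeneous0.
- exact: bar_degB.
- exact: bar_deg_bnd.
- by move=> a b x bx gs; rewrite bar_map_coef; exact: homogeneous_diff.
- move=> a b x bx; apply/malgP => gs; rewrite bar_map_coef mcoeff0 /= /chain_aug bx ?raddf0 //.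
  by rewrite cards0.
- move=> b x bx U Ub; rewrite ffunE (bar_component_deg bx Ub); exact: raddf0.
- exact: bar_row_exact.
- exact: bar_aug_surj.
- exact: bar_col_exact.
- exact: bar_col_exact0.
- exact: bar_eval_surj.
- exact: Ex.
- by case: i z zc {Ex} => // i z /eqP.
Qed.

End BarExact.

(** * Vanishing *)

Section Above.
Variables (m : nat) (X : zmodType) (s : nat -> {additive X -> X}).
Implicit Types (U V A : {set 'I_m}) (z w : chain m X) (p c k : nat).
Local Notation d := (@diff m X s).

Definition above p U : bool := [forall i in U, (p <= i)%N].

Lemma aboveP p U : reflect (forall i, i \in U -> (p <= i)%N) (above p U).
Proof. exact: (iffP forall_inP). Qed.

Lemma aboveU1 p i U : above p (i |: U) = (p <= i)%N && above p U.
Proof.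
apply/aboveP/andP => [h|[pi /aboveP h] k].
  split; first by apply: h; rewrite !inE eqxx.
  by apply/aboveP => k kU; apply: h; rewrite !inE kU orbT.
by rewrite !inE => /orP[/eqP -> //|]; exact: h.
Qed.

(** Without generators below p, each of the first p strands is a block of its own, and the chain
    belongs to the complex of the remaining strands. *)
Definition supp_above p z : Prop := forall U, ~~ above p U -> z U = 0.

Definition exact_above p k : Prop :=
  forall z, homogeneous k z -> supp_above p z -> d z = 0 ->
  exists w, [/\ homogeneous k.+1 w, supp_above p w & d w = z].

Lemma supp_above_diff p z : supp_above p z -> supp_above p (d z).
Proof.
move=> zp U Up; rewrite ffunE big1 // => i iU.
by rewrite zp ?raddf0 ?mul0rz // aboveU1 (negbTE Up) andbF.
Qed.

Lemma homogeneousB k z w : homogeneous k z -> homogeneous k w -> homogeneous k (z - w).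
Proof. by move=> zk wk U Uk; rewrite !ffunE zk // wk // subrr. Qed.

Lemma supp_aboveB p z w : supp_above p z -> supp_above p w -> supp_above p (z - w).
Proof. by move=> zp wp U Up; rewrite !ffunE zp // wp // subrr. Qed.

(* A generator c missing on both sides separates A from V: removing a generator *)
(* of V from A :|: V does not interact with A, except for the sign.             *)
Lemma diff_separated c A V z : (forall i : 'I_m, i \in A -> (i < c)%N) -> above c.+1 V ->
  (forall i : 'I_m, (i <= c)%N -> i \notin A -> z (i |: (A :|: V)) = 0) ->
  d z (A :|: V) = d [ffun V => if above c.+1 V then z (A :|: V) else 0] V *~ (-1) ^+ #|A|.
Proof.
move=> Ac Vc z0; rewrite !ffunE mulrz_suml [LHS]big_mkcond [RHS]big_mkcond.
apply: eq_bigr => i _; rewrite ffunE aboveU1 Vc andbT in_setU negb_or.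
have [iV|iV] /= := boolP (i \in V); first by rewrite andbF.
rewrite andbT; have [ci|ic] := ltnP c i; last first.
  by rewrite raddf0 mul0rz mul0rz; case: ifP => // iA; rewrite z0 ?raddf0 ?mul0rz ?iA.
have iA : i \notin A by apply/negP => /Ac; lia.
rewrite iA setUCA -mulrzA -exprD.
have AV j : (c < j)%N -> in_gens (A :|: V) j = in_gens V j.
  rewrite /in_gens; case: insubP => // k _ <- ck; rewrite !inE.
  by case kA : (k \in A) => //; have := ltn_trans ck (Ac _ kA); rewrite ltnn.
have V0 j : (j <= c)%N -> in_gens V j = false.
  rewrite /in_gens; case: insubP => // k _ <- kc; apply/negP.
  by move/(aboveP _ _ Vc); rewrite ltnNge kc.
have [lo_i i_hi h out top] := runP V i.
have clo : (c < run_lo V i)%N.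
  rewrite ltnNge; apply/negP => loc.
  by have := h (run_lo V i) (leqnn _) ltac:(lia) ltac:(lia); rewrite V0.
have r : is_run (A :|: V) (run_lo V i) i (run_hi V i).
  split=> // [j j1 j2 ji|j j1|].
  - by rewrite AV ?h //; lia.
  - have [->|jc] := eqVneq j c; last by rewrite AV ?out //; lia.
    rewrite /in_gens; case: insubP => // k _ kc; rewrite !inE negb_or.
    apply/andP; split; apply/negP; first by move/Ac; rewrite kc ltnn.
    by move/(aboveP _ _ Vc); rewrite kc ltnn.
  - by rewrite AV //; lia.
rewrite (merge_opE _ r) (merge_opE _ (runP V i)); congr (_ *~ _ ^+ _).
rewrite addnC /rank -cardsUI [X in (_ + X)%N](_ : _ = 0)%N ?addn0; last first.
  apply/eqP; rewrite cards_eq0; apply/eqP/setP => k; rewrite !inE.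
  by apply/negP => /andP[/Ac kA /andP[/(aboveP _ _ Vc)]]; lia.
apply: eq_card => k; rewrite !inE; case kA : (k \in A) => //=.
by have := Ac _ kA => kc; rewrite (leq_trans kc (ltnW ci)).
Qed.

End Above.

(** * Clearing the block that starts at strand j *)

Section FirstBlock.
Variables (m : nat) (X : zmodType) (s : nat -> {additive X -> X}).
Hypothesis s_ops : braid_ops s.
Implicit Types (U V A : {set 'I_m}) (z w : chain m X).
Local Notation d := (@diff m X s).

Definition ord_range (a b : nat) : {set 'I_m} := [set i : 'I_m | (a <= i)%N && (i < b)%N].

Lemma card_ord_range a c : (a + c <= m)%N -> #|ord_range a (a + c)| = c.
Proof.
elim: c => [|c IH] acm.
  by apply/eqP; rewrite cards_eq0; apply/eqP/setP => i; rewrite !inE addn0; lia.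
have acm' : (a + c < m)%N by rewrite -addnS.
have -> : ord_range a (a + c.+1) = Ordinal acm' |: ord_range a (a + c).
  by apply/setP => i; rewrite !inE -val_eqE /=; lia.
by rewrite cardsU1 inE /= ltnn andbF IH ?add1n // ltnW.
Qed.

Lemma card_separated c A V : (forall i : 'I_m, i \in A -> (i < c)%N) -> above c V ->
  #|A :|: V| = (#|A| + #|V|)%N.
Proof.
move=> Ac /aboveP Vc; rewrite -cardsUI [X in (_ + X)%N](_ : _ = 0)%N ?addn0 //.
apply/eqP; rewrite cards_eq0; apply/eqP/setP => i; rewrite !inE.
by apply/negP => /andP[/Ac iA /Vc]; rewrite leqNgt iA.
Qed.

(* j, ..., j + c - 1 belong to U: eliminate the values of z on such U, for      *)
(* decreasing c.                                                               *)
Lemma first_block_elim j k c z : (j + c <= m)%N ->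
  (forall q, (2 <= q)%N -> (q <= k.+1)%N -> exact_above m s (j + q) (k.+1 - q)) ->
  homogeneous k z -> supp_above j z -> d z = 0 ->
  (forall U, ord_range j (j + c) \subset U -> z U = 0) ->
  exists w, homogeneous k.+1 w /\ supp_above j.+1 (z - d w).
Proof.
move=> jcm Ex; elim: c z jcm => [|[|c] IH] z jcm zk zj dz zc.
- exists 0; split; first by move=> U _; rewrite ffunE.
  rewrite raddf0 subr0 => U _; apply: zc; apply/subsetP => i.
  by rewrite inE addn0 => /andP[]; lia.
- exists 0; split; first by move=> U _; rewrite ffunE.
  rewrite raddf0 subr0 => U /forall_inPn[i iU ij].
  have [ji|ji] := leqP j i; last first.
    by apply: zj; apply/forall_inPn; exists i; rewrite -?ltnNge.
  apply: zc; apply/subsetP => l; rewrite inE => /andP[l1 l2].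
  by rewrite (_ : l = i) //; apply: val_inj; rewrite /=; lia.
(* A consists of c + 1 generators, which join c + 2 strands, and [cc] is the generator that must be
   absent for this block to end there. *)
set A := ord_range j (j + c.+1) in IH *; set cc := (j + c.+1)%N.
have Acc (i : 'I_m) : i \in A -> (i < cc)%N by rewrite inE => /andP[].
have cardA : #|A| = c.+1 by apply: card_ord_range; lia.
have subA U : A \subset U -> U = A :|: (U :\: A).
  move=> AU; apply/setP => i; rewrite in_setU in_setD.
  by have [iA|iA] /= := boolP (i \in A); rewrite ?(subsetP AU _ iA).
(* If the degree k is smaller than the size of A, no set of size k contains A and there is nothing
   to clear. *)
have [kc|ck] := ltnP k c.+1.
  apply: IH => // [|U AU]; first by lia.
  by apply: zk; have := subset_leq_card AU; rewrite cardA; lia.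
have sgn0 (x : X) l : x *~ (-1) ^+ l = 0 -> x = 0.
  by move=> /(congr1 (fun y => y *~ (-1) ^+ l)); rewrite mul0rz -mulrzA -expr2 sqrr_sign mulr1z.
have z0 U (i : 'I_m) : A \subset U -> i \in U -> i \notin A -> (i <= cc)%N -> z U = 0.
  move=> AU iU iA icc; have [ji|ij] := leqP j i; last first.
    by apply: zj; apply/forall_inPn; exists i; rewrite -?ltnNge.
  apply: zc; apply/subsetP => l; rewrite inE => /andP[l1 l2].
  have [lcc|lcc] := ltnP l cc; first by apply: (subsetP AU); rewrite inE l1.
  move: iA; rewrite inE ji /= -leqNgt => ci.
  by rewrite (_ : l = i) //; apply: val_inj; rewrite /=; move: lcc ci icc l2; rewrite /cc; lia.
pose z1 : chain m X := [ffun V => if above cc.+1 V then z (A :|: V) else 0].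
have z1s : supp_above cc.+1 z1 by move=> V Vc; rewrite ffunE (negbTE Vc).
have above_cc V : above cc.+1 V -> above cc V.
  by move/aboveP=> Vc; apply/aboveP => i /Vc; exact: ltnW.
have dz1 : d z1 = 0.
  apply/ffunP => V; rewrite [RHS]ffunE; have [Vc|Vc] := boolP (above cc.+1 V); last first.
    exact: supp_above_diff Vc.
  have h : d z (A :|: V) = d z1 V *~ (-1) ^+ #|A|.
    apply: diff_separated => // i icc iA; apply: (z0 _ i) => //.
      by apply/subsetP => l lA; rewrite !in_setU lA orbT.
    by rewrite setU11.
  by apply: (sgn0 _ #|A|); rewrite -h dz ffunE.
(* The values of z behind the block A form a cycle of degree k - (c + 1) on the strands from j + c +
   2 on, that is, q = c + 2. *)
have [||w1 [w1k w1s w1E]] := Ex c.+2 isT ck z1 _ _ dz1.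
- move=> V Vk; rewrite ffunE; case: ifP => // Vc; apply: zk.
  by rewrite (card_separated Acc (above_cc _ Vc)) cardA; lia.
- by rewrite addnS.
(* The sign cancels the factor from [diff_separated], whose exponent is the size c + 1 of A. *)
pose w : chain m X := [ffun U : {set 'I_m} => if (A \subset U) && above cc.+1 (U :\: A)
  then w1 (U :\: A) *~ (-1) ^+ c.+1 else 0].
have wk : homogeneous k.+1 w.
  move=> U Uk; rewrite ffunE; case: ifP => // /andP[AU Uc]; rewrite w1k ?mul0rz //.
  by move: Uk; rewrite {1}(subA _ AU) (card_separated Acc (above_cc _ Uc)) cardA; lia.
have wj : supp_above j w.
  move=> U /forall_inPn[i iU]; rewrite -ltnNge => ij; rewrite ffunE ifF //.
  apply/negP => /andP[AU /aboveP/(_ i)]; rewrite !inE iU leqNgt ij /= => /(_ isT).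
  by rewrite /cc; lia.
have [|||||w2 [w2k w2s]] := IH (z - d w).
- by lia.
- by apply: homogeneousB => //; exact: homogeneous_diff.
- by apply: supp_aboveB => //; exact: supp_above_diff.
- by rewrite raddfB /= dz (diff_diff s_ops) subrr.
- move=> U AU; rewrite chain_subE; have [Uc|Uc] := boolP (above cc.+1 (U :\: A)); last first.
    have [i iU ic] := forall_inPn Uc; move: iU; rewrite inE => /andP[iA iU].
    rewrite -leqNgt in ic; rewrite (z0 U i) // sub0r ffunE big1 ?oppr0 // => l lU.
    rewrite ffunE ifF ?raddf0 ?mul0rz //; apply/negP => /andP[_ /aboveP/(_ i)].
    by rewrite in_setD iA in_setU1 iU orbT => /(_ isT); lia.
  have h : d w (A :|: (U :\: A)) = d (w1 *~ (-1) ^+ c.+1) (U :\: A) *~ (-1) ^+ #|A|.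
    rewrite (diff_separated s Acc Uc) => [|i icc iA].
      congr (diff s _ _ *~ _); apply/ffunP => V; rewrite ffunE chain_mulrzE.
      case: ifP => Vc; last by rewrite w1s ?mul0rz // addnS Vc.
      have AV : (A :|: V) :\: A = V.
        apply/setP => i; rewrite in_setD in_setU; case iA : (i \in A) => //=.
        by apply/esym/negP => /(aboveP _ _ Vc); have := Acc _ iA; lia.
      by rewrite ffunE AV Vc subsetUl.
    rewrite ffunE ifF //; apply/negP => /andP[_ /aboveP/(_ i)].
    by rewrite in_setD iA in_setU1 eqxx /= => /(_ isT); lia.
  have -> : z U = z1 (U :\: A) by rewrite ffunE Uc -subA.
  have dM : d (w1 *~ (-1) ^+ c.+1) = d w1 *~ (-1) ^+ c.+1 by exact: raddfMz.
  rewrite [in X in _ - X](subA _ AU) h dM w1E chain_mulrzE -mulrzA cardA.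
  by rewrite -expr2 sqrr_sign mulr1z subrr.
exists (w + w2); split.
  by move=> U Uk; rewrite ffunE wk // w2k // addr0.
by rewrite raddfD /= opprD addrA.
Qed.

End FirstBlock.

(** * Contraction by trivial coinvariants on the first N strands *)

Section Coinvariants.
Variables (m : nat) (X : zmodType) (s : nat -> {additive X -> X}).
Variables (N : nat) (h : 'I_m -> {additive X -> X}).
Hypothesis h_comm : forall (l : 'I_m) j x, (l.+1 < N)%N -> (N <= j)%N ->
  h l (s j x) = s j (h l x).
Hypothesis h_sum : forall x, \sum_(l : 'I_m | (l.+1 < N)%N) (h l x - s l (h l x)) = x.
Implicit Types (U V A : {set 'I_m}) (z w : chain m X).
Local Notation d := (@diff m X s).

Lemma above_notin p U j : above p U -> (j < p)%N -> in_gens U j = false.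
Proof.
rewrite /in_gens => /aboveP Up; case: insubP => // k _ <- kp; apply/negP => /Up.
by rewrite leqNgt kp.
Qed.

Lemma diff_above p z V (f : {additive X -> X}) :
  (forall j x, (p <= j)%N -> f (s j x) = s j (f x)) -> supp_above p z -> above p V ->
  d [ffun U => f (z U)] V = f (d z V).
Proof.
move=> fs zp Vp; rewrite !ffunE raddf_sum; apply: eq_bigr => i iV.
rewrite raddfMz ffunE /=; congr (_ *~ _).
have [pi|ip] := leqP p i; last first.
  by rewrite zp ?raddf0 ?raddf0 // aboveU1 leqNgt ip.
rewrite /merge_op -[run_lo V i]add0n; symmetry; apply: shuffle_morph => j y j1 _.
apply: fs; rewrite add0n; apply: leq_trans j1; rewrite leqNgt; apply/negP => lop.
have [lo_i i_hi hin _ _] := runP V i.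
have := hin (run_lo V i) (leqnn _) ltac:(lia) ltac:(lia).
by rewrite (above_notin Vp lop).
Qed.

(* The generators below N act with trivial coinvariants and commute with those  *)
(* from N on, so the chains l |: U with U above N contract the chains above N.  *)
Lemma coinvariant_contract k z : homogeneous k z -> supp_above N z -> d z = 0 ->
  exists2 w, homogeneous k.+1 w & d w = z.
Proof.
move=> zk zN dz.
pose wl (l : 'I_m) : chain m X := [ffun U : {set 'I_m} =>
  if (l \in U) && above N (U :\ l) then h l (z (U :\ l)) else 0].
exists (\sum_(l : 'I_m | (l.+1 < N)%N) wl l).
  move=> U Uk; rewrite sum_ffunE big1 // => l _; rewrite ffunE; case: ifP => // /andP[lU _].
  by rewrite zk ?raddf0 // => e; apply: Uk; rewrite (cardsD1 l) lU e.
rewrite raddf_sum /=; apply/ffunP => U; rewrite sum_ffunE.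
(* For U above N, the chain [wl l] contributes only through removal of l, which yields h_l - s_l h_l
   applied to the value of z; [h_sum] adds these up to z. *)
have [Up|Up] := boolP (above N U).
  rewrite -[RHS]h_sum; apply: eq_bigr => l lN.
  have lU : l \notin U by apply/negP => /(aboveP _ _ Up); lia.
  rewrite ffunE (bigD1 l) //= big1 ?addr0 => [|i /andP[iU il]]; last first.
    by rewrite ffunE in_setU1 eq_sym (negbTE il) (negbTE lU) raddf0 mul0rz.
  have r : is_run U l l l.+1.
    split=> // [j j1 j2 j3|j j1|]; [lia| |]; rewrite (above_notin Up) //; lia.
  have -> : rank U l = 0%N.
    apply/eqP; rewrite cards_eq0; apply/eqP/setP => j; rewrite !inE.
    by apply/negP => /andP[/(aboveP _ _ Up)]; lia.
  rewrite ffunE setU11 setU1K // Up mulr1z (merge_opE _ r) subSnn subnn shuffleSS.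
  by rewrite shufflen0 /= addn0 mulrN1z.
rewrite zN //; apply: big1 => l lN.
have [/andP[lU Ulp]|nl] := boolP ((l \in U) && above N (U :\ l)); last first.
  rewrite ffunE big1 // => i iU; rewrite ffunE ifF ?raddf0 ?mul0rz //.
  apply/negP => /andP[]; rewrite in_setU1 => /orP[/eqP li|lU] /aboveP hU.
    move/aboveP: Up; apply => j jU; apply: hU; rewrite !inE jU orbT andbT.
    by apply: contraNneq iU => jl; rewrite -li -jl.
  move: nl; rewrite lU /= => /aboveP; apply => j; rewrite !inE => /andP[jl jU].
  by apply: hU; rewrite !inE jl jU orbT.
(* The generator N - 1 is absent and separates l from the rest, so the differential here is h_l
   applied to that of z, up to sign. *)
have Np : (N.-1.+1 = N)%N by lia.
rewrite -(setD1K lU) (@diff_separated m X s N.-1); first last.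
- move=> i iN il; rewrite ffunE ifF //; apply/negP => /andP[_ /aboveP/(_ i)].
  by rewrite in_setD1 setU11 andbT -in_set1 il => /(_ isT); lia.
- by rewrite Np.
- by move=> i; rewrite inE => /eqP ->; lia.
rewrite Np (_ : [ffun V => _] = [ffun V => h l (z V)]); last first.
  apply/ffunP => V; rewrite !ffunE; case: ifP => Vp; last by rewrite zN ?raddf0 ?Vp.
  have lV : l \notin V by apply/negP => /(aboveP _ _ Vp); lia.
  by rewrite setU11 setU1K // Vp.
rewrite (diff_above (p := N)) // => [|j x Nj]; last exact: h_comm.
by rewrite dz ffunE raddf0 mul0rz.
Qed.

End Coinvariants.

(** * Exactness on the last strands from exactness on fewer strands *)

Section Transport.
Variables (p m' : nat).
Local Notation m := (p + m')%N.
Variables (X X' : zmodType) (s : nat -> {additive X -> X}) (s' : nat -> {additive X' -> X'}).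
Variables (I : Type) (rho : I -> {additive X -> X'}).
Hypothesis rho_ops : forall t j x, rho t (s (p + j)%N x) = s' j (rho t x).
Hypothesis rho_inj : forall x, (forall t, rho t x = 0) -> x = 0.
Hypothesis rho_glue : forall y : I -> X',
  (forall t u, rho t =1 rho u -> y t = y u) -> exists x, forall t, rho t x = y t.

Definition shift_set (U : {set 'I_m'}) : {set 'I_m} := [set rshift p i | i in U].
Definition unshift_set (U : {set 'I_m}) : {set 'I_m'} := [set i | rshift p i \in U].

Lemma in_shift_set U i : (rshift p i \in shift_set U) = (i \in U).
Proof. by rewrite mem_imset //; exact: rshift_inj. Qed.

Lemma shift_setK : cancel shift_set unshift_set.
Proof. by move=> U; apply/setP => i; rewrite inE in_shift_set. Qed.

Lemma above_shift_set U : above p (shift_set U).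
Proof. by apply/aboveP => i /imsetP[j _ ->] /=; exact: leq_addr. Qed.

Lemma unshift_setK U : above p U -> shift_set (unshift_set U) = U.
Proof.
move=> /aboveP Up; apply/setP => i; apply/imsetP/idP => [[j]|iU].
  by rewrite inE => jU ->.
case: (split_ordP i) iU => [j ->|j ->] iU; last by exists j; rewrite ?inE.
by have := Up _ iU; rewrite /= leqNgt ltn_ord.
Qed.

Lemma card_shift_set U : #|shift_set U| = #|U|.
Proof. by rewrite card_imset //; exact: rshift_inj. Qed.

Lemma shift_setU1 U i : shift_set (i |: U) = rshift p i |: shift_set U.
Proof. exact: imsetU1. Qed.

Lemma in_gens_shift U j : in_gens (shift_set U) j = (p <= j)%N && in_gens U (j - p).
Proof.
have [pj|jp] := leqP p j; last by rewrite (above_notin (above_shift_set U) jp).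
have [jm|jm] := ltnP (j - p) m'; last first.
  apply/idP/idP => [/in_gens_lt|/=/in_gens_lt]; lia.
pose k := Ordinal jm; have -> : j = rshift p k :> nat by rewrite /= subnKC.
by rewrite in_gensE in_shift_set /= addKn -[(j - p)%N]/(val k) in_gensE.
Qed.

Lemma rho_diff t (z : chain m X) (U : {set 'I_m'}) : supp_above p z ->
  rho t (diff s z (shift_set U)) = diff s' [ffun V => rho t (z (shift_set V))] U.
Proof.
move=> zp; rewrite !ffunE raddf_sum big_mkcond big_split_ord /= big1 ?add0r => [|i _]; last first.
  case: ifP => // iU; rewrite zp ?raddf0 ?mul0rz ?raddf0 //.
  by rewrite aboveU1 /= leqNgt ltn_ord.
rewrite [RHS]big_mkcond; apply: eq_bigr => i _; rewrite in_shift_set; case: ifP => // iU.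
rewrite raddfMz ffunE shift_setU1 /=; congr (_ *~ _ ^+ _); last first.
  rewrite /rank -card_shift_set; apply: eq_card => j; rewrite inE.
  apply/andP/imsetP => [[/imsetP[k kU ->] ki]|[k]].
    by exists k => //; rewrite inE kU -(ltn_add2l p).
  by rewrite inE => /andP[kU ki] ->; rewrite in_shift_set kU ltn_add2l.
have [lo_i i_hi h out top] := runP U i.
have r : is_run (shift_set U) (p + run_lo U i) (rshift p i) (p + run_hi U i).
  split=> /= [|| j j1 j2 ji|j j1|]; rewrite ?leq_add2l ?ltn_add2l //.
  - by rewrite in_gens_shift h ?andbT; lia.
  - rewrite in_gens_shift; apply/negP => /andP[pj]; apply/negP/out; lia.
  - by rewrite in_gens_shift addKn leq_addr.
rewrite (merge_opE _ r) (merge_opE _ (runP U i)) [nat_of_ord (rshift p i)]/= !subnDl.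
by apply: (@shuffle_morph X X' s s' (rho t) p 0) => j y _ _; exact: rho_ops.
Qed.

(** Through the family [rho], X is a product of copies of X', indexed with repetitions; [rho_glue]
    accounts for the repetitions. Primitives are found in each copy and glued. *)
Lemma exact_transport k : exact_at m' s' k -> exact_above m s p k.
Proof.
move=> Ex z zk zp dz.
(* Choosing the primitive as a function of the chain alone ensures that equal maps [rho t] and
   [rho u] receive equal primitives, as [rho_glue] requires. *)
have /choice[W WP] : forall z' : chain m' X', exists w, homogeneous k z' ->
    diff s' z' = 0 -> homogeneous k.+1 w /\ diff s' w = z'.
  move=> z'; have [zk'|nk] := pselect (homogeneous k z'); last by exists 0.
  have [dz'|nd] := pselect (diff s' z' = 0); last by exists 0.
  by have [w wk wE] := Ex _ zk' dz'; exists w.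
pose zt t : chain m' X' := [ffun V => rho t (z (shift_set V))].
have ztP t : homogeneous k.+1 (W (zt t)) /\ diff s' (W (zt t)) = zt t.
  apply: WP => [U Uk|]; first by rewrite ffunE zk ?raddf0 // card_shift_set.
  by apply/ffunP => U; rewrite -rho_diff // dz !ffunE raddf0.
have /choice[y yP] : forall U : {set 'I_m'}, exists x, forall t, rho t x = W (zt t) U.
  move=> U; apply: rho_glue => t u tu; congr (W _ U).
  by apply/ffunP => V; rewrite !ffunE tu.
pose w : chain m X := [ffun U : {set 'I_m} => if above p U then y (unshift_set U) else 0].
have wp : supp_above p w by move=> U Up; rewrite ffunE (negbTE Up).
have rho_inj2 x x' : (forall t, rho t x = rho t x') -> x = x'.
  by move=> xx; apply/subr0_eq/rho_inj => t; rewrite raddfB xx subrr.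
exists w; split=> //.
  move=> U Uk; rewrite ffunE; case: ifP => // Up; apply: rho_inj => t.
  rewrite yP; apply: (ztP t).1; move: Uk; by rewrite -{1}(unshift_setK Up) card_shift_set.
apply/ffunP => U; have [Up|Up] := boolP (above p U); last first.
  by rewrite (supp_above_diff s wp Up) zp.
apply: rho_inj2 => t; rewrite -(unshift_setK Up) rho_diff //.
rewrite (_ : [ffun V => _] = W (zt t)); first by rewrite (ztP t).2 ffunE.
by apply/ffunP => V; rewrite !ffunE above_shift_set shift_setK yP.
Qed.

End Transport.

(** * Coinvariants and homology in degree 0 *)

Section ZerothHomology.
Variables (n : nat) (M : gmodule (braid_group n)).
Local Notation G := (braid_group n).

Definition zero_coinvariant (x : M) : Prop :=
  exists y : 'I_n.-1 -> M, x = \sum_l (y l - ops M l (y l)).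

Lemma zero_coinvariantB x y :
  zero_coinvariant x -> zero_coinvariant y -> zero_coinvariant (x - y).
Proof.
move=> [u ->] [v ->]; exists (fun l => u l - v l); rewrite -sumrB; apply: eq_bigr => l _.
have gen (a b c e : M) : (a - b) - (c - e) = (a - c) - (b - e).
  by rewrite !opprB addrACA [RHS]addrACA [- b - c]addrC.
by rewrite [ops M l (_ - _)]raddfB gen.
Qed.

Lemma zero_coinvariant0 : zero_coinvariant 0.
Proof. by exists (fun=> 0); rewrite big1 // => l _; rewrite raddf0 subr0. Qed.

Lemma zero_coinvariantD x y :
  zero_coinvariant x -> zero_coinvariant y -> zero_coinvariant (x + y).
Proof.
move=> hx hy; rewrite -[y]opprK; apply: zero_coinvariantB => //.
by rewrite -[- y]sub0r; apply: zero_coinvariantB => //; exact: zero_coinvariant0.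
Qed.

Lemma zero_coinvariant_gen (j : 'I_n.-1) x : zero_coinvariant (x - gm_act M (sigma j) x).
Proof.
exists (fun l => if l == j then x else 0); rewrite (bigD1 j) //= eqxx big1 ?addr0.
  by rewrite -[ops_fun _ _]/(ops M j x) opsE ?ltn_ord // genE.
by move=> l /negbTE ->; rewrite raddf0 subr0.
Qed.

(** Telescope along a word for g. An inverse letter is handled by y - s^-1 y = -(y' - s y') with y'
    = s^-1 y. *)
Lemma zero_coinvariant_act g x : zero_coinvariant (x - gm_act M g x).
Proof.
have [u ->] := braid_wordE g; elim: u => [|[j b] u IH].
  have -> : (braid_of_word [::] : G) = 1%g by [].
  by rewrite gm_act1 subrr; exact: zero_coinvariant0.
set y := gm_act M (braid_of_word u) x in IH.
have -> : braid_of_word ((j, b) :: u) = (braid_of_word [:: (j, b)] * braid_of_word u)%g.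
  by rewrite -(braid_mulE [:: (j, b)] u).
rewrite gm_actM -/y -[x in x - _](subrK y) -addrA; apply: zero_coinvariantD => //.
case: b; first exact: zero_coinvariant_gen.
set y' := gm_act M _ y; have -> : y = gm_act M (sigma j) y'.
  rewrite -gm_actM; have -> : (sigma j * braid_of_word [:: (j, false)])%g = 1%g.
    by rewrite sigma_mul; apply/braid_of_wordP; exact: (@braid_eq_cancel n j true).
  by rewrite gm_act1.
rewrite -opprB -sub0r; apply: zero_coinvariantB; first exact: zero_coinvariant0.
exact: zero_coinvariant_gen.
Qed.

(** Summing the coefficients of a bar 0-chain sends the boundary of [g] y to y - g y, and
    [zero_coinvariant_act] reduces g to generators. *)
Lemma homology0_zero_coinvariant :
  (forall c : homology M 0, c = 0) -> forall x, zero_coinvariant x.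
Proof.
move=> /homology_eq0P h x.
have [w wE] := h << x *g [ffun=> 1%g] >> isT.
pose tot : bar M 0 -> M :=
  mlift (fun _ : {ffun 'I_0 -> G} => (fun u v => erefl) : zmod_morphism (@id M)).
have totU gs y : tot << y *g gs >> = y by exact: mliftU.
have totB : zmod_morphism tot by exact: mlift_is_zmod_morphism.
have -> : x = tot (bar_bnd w) by rewrite wE totU.
move: (w) => v {wE}.
pose totz : {additive bar M 0 -> M} :=
  HB.pack tot (GRing.isZmodMorphism.Build (bar M 0) M tot totB).
rewrite -[tot _]/(totz _).
have -> : v = \sum_(gs <- msupp v) << v@_gs *g gs >> by exact: monalgE.
elim/big_rec: _ => [|gs u _ hu]; first by rewrite bar_bnd0 raddf0; exact: zero_coinvariant0.
rewrite bar_bndD raddfD; apply: zero_coinvariantD hu.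
rewrite bar_bnd_monom big_ord_recr big_ord1 raddfD !raddfMz /= !totU mulr1z mulrN1z.
have -> : bar_coef (widen_ord (leqnSn 1) ord0) gs v@_gs = v@_gs by [].
by rewrite /bar_coef eqxx; exact: zero_coinvariant_act.
Qed.

End ZerothHomology.

(** * Tensor powers of the braided space and the induction *)

Section BraidedSpace.
Variables (K : fieldType) (V : braided_space K).
Local Notation T := (braid_module V).

Lemma ops_slot n (i : 'I_n.-1) (x : tpow V n) : ops (T n) i x = at_slots (slot i) (bs_R V) x.
Proof. by rewrite opsE ?ltn_ord // genE; exact: braid_act_sigma. Qed.

(** The component of x along basis vectors fixed outside the image of f. A whole multi-index t
    records them; its entries at f are irrelevant ([slice_splice]). *)
Definition slice m n (f : 'I_m -> 'I_n) (t : mindex V n) (x : T n) : T m :=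
  [ffun a : mindex V m => x (splice f t a)].

Lemma slice_zmod_morphism m n (f : 'I_m -> 'I_n) t : zmod_morphism (slice f t).
Proof. by move=> x y; apply/ffunP => a; rewrite !ffunE. Qed.
HB.instance Definition _ m n (f : 'I_m -> 'I_n) t :=
  GRing.isZmodMorphism.Build (T n) (T m) (slice f t) (slice_zmod_morphism f t).

Lemma slice_splice m n (f : 'I_m -> 'I_n) t a x :
  slice f (splice f t a) x = slice f t x.
Proof. by apply/ffunP => b; rewrite !ffunE splice_splice. Qed.

Lemma slice_restr m n (f : 'I_m -> 'I_n) t (x : T n) :
  slice f t x (restr f t) = x t.
Proof. by rewrite ffunE splice_restr. Qed.

Lemma at_slotsE m n (f : 'I_m -> 'I_n) phi t (x : tpow V n) :
  at_slots f phi x t = phi (slice f t x) (restr f t).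
Proof. by rewrite ffunE. Qed.

Lemma slice_at_slots m n (f : 'I_m -> 'I_n) phi t (x : tpow V n) : injective f ->
  slice f t (at_slots f phi x) = phi (slice f t x).
Proof.
by move=> fI; apply/ffunP => a; rewrite ffunE at_slotsE slice_splice restr_splice.
Qed.

Lemma slot_comp m n p (f : 'I_m -> 'I_n) (j : 'I_m.-1) (i : 'I_n.-1) :
  (forall e, f e = (p + e)%N :> nat) -> i = (p + j)%N :> nat -> slot i = f \o slot j.
Proof. by move=> fE iE; apply/funext => e; apply/val_inj; rewrite /= fE iE addnA. Qed.

Lemma slice_ops m n p (f : 'I_m -> 'I_n) t (j : 'I_m.-1) (i : 'I_n.-1) (x : T n) :
  (forall e, f e = (p + e)%N :> nat) -> i = (p + j)%N :> nat ->
  slice f t (ops (T n) i x) = ops (T m) j (slice f t x).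
Proof.
move=> fE iE; have fI : injective f.
  by move=> d e /(congr1 val) /=; rewrite !fE => /addnI/val_inj.
have sE : at_slots (f \o slot j) (bs_R V) x = at_slots f (at_slots (slot j) (bs_R V)) x.
  by rewrite at_slots_at_slots.
by rewrite !ops_slot (slot_comp fE iE) sE; exact: slice_at_slots.
Qed.

(** Slicing by basis vectors in the first p factors splits the tensor power into copies of the n-th
    one, on each of which the generator p + j acts as the generator j. *)
Lemma exact_shift p n k : (0 < n)%N -> exact_at n.-1 (ops (T n)) k ->
  exact_above (p + n).-1 (ops (T (p + n))) p k.
Proof.
move=> n0; have -> : (p + n).-1 = (p + n.-1)%N by lia.
apply: (exact_transport (rho := fun t => slice (@rshift p n) t)).
- move=> t j x; have [jn|jn] := boolP (j < n.-1)%N; last by rewrite !ops_out ?raddf0 //; lia.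
  have pj : (p + j < (p + n).-1)%N by lia.
  exact: (@slice_ops _ _ p _ t (Ordinal jn) (Ordinal pj)).
- move=> x x0; apply/ffunP => t; rewrite -(slice_restr (@rshift p n)) x0.
  by rewrite !ffunE.
- move=> y yE; exists [ffun t : mindex V (p + n) => y t (restr (@rshift p n) t)] => t.
  apply/ffunP => a; rewrite !ffunE restr_splice; last exact: rshift_inj.
  by rewrite (yE _ t) // => x; exact: slice_splice.
Qed.

(** The witnesses are chosen on the basis and extended linearly: linearity is what allows [at_slots]
    to apply them to N of the n factors. *)
Lemma coinvariant_section N : (forall x : T N, zero_coinvariant x) ->
  exists h : 'I_N.-1 -> 'End(tpow V N),
    forall x, \sum_l (h l x - ops (T N) l (h l x)) = x.
Proof.
move=> hN; have /choice[Y YE] : forall a : mindex V N, exists y : 'I_N.-1 -> tpow V N,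
    tpow_delta a = \sum_l (y l - ops (T N) l (y l)) by move=> a; exact: hN.
have /choice[h hE] : forall l : 'I_N.-1, exists h : 'End(tpow V N),
    forall x, h x = \sum_a x a *: Y a l.
  move=> l; pose g (x : tpow V N) := \sum_a x a *: Y a l.
  have glin : linear g.
    move=> c x y; rewrite /g scaler_sumr -big_split; apply: eq_bigr => a _ /=.
    by rewrite !ffunE scalerDl scalerA.
  pose gl : {linear tpow V N -> tpow V N} :=
    HB.pack g (GRing.isLinear.Build K (tpow V N) (tpow V N) *:%R g glin).
  by exists (linfun gl) => x; rewrite lfunE.
exists h => x; rewrite [RHS]tpow_sum.
have E l : h l x - ops (T N) l (h l x) = \sum_a x a *: (Y a l - ops (T N) l (Y a l)).
  rewrite hE ops_slot linear_sum -sumrB; apply: eq_bigr => a _.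
  by rewrite linearZ /= -scalerBr -ops_slot.
rewrite (eq_bigr _ (fun l _ => E l)) exchange_big; apply: eq_bigr => a _ /=.
by rewrite -scaler_sumr -YE.
Qed.

(** The operators act on the first N factors only, so by [at_slotsC] they commute with every
    generator from N on; their defining sum is checked on slices. *)
Lemma coinvariant_exact N n k (z : chain n.-1 (T n)) : (N <= n)%N ->
  (forall x : T N, zero_coinvariant x) ->
  homogeneous k z -> supp_above N z -> diff (ops (T n)) z = 0 ->
  exists2 w, homogeneous k.+1 w & diff (ops (T n)) w = z.
Proof.
move=> Nn hN; have [h hE] := coinvariant_section hN.
pose f := widen_ord Nn; have f_inj : injective f by move=> d e [] /val_inj.
pose H (l : nat) : 'End(tpow V N) := if insub l is Some l' then h l' else 0.
apply: (@coinvariant_contract n.-1 (T n) (ops (T n)) N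
  (fun l : 'I_n.-1 => at_slots f (H l) : {additive T n -> T n})).
- move=> l j x lN Nj; have [jn|jn] := boolP (j < n.-1)%N; last first.
    by rewrite !ops_out // raddf0.
  rewrite -[j]/(val (Ordinal jn)) !ops_slot; apply: at_slotsC => //; first exact: slot_inj.
  move=> d e; rewrite -val_eqE /= neq_ltn; apply/orP; left.
  by have := ltn_ord d; lia.
- move=> x; apply/ffunP => t; rewrite -[RHS](slice_restr f) -[LHS](slice_restr f).
  congr ((_ : {ffun _ -> _}) _); set y := slice f t x.
  rewrite raddf_sum -[RHS]hE /=.
  pose F (l : nat) := H l y - ops (T N) l (H l y).
  rewrite (eq_bigr (fun l : 'I_n.-1 => F l)) => [|l lN]; last first.
    have lN' : (l < N.-1)%N by lia.
    rewrite raddfB /= (slice_at_slots _ _ _ f_inj); congr (_ - _).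
    by rewrite (@slice_ops _ _ 0 _ t (Ordinal lN')) // slice_at_slots.
  rewrite (eq_bigl (fun l : 'I_n.-1 => (l < N.-1)%N)) => [|l]; last by lia.
  rewrite -(big_ord_widen _ F); last by lia.
  by apply: eq_bigr => l _; rewrite /F /H valK.
Qed.

(** Strong induction on i. An inner induction on j up to N subtracts boundaries until the cycle has
    no generator below N, where [coinvariant_exact] finishes. *)
Theorem vanishing N : (2 <= N)%N -> homology_vanishes V N 0 ->
  forall i n, (N + N.+1 * i <= n)%N -> exact_at n.-1 (ops (T n)) i.
Proof.
move=> N2 /homology0_zero_coinvariant hN; elim/ltn_ind => i IH n Nn z zi dz.
have T_ops := ops_braid (T n).
suff [w [wi wN]] : exists w, homogeneous i.+1 w /\ supp_above N (z - diff (ops (T n)) w).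
  have [||||w' wi' wE] := @coinvariant_exact N n i (z - diff (ops (T n)) w) _ hN.
  - by lia.
  - by apply: homogeneousB => //; exact: homogeneous_diff.
  - by [].
  - by rewrite raddfB /= dz (diff_diff T_ops) subrr.
  exists (w' + w); first by move=> U Ui; rewrite ffunE wi' // wi // addr0.
  by rewrite raddfD /= wE subrK.
elim: {-2}N (leqnn N) => [|j IHj] jN.
  exists 0; split; first by move=> U _; rewrite ffunE.
  by rewrite raddf0 subr0 => U /aboveP[].
have [w [wi wj]] := IHj (ltnW jN).
(* In degree 0 a chain is supported on the empty set, so it already has no generator below N. *)
have [i0|i_gt0] := posnP i.
  exists 0; split; first by move=> U _; rewrite ffunE.
  rewrite raddf0 subr0 => U /forall_inPn[l lU _]; apply: zi; rewrite i0.
  by apply/eqP; rewrite cards_eq0; apply/set0Pn; exists l.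
set z' := z - diff (ops (T n)) w in wj.
have z'i : homogeneous i z' by apply: homogeneousB => //; exact: homogeneous_diff.
(* The elimination starts with ranges of i + 1 generators, on which a chain of degree i vanishes for
   reasons of size. *)
have jin : (j + i.+1 <= n.-1)%N by nia.
have [|||w' [wi' wj']] := first_block_elim T_ops jin _ z'i wj.
(* It suffices that [j + q <= N.+1 * (q - 1)]. This is tightest for q = 2 and j = N - 1, where both
   sides are N + 1. *)
- move=> q q2 qi; have qn : (N + N.+1 * (i.+1 - q) <= n - (j + q))%N by nia.
  have nE : n = (j + q + (n - (j + q)))%N by nia.
  rewrite nE; apply: exact_shift; first by lia.
  by apply: IH qn; lia.
- by rewrite raddfB /= dz (diff_diff T_ops) subrr.
- move=> U jU; apply: z'i; have := subset_leq_card jU; rewrite card_ord_range //; lia.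
exists (w + w'); split; first by move=> U Ui; rewrite ffunE wi // wi' // addr0.
by rewrite raddfD /= opprD addrA.
Qed.

End BraidedSpace.

Theorem corollary1p3 (R : realType) (V : braided_space R[i]) (N : nat)
    (hN : (2 <= N)%N) (hV : homology_vanishes V N 0) :
  (forall n i : nat, (1 <= n)%N ->
     i%:R <= n.+1%:R / N.+1%:R - 1 :> R -> homology_vanishes V n i) /\
  vanishes_with_slope V (1 / N.+1%:R).
Proof.
(* Clearing denominators gives (i + 1)(N + 1) <= n + 1, which is the bound N + (N + 1) i <= n of
   [vanishing]. *)
have main n i : i%:R <= n.+1%:R / N.+1%:R - 1 :> R -> homology_vanishes V n i.
  rewrite lerBrDr natr1 ler_pdivlMr ?ltr0Sn // -natrM ler_nat => ni.
  by apply: homology_eq0; apply: (vanishing hN hV); lia.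
split=> [n i _|]; first exact: main.
(* This constant is the value of (n + 1)/(N + 1) - 1 at n = 0. *)
exists (N.+1%:R^-1 - 1) => n i _ h; apply: main; apply: le_trans h _.
by rewrite mul1r -[n.+1%:R]natr1 mulrDl mul1r addrA mulrC.
Qed.
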